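(* Let $n=3p_1\cdots p_t q_1\cdots q_s\equiv 3,9,15\pmod{24}$, where $p_1,\dots,p_t,q_1,\dots,q_s$ are distinct odd primes with $p_i\equiv 1\pmod 3$, $q_j\equiv 2\pmod 3$, and $t+s\geqslant 1$. Let $P=p_1\cdots p_t$, $Q=q_1\cdots q_s$, and $E=E_{n,\frac{\pi}{3}}: y^2=x(x-n)(x+3n)$. (I.1) If $PQ\equiv 1\pmod 3$, then $S'(E)=\{1,n,-\frac{n}{3},-3\}$ if and only if $s=0$ and $G(n)$ (with $n=3p_1\cdots p_t$, $t\geqslant1$) is an odd graph. (I.2) If $PQ\equiv 2\pmod 3$, then $S'(E)=\{1,n,-\frac n3,-3\}$ if and only if $s=1$ and, in the graph $G(n)$, all nontrivial partitions $\{V_1,\overline V_1\}$ of $V=\{3,p_1,\dots,p_t,q_1\}$ with $V_1\subseteq\{p_1,\dots,p_t\}$ are odd. (II.1) If $PQ\equiv1\pmod3$ and $s=0$ (so $n=3p_1\cdots p_t$, $t\ge1$), then $S(E)=\{1\}$ if and only if $n\equiv 9\pmod{24}$ and $G(n/3)$ is an odd graph. (II.2) If $PQ\equiv 2\pmod 3$ and $s=1$ (so $n=3p_1\cdots p_tq_1$), then $S(E)=\{1\}$ if and only if, in the graph $G(-n)$, all nontrivial partitions $\{V_1,\overline V_1\}$ of $V=\{-1,3,p_1,\dots,p_t,q_1\}$ with $V_1\subseteq\{3,p_1,\dots,p_t\}$, $d(V_1)\equiv1\pmod 4$ and $\left(\frac{d(V_1)}{q_1}\right)=1$ are odd.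
   Context: Selmer groups: for an elliptic curve $E: y^2=x^3+Ax^2+Bx$ ($A,B\in\mathbb{Z}$, $B^2(A^2-4B)\ne0$), let $E': y^2=x^3-2Ax^2+(A^2-4B)x$, $M=\{\infty\}\cup\{p \text{ prime}: p\mid B^2(A^2-4B)\}$, $\mathbb{Q}_\infty=\mathbb{R}$, and $D\subseteq\mathbb{Q}^*/\mathbb{Q}^{*2}$ the subgroup generated by $-1$ and primes dividing $B^2(A^2-4B)$ (elements represented by square-free integers). For $p\in M$, $\delta_p:E'(\mathbb{Q}_p)\to\mathbb{Q}_p^*/\mathbb{Q}_p^{*2}$ sends $O\mapsto1$, $(0,0)\mapsto A^2-4B$, $(x,y)\mapsto x$ otherwise; $\delta'_p:E(\mathbb{Q}_p)\to\mathbb{Q}_p^*/\mathbb{Q}_p^{*2}$ sends $O\mapsto1$, $(0,0)\mapsto B$, $(x,y)\mapsto x$ otherwise. $S(E)=\{d\in D: d\in\mathrm{Im}\,\delta_p\ \forall p\in M\}$ and $S'(E)=\{d\in D: d\in\mathrm{Im}\,\delta'_p\ \forall p\in M\}$. For $E_{n,\frac{\pi}{3}}$, $A=2n$, $B=-3n^2$. Graphs: for $m=\pm r_1\cdots r_k$ (distinct primes, possibly including $3$), $G(m)$ is the directed graph with vertex set $\{r_1,\dots,r_k\}$ if $m>0$ and $\{-1,r_1,\dots,r_k\}$ if $m<0$, with an arc $r_i\to v$ ($v\ne r_i$) exactly when $r_i\equiv1\pmod3$ and the Legendre symbol $\left(\frac{v}{r_i}\right)=-1$ (no arcs leave $-1$,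 $3$, or primes $\equiv 2\pmod 3$). A partition $\{V_1,V_2\}$ of the vertex set is nontrivial if both parts are nonempty; it is odd if some vertex of one part has an odd number of arcs into the other part. The graph is odd if every nontrivial partition is odd. $\overline V_1$ is the complement of $V_1$ and $d(V_1)=\prod_{v\in V_1}v$. *)

(* Defs.v *)
From HB Require Import structures.
From mathcomp Require Import all_boot all_order all_algebra.
From mathcomp Require Import finmap.
From mathcomp Require Import boolp classical_sets reals.

Set Implicit Arguments.
Unset Strict Implicit.
Unset Printing Implicit Defensive.

Import Order.TTheory GRing.Theory Num.Theory.

(* The ring Z_p as the inverse limit of the Z/p^k: a p-adic integer is the
   sequence of its residues, the k-th one being reduced modulo p^k. *)
Record padic_int (p : nat) (p_pr : prime p) := PadicInt {
  residue :> nat -> nat;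
  residueP : forall k, residue k = residue k.+1 %% p ^ k }.

Section PadicInt.
Variables (p : nat) (p_pr : prime p).
Implicit Types x y z : padic_int p_pr.

HB.instance Definition _ := gen_eqMixin (padic_int p_pr).
HB.instance Definition _ := gen_choiceMixin (padic_int p_pr).

Lemma padic_eqP x y : residue x =1 residue y -> x = y.
Proof.
case: x y => [x xP] [y yP] /= /funext xy; rewrite xy in xP *.
by congr PadicInt; exact: Prop_irrelevance.
Qed.

Lemma residue_small x k : x k %% p ^ k = x k.
Proof. by rewrite [x k]residueP modn_mod. Qed.

Lemma residue_mod x i j : i <= j -> x j %% p ^ i = x i.
Proof.
elim: j => [|j IHj]; first by rewrite leqn0 => /eqP ->; exact: residue_small.
rewrite leq_eqVlt => /predU1P [->|]; first exact: residue_small.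
by rewrite ltnS => le_ij; rewrite -(IHj le_ij) [x j]residueP modn_dvdm ?dvdn_exp2l.
Qed.

Fact modpX_coherent (f : nat -> nat) :
  (forall k, f k = f k.+1 %[mod p ^ k]) ->
  forall k, f k %% p ^ k = (f k.+1 %% p ^ k.+1) %% p ^ k.
Proof. by move=> fP k; rewrite modn_dvdm ?dvdn_exp2l // fP. Qed.

Fact padic_nat_subproof (n : nat) k : n = n %[mod p ^ k].
Proof. by []. Qed.
Definition padic_nat (n : nat) : padic_int p_pr :=
  PadicInt p_pr (modpX_coherent (padic_nat_subproof n)).

Fact padic_add_subproof x y k : x k + y k = x k.+1 + y k.+1 %[mod p ^ k].
Proof. by rewrite (residueP x) (residueP y) modnDm. Qed.
Definition padic_add x y : padic_int p_pr :=
  PadicInt p_pr (modpX_coherent (padic_add_subproof x y)).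

Fact padic_mul_subproof x y k : x k * y k = x k.+1 * y k.+1 %[mod p ^ k].
Proof. by rewrite (residueP x) (residueP y) modnMm. Qed.
Definition padic_mul x y : padic_int p_pr :=
  PadicInt p_pr (modpX_coherent (padic_mul_subproof x y)).

Lemma residue_lt x k : x k < p ^ k.
Proof. by rewrite -residue_small ltn_mod expn_gt0 prime_gt0. Qed.

Fact padic_opp_subproof x k :
  p ^ k - x k = p ^ k.+1 - x k.+1 %[mod p ^ k].
Proof.
apply/eqP; rewrite -(eqn_modDr (x k)) subnK ?(ltnW (residue_lt _ _)) // modnn.
rewrite [x k]residueP modnDmr subnK ?(ltnW (residue_lt _ _)) //.
by rewrite eq_sym; apply: dvdn_exp2l.
Qed.
Definition padic_opp x : padic_int p_pr :=
  PadicInt p_pr (modpX_coherent (padic_opp_subproof x)).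

Fact padic_addA : associative padic_add.
Proof. by move=> x y z; apply: padic_eqP => k /=; rewrite modnDml modnDmr addnA. Qed.
Fact padic_addC : commutative padic_add.
Proof. by move=> x y; apply: padic_eqP => k /=; rewrite addnC. Qed.
Fact padic_add0 : left_id (padic_nat 0) padic_add.
Proof. by move=> x; apply: padic_eqP => k /=; rewrite mod0n add0n residue_small. Qed.
Fact padic_addN : left_inverse (padic_nat 0) padic_opp padic_add.
Proof.
move=> x; apply: padic_eqP => k /=.
by rewrite modnDml subnK ?(ltnW (residue_lt _ _)) // modnn mod0n.
Qed.
HB.instance Definition _ := GRing.isZmodule.Build (padic_int p_pr)
  padic_addA padic_addC padic_add0 padic_addN.

Fact padic_mulA : associative padic_mul.
Proof. by move=> x y z; apply: padic_eqP => k /=; rewrite modnMml modnMmr mulnA. Qed.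
Fact padic_mulC : commutative padic_mul.
Proof. by move=> x y; apply: padic_eqP => k /=; rewrite mulnC. Qed.
Fact padic_mul1 : left_id (padic_nat 1) padic_mul.
Proof. by move=> x; apply: padic_eqP => k /=; rewrite modnMml mul1n residue_small. Qed.
Fact padic_mulDl : left_distributive padic_mul padic_add.
Proof.
by move=> x y z; apply: padic_eqP => k /=; rewrite modnMml modnDm mulnDl.
Qed.
Fact padic_one_neq0 : padic_nat 1 != 0%R.
Proof.
apply/eqP => /(congr1 (fun x : padic_int p_pr => x 1)) /=.
by rewrite expn1 mod0n modn_small ?prime_gt1.
Qed.
HB.instance Definition _ := GRing.Zmodule_isComNzRing.Build (padic_int p_pr)
  padic_mulA padic_mulC padic_mul1 padic_mulDl padic_one_neq0.

Local Open Scope ring_scope.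

Definition padic_unit : pred (padic_int p_pr) :=
  fun x => `[< exists y : padic_int p_pr, y * x = 1 >].
Definition padic_inv x : padic_int p_pr :=
  if pselect (exists y : padic_int p_pr, y * x = 1) is left ex
  then projT1 (cid ex) else x.

Fact padic_mulVr : {in padic_unit, left_inverse 1 padic_inv *%R}.
Proof.
move=> x /asboolP ux; rewrite /padic_inv; case: pselect => // ex.
by case: (cid ex).
Qed.
Fact padic_unitP x y : y * x = 1 -> padic_unit x.
Proof. by move=> yx1; apply/asboolP; exists y. Qed.
Fact padic_inv_out : {in [predC padic_unit], padic_inv =1 id}.
Proof.
by move=> x /asboolP nux; rewrite /padic_inv; case: pselect.
Qed.
HB.instance Definition _ := GRing.ComNzRing_hasMulInverse.Build (padic_int p_pr)
  padic_mulVr padic_unitP padic_inv_out.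

Fact padic_mulf_eq0 x y : x * y = 0 -> (x == 0) || (y == 0).
Proof.
move=> xy0; apply/norP => -[x_neq0 y_neq0].
have nz z : z != 0 -> exists k, z k != 0%N.
  move=> z_neq0; apply: contrapT => nex; move/eqP: z_neq0; apply.
  apply: padic_eqP => k /=; rewrite mod0n; apply: contrapT => /eqP zk.
  by apply: nex; exists k.
have [i xi] := nz _ x_neq0; have [j yj] := nz _ y_neq0.
have big z k l : (k <= l)%N -> z k != 0%N -> (0 < z l)%N /\ (logn p (z l) < k)%N.
  move=> le_kl; rewrite -(residue_mod z le_kl) => zk.
  have zl : (0 < z l)%N by rewrite lt0n; apply: contraNneq zk => ->; rewrite mod0n.
  by split=> //; rewrite ltnNge -pfactor_dvdn.
have [x_gt0 xlog] := big x _ _ (leq_addr j i) xi.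
have [y_gt0 ylog] := big y _ _ (leq_addl i j) yj.
have := congr1 (fun z : padic_int p_pr => z (i + j)%N) xy0; rewrite /= mod0n.
move/eqP; rewrite -/(dvdn _ _) pfactor_dvdn ?muln_gt0 ?x_gt0 // lognM //.
by rewrite leqNgt -addSn leq_add // ltnW.
Qed.
HB.instance Definition _ := GRing.ComUnitRing_isIntegral.Build (padic_int p_pr)
  padic_mulf_eq0.

End PadicInt.

Definition padic (p : nat) (p_pr : prime p) : fieldType :=
  {fraction padic_int p_pr}.

Local Open Scope ring_scope.
Local Open Scope classical_set_scope.

Inductive place := Infinite | Finite p of prime p.

Definition completion (R : realType) (v : place) : fieldType :=
  match v with
  | Infinite => R
  | Finite _ p_pr => padic p_pr
  end.

(* The curve y^2 = x^3 + A x^2 + B x; nonsingularity, i.e. badness E != 0,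
   is not part of the structure. *)
Record curve := Curve { coefA : int; coefB : int }.

Definition isogenous (E : curve) : curve :=
  Curve (- 2 * coefA E) (coefA E ^+ 2 - 4 * coefB E).

Definition badness (E : curve) : int :=
  coefB E ^+ 2 * (coefA E ^+ 2 - 4 * coefB E).

Inductive point (K : Type) := Origin | Affine of K & K.
Arguments Origin {K}.

Definition points (E : curve) (K : fieldType) : set (point K) :=
  [set P | match P with
           | Origin => True
           | Affine x y =>
               y ^+ 2 = x ^+ 3 + (coefA E)%:~R * x ^+ 2 + (coefB E)%:~R * x
           end].
Arguments points : clear implicits.

(* For a != 0, the class of a in K^* / K^*2, as a coset. *)
Definition sqclass (K : fieldType) (a : K) : set K :=
  [set a * u ^+ 2 | u in [set u : K | u != 0]].

(* On E this is delta'; on isogenous E, whose last coefficient is A^2 - 4B,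
   it is delta. A point with x = 0 is (0, 0). *)
Definition descent_map (E : curve) (K : fieldType) (P : point K) : set K :=
  match P with
  | Origin => sqclass 1
  | Affine x _ => sqclass (if x == 0 then (coefB E)%:~R else x)
  end.

Definition descent_image (E : curve) (K : fieldType) : set (set K) :=
  [set descent_map E P | P in points E K].
Arguments descent_image : clear implicits.

Definition bad_places (E : curve) : set place :=
  [set v | match v with
           | Infinite => True
           | Finite p _ => (p %| badness E)%Z
           end].

(* The square-free representatives of the subgroup of Q^* / Q^*2 generated by
   -1 and the primes dividing badness E. *)
Definition bad_sqfree (E : curve) : set int :=
  [set d | forall p : nat, prime p ->
     ~~ (p%:Z ^+ 2 %| d)%Z /\ ((p %| d)%Z -> (p %| badness E)%Z)].

Definition Selmer (R : realType) (E : curve) : set int :=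
  [set d | bad_sqfree E d /\ forall v, bad_places E v ->
     descent_image (isogenous E) (completion R v) (sqclass d%:~R)].

Definition Selmer' (R : realType) (E : curve) : set int :=
  [set d | bad_sqfree E d /\ forall v, bad_places E v ->
     descent_image E (completion R v) (sqclass d%:~R)].

Definition curve_pi3 (n : nat) : curve := Curve (2 * n%:Z) (- 3 * n%:Z ^+ 2).

Definition legendre (a : int) (p : nat) : int :=
  if (p %| a)%Z then 0
  else if [exists x : 'I_p, (x%:Z ^+ 2 == a %[mod p])%Z] then 1 else -1.

Record digraph := Digraph { vertices : {fset int}; arc : rel int }.

Definition residue_graph (m : int) : digraph :=
  Digraph
    [fset v in (if m < 0 then [:: -1] else [::]) ++
               [seq r%:Z | r <- primes `|m|%N]]%fset
    (fun r v => [&& r != v, 0 < r, (r == 1 %[mod 3])%Z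
                  & legendre v `|r|%N == -1]).

Definition nontrivial_partition (G : digraph) (V1 V2 : {fset int}) : Prop :=
  [/\ V1 != fset0, V2 != fset0, [disjoint V1 & V2]%fset
    & (V1 `|` V2)%fset = vertices G].

Definition arcs_into (G : digraph) (v : int) (W : {fset int}) : nat :=
  #|` [fset w in W | arc G v w]%fset |.

Definition odd_partition (G : digraph) (V1 V2 : {fset int}) : Prop :=
  (exists2 v, v \in V1 & odd (arcs_into G v V2)) \/
  (exists2 v, v \in V2 & odd (arcs_into G v V1)).

Definition odd_graph (G : digraph) : Prop :=
  forall V1 V2, nontrivial_partition G V1 V2 -> odd_partition G V1 V2.

Definition vertex_prod (V : {fset int}) : int := \prod_(v <- V) v.

(* Main.v *)
(** Both Selmer groups are cut out by local conditions, place by place. A class [d] lies in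
    the local image iff the homogeneous space [d z^2 = d^2 a^4 + A d a^2 b^2 + B b^4] has a
    [p]-adic point; scaling it to be primitive and reducing modulo a small power of [p]
    bounds the image from above, and the 2-torsion points together with a few explicit
    integral points, lifted by Hensel's lemma, show that the bound is attained. With
    [m = n / 3], this gives: for [S'], [d] is odd, [d] lies in [<n>] inside
    [Q_p^* / Q_p^*2] for [p = 1 mod 3], and in [<-3>] at 3 if [m = 2 mod 3]; for [S],
    [d > 0], [d = 1 mod 4], [d] lies in [<-n>] for [p = 1 mod 3], is a square at
    [q = 2 mod 3], and at 3 lies in [<3>] or is a square according to [m] modulo 3.

    Divisors [d] correspond to vertex sets [V1] of the residue graph of [M = +-n] or [m],
    and if [d1 d2 = M] are the products of the two parts of a partition then
    [d1 M = d2 d1^2], so the conditions at all [p = 1 mod 3] say exactly that no vertex has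
    an odd number of arcs into the other part. The bound on [s] is a pigeonhole count: the
    conditions on the [2^(t+s)] divisors of [m] are [t] or [t + 1] conditions of index two. *)

Require Import Defs.
From HB Require Import structures.
From mathcomp Require Import all_boot all_order all_algebra.
From mathcomp Require Import all_fingroup all_solvable finfield.
From mathcomp Require Import finmap.
From mathcomp Require Import boolp classical_sets reals.
From mathcomp Require Import zify ring.
(* [coefB] also names a lemma of poly.v. *)
Import Defs.

Set Implicit Arguments.
Unset Strict Implicit.
Unset Printing Implicit Defensive.

Import Order.TTheory GRing.Theory Num.Theory.

Local Open Scope ring_scope.
Local Open Scope classical_set_scope.

(** * Quadratic residues *)

(** The target {1, n, -n/3, -3} of S' is the image of the 2-torsion of E: (n, 0), (0, 0) and (-3n,
    0) have classes n, -3 and -3n, and -3n = -9 (n/3). On E' the point (0, 0) has class 16 n^2, a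
    square, whence the target {1} for S. Primes p = 1 mod 3 stand apart because -3 is a square
    there: the torsion classes on E shrink to those of 1 and n, and E' acquires its full 2-torsion.

    The field [padic] is a bare fraction field without a valuation. Primitive pairs take its place:
    two elements, not both zero, are a common multiple of two p-adic integers one of which is a
    unit. When denominators are cleared in this way, the square-freeness of d forces the denominator
    of z to be a unit; from there on the upper bounds are divisibilities between ordinary integers.

    The residue of n mod 24 enters through n mod 8, which is never 5. *)

Definition qres (p : nat) (a : int) : Prop := exists x : int, (p %| x ^+ 2 - a)%Z.

Lemma dvdzE_Fp (p : nat) (a : int) : prime p ->
  (p %| a)%Z = (a%:~R == 0 :> 'F_p).
Proof.
move=> p_pr; rewrite dvdzE absz_nat.
rewrite (dvdn_pcharf (pchar_Fp p_pr)).
by case: a => k; rewrite ?NegzE ?abszN ?mulrNz ?oppr_eq0.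
Qed.

Lemma qres_Fp (p : nat) (a : int) : prime p ->
  qres p a <-> exists y : 'F_p, y ^+ 2 = a%:~R.
Proof.
move=> p_pr; split=> [[x]|[y yE]].
  rewrite dvdzE_Fp // rmorphB rmorphXn /= subr_eq0 => /eqP xE.
  by exists (x%:~R).
exists (Posz y); rewrite dvdzE_Fp // rmorphB rmorphXn /= subr_eq0 -yE.
by rewrite -pmulrn natr_Zp.
Qed.

(** The unit group is cyclic, and a non-square is an odd power of a generator. *)
Lemma nonsquare_mul (F : finFieldType) (a b : F) : a != 0 -> b != 0 ->
  ~ (exists y, y ^+ 2 = a) -> ~ (exists y, y ^+ 2 = b) ->
  exists y, y ^+ 2 = a * b.
Proof.
have [g gP] := cyclicP (field_unit_group_cyclic [group of [set: {unit F}]]).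
have powP (c : F) : c != 0 -> exists i, c = val g ^+ i.
  rewrite -unitfE => c_unit; have: FinRing.unit F c_unit \in <[g]>%g.
    by rewrite -gP inE.
  by case/cycleP=> i /(congr1 val) /=; rewrite FinRing.val_unitX => ->; exists i.
have oddP i : ~ (exists y, y ^+ 2 = val g ^+ i) -> odd i.
  move=> nsq; apply/negP => /negP ev; apply: nsq; exists (val g ^+ i./2).
  by rewrite -exprM muln2 even_halfK.
move=> /powP [i ->] /powP [j ->] /oddP oi /oddP oj.
by exists (val g ^+ (i + j)./2); rewrite -exprM muln2 even_halfK ?exprD // oddD oi oj.
Qed.

Lemma dvdz_mulP (p : nat) (a b : int) : prime p ->
  (p %| a * b)%Z = (p %| a)%Z || (p %| b)%Z.
Proof. by move=> p_pr; rewrite !dvdzE abszM Euclid_dvdM. Qed.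

Lemma dvdz_sqr (p : nat) (a : int) : prime p -> (p %| a ^+ 2)%Z = (p %| a)%Z.
Proof. by move=> p_pr; rewrite expr2 dvdz_mulP // orbb. Qed.

Lemma qres_sqr p a : qres p (a ^+ 2).
Proof. by exists a; rewrite subrr dvdz0. Qed.

Lemma qres1 p : qres p 1.
Proof. by exists 1; rewrite expr1n subrr dvdz0. Qed.

Lemma qres_mul (p : nat) (a b : int) : qres p a -> qres p b -> qres p (a * b).
Proof.
move=> [x /dvdzP [u xa]] [y /dvdzP [v yb]]; exists (x * y); apply/dvdzP.
exists (u * b + v * x ^+ 2); have -> : a = x ^+ 2 - u * p by rewrite -xa; ring.
have -> : b = y ^+ 2 - v * p by rewrite -yb; ring.
by ring.
Qed.

Lemma nqres_mul (p : nat) (a b : int) : prime p -> ~~ (p %| a)%Z -> ~~ (p %| b)%Z ->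
  ~ qres p a -> ~ qres p b -> qres p (a * b).
Proof.
move=> p_pr; rewrite !dvdzE_Fp // !qres_Fp // rmorphM /=.
exact: nonsquare_mul.
Qed.

Lemma qres_mulr (p : nat) (a b : int) : prime p -> ~~ (p %| b)%Z ->
  qres p b -> qres p (a * b) -> qres p a.
Proof.
move=> p_pr pb; rewrite !qres_Fp // => -[y yb] [z zab].
have b0 : (b%:~R : 'F_p) != 0 by rewrite -dvdzE_Fp.
exists (z / y); rewrite expr_div_n zab yb rmorphM /=.
by rewrite mulfK.
Qed.

Lemma qres_mulsqr (p : nat) (a b : int) : prime p -> ~~ (p %| b)%Z ->
  qres p (a * b ^+ 2) -> qres p a.
Proof.
by move=> p_pr pb; apply: qres_mulr => //; [rewrite dvdz_sqr|exact: qres_sqr].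
Qed.

(** As 3 divides [p - 1], the cyclic unit group contains a primitive cube root of unity [w], and
    [(2 * w + 1) ^+ 2 = - 3]. *)
Lemma qres_N3 (p : nat) : prime p -> (p %% 3 = 1)%N -> qres p (- 3).
Proof.
move=> p_pr p1; apply/qres_Fp => //.
have p_gt1 := prime_gt1 p_pr.
have [g gP] := cyclicP (field_unit_group_cyclic [group of [set: {unit 'F_p}]]).
have og : #[g]%g = p.-1.
  rewrite orderE -gP; have := card_finField_unit 'F_p.
  by rewrite card_Fp.
have d3 : (3 %| p.-1)%N by lia.
set w : 'F_p := val g ^+ (p.-1 %/ 3).
have w3 : w ^+ 3 = 1.
  by rewrite -exprM divnK // -og -FinRing.val_unitX expg_order.
have w1 : w != 1.
  apply/eqP; rewrite /w -FinRing.val_unitX => gw1.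
  have /eqP: (g ^+ (p.-1 %/ 3) = 1)%g by apply: val_inj; rewrite /= gw1.
  by rewrite -order_dvdn og => /dvdn_leq; lia.
have w0 : w ^+ 2 + w + 1 = 0.
  apply: (mulfI (x := w - 1)); first by rewrite subr_eq0.
  have -> : (w - 1) * (w ^+ 2 + w + 1) = w ^+ 3 - 1 by ring.
  by rewrite w3 subrr mulr0.
exists (2 * w + 1).
have -> : (2 * w + 1) ^+ 2 = 4 * (w ^+ 2 + w + 1) - 3 by ring.
by rewrite w0 mulr0 sub0r rmorphN.
Qed.

(** A square root [y] of -3 would give [w = (y - 1) / 2] with [w ^+ 3 = 1]; as [p = 2] mod 3, the
    Frobenius identity [w ^+ p = w] forces [w ^+ 2 = w], so [w = 1] and 3 = 0. *)
Lemma nqres_N3 (p : nat) : prime p -> odd p -> (p %% 3 = 2)%N -> ~ qres p (- 3).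
Proof.
move=> p_pr p_odd p2; rewrite qres_Fp // => -[y]; rewrite rmorphN /= => y2.
have n2 : (2 : 'F_p) != 0.
  rewrite -[2]/(2%:~R) -dvdzE_Fp //; apply/negP => /(dvdn_leq (isT : 0 < 2)%N).
  by have := prime_gt1 p_pr; lia.
have n3 : (3 : 'F_p) != 0.
  rewrite -[3]/(3%:~R) -dvdzE_Fp //; change (~~ (p %| 3)%N).
  by rewrite dvdn_prime2 //; apply/eqP; lia.
set w : 'F_p := (y - 1) / 2.
have w0 : w ^+ 2 + w + 1 = 0.
  apply: (mulfI (x := 2 ^+ 2)); first by rewrite expf_neq0.
  have yE : y = 2 * w + 1 by rewrite mulrC divfK //; ring.
  have -> : 2 ^+ 2 * (w ^+ 2 + w + 1) = (2 * w + 1) ^+ 2 + 3 by ring.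
  by rewrite -yE y2 mulr0 addrC subrr.
have w3 : w ^+ 3 = 1.
  apply/eqP; rewrite -subr_eq0.
  have -> : w ^+ 3 - 1 = (w - 1) * (w ^+ 2 + w + 1) by ring.
  by rewrite w0 mulr0.
have wp : w ^+ p = w.
  have := expf_card w; by rewrite card_Fp.
have [k pE] : exists k, p = (3 * k + 2)%N by exists (p %/ 3)%N; lia.
have ww : w ^+ 2 = w.
  have : w ^+ (3 * k + 2) = w by rewrite -pE.
  by rewrite exprD exprM w3 expr1n mul1r.
have w1 : w = 1.
  have w_neq0 : w != 0.
    by apply/eqP => w00; move/eqP: w3; rewrite w00 expr0n eq_sym oner_eq0.
  by apply: (mulfI w_neq0); rewrite mulr1 -expr2.
move/eqP: w0; rewrite w1 expr1n.
have -> : 1 + 1 + 1 = 3 :> 'F_p by ring.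
by rewrite (negPf n3).
Qed.

Lemma legendre_eqN1 a p : prime p -> (legendre a p == -1) = ~~ `[< qres p a >].
Proof.
move=> p_pr; rewrite /legendre; case: ifP => [pa|npa].
  apply/esym/negbTE; rewrite negbK; apply/asboolP; exists 0.
  by rewrite expr0n sub0r rpredN.
have -> : [exists x : 'I_p, (x%:Z ^+ 2 == a %[mod p])%Z] = `[< qres p a >].
  apply/existsP/asboolP => [[x]|[x xa]]; first by rewrite eqz_mod_dvd; exists x.
  have p_neq0 : Posz p != 0 by have := prime_gt0 p_pr; lia.
  have x_lt : (`|(x %% p)%Z| < p)%N.
    by have := modz_ge0 x p_neq0; have := ltz_mod x p_neq0; lia.
  by exists (Ordinal x_lt) => /=; rewrite gez0_abs ?modz_ge0 // modzXm eqz_mod_dvd.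
by case: `[< _ >].
Qed.

Lemma legendre_eq1 a p : prime p ->
  legendre a p = 1 <-> ~~ (p %| a)%Z /\ qres p a.
Proof.
move=> p_pr; have := legendre_eqN1 a p_pr; rewrite /legendre.
case: (p %| a)%Z => [_|]; first by split=> // -[].
case: ifP => _ /esym H; split=> //.
- by move=> _; split=> //; move/negbFE/asboolP: H.
- by move=> [_ qr]; move: H; rewrite asboolT.
Qed.

(** Turns a combination of known divisibilities into the desired one, leaving a polynomial identity
    to [ring]. *)
Lemma dvdz_conv (d a b : int) : (d %| a)%Z -> a = b -> (d %| b)%Z.
Proof. by move=> da <-. Qed.

Lemma linear_congruence (p : nat) (e a : int) : prime p -> ~~ (p %| a)%Z ->
  exists s : int, (p %| e + a * s)%Z.
Proof.
move=> p_pr; rewrite dvdzE_Fp // => a0.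
pose y : 'F_p := - e%:~R / a%:~R.
have yE : (y : nat)%:R = y by exact: natr_Zp.
exists (y : nat)%:Z; rewrite dvdzE_Fp // rmorphD rmorphM /=.
have -> : (Posz y)%:~R = y by exact: yE.
by rewrite /y mulrC divfK // subrr.
Qed.

Lemma coprimez_prime (p : nat) (a : int) : prime p -> coprimez p a = ~~ (p %| a)%Z.
Proof. by move=> p_pr; rewrite coprimezE absz_nat prime_coprime // dvdzE absz_nat. Qed.

Lemma prime_dvdz1 (p : nat) : prime p -> (1%R : int) \in dvdz p = false.
Proof. by move=> p_pr; rewrite dvdzE dvdn1; apply: gtn_eqF; exact: prime_gt1. Qed.

(** * p-adic integers, Hensel's lemma *)

Section PadicCongruence.
Variables (p : nat) (p_pr : prime p).
Local Notation Zp := (padic_int p_pr).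
Implicit Types (x y : Zp) (z c : int) (k : nat).

(** Congruence of a p-adic integer with an ordinary one. It is compatible with the ring operations,
    so identities between p-adic integers descend to divisibilities. *)
Definition congp k x z := ((p ^ k)%N %| (x k)%:Z - z)%Z.

Lemma modp_cong k (i : nat) : ((p ^ k)%N %| (i %% p ^ k)%N%:Z - i%:Z)%Z.
Proof. by rewrite -eqz_mod_dvd !modz_nat modn_mod. Qed.

Lemma congp_residue k x : congp k x (x k).
Proof. by rewrite /congp subrr dvdz0. Qed.

Lemma congpD k x y z1 z2 : congp k x z1 -> congp k y z2 -> congp k (x + y) (z1 + z2).
Proof.
move=> xz yz; apply: dvdz_conv (rpredD (modp_cong k (x k + y k)) (rpredD xz yz)) _.
by rewrite PoszD /=; ring.
Qed.

Lemma congpM k x y z1 z2 : congp k x z1 -> congp k y z2 -> congp k (x * y) (z1 * z2).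
Proof.
move=> xz yz; apply: dvdz_conv (rpredD (modp_cong k (x k * y k))
  (rpredD (dvdz_mull z2 xz) (dvdz_mull (x k)%:Z yz))) _.
by rewrite PoszM /=; ring.
Qed.

Lemma congp1 k : congp k 1 1.
Proof. exact: modp_cong. Qed.

Lemma congpN k x z : congp k x z -> congp k (- x) (- z).
Proof.
move=> xz.
apply: dvdz_conv (rpredD (modp_cong k (p ^ k - x k)) (rpredB (dvdzz (p ^ k)%N) xz)) _.
by rewrite -subzn ?(ltnW (residue_lt _ _)) //=; ring.
Qed.

Lemma congpX k x z i : congp k x z -> congp k (x ^+ i) (z ^+ i).
Proof.
by move=> xz; elim: i => [|i IHi]; [exact: congp1|rewrite !exprS; exact: congpM].
Qed.

Lemma congp_int k c : congp k c%:~R c.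
Proof.
have nat_case i : congp k i%:R i.
  elim: i => [|i IHi]; first exact: modp_cong.
  by rewrite -addn1 natrD PoszD; apply: congpD => //; exact: congp1.
by case: c => i; [exact: nat_case | rewrite NegzE mulrNz; apply/congpN/nat_case].
Qed.

Lemma congp_dvd k x z1 z2 : congp k x z1 -> congp k x z2 -> ((p ^ k)%N %| z1 - z2)%Z.
Proof. by move=> xz1 xz2; apply: dvdz_conv (rpredB xz2 xz1) _; ring. Qed.

Lemma congp_eq x y : (forall k, congp k x (y k)) -> x = y.
Proof.
move=> xy; apply: padic_eqP => k.
have := xy k; rewrite /congp -eqz_mod_dvd !modz_nat !residue_small.
by move=> /eqP [].
Qed.

Lemma intr_padic_int_eq0 c : ((c%:~R : Zp) == 0) = (c == 0).
Proof.
apply/eqP/eqP => [c0|->//].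
have := congp_int `|c|%N c; rewrite c0 /congp /= mod0n sub0r rpredN dvdzE absz_nat.
have := ltn_expl `|c|%N (prime_gt1 p_pr).
have [-> //|c_neq0] := eqVneq c 0.
move=> lt /dvdn_leq -/(_ _); rewrite absz_gt0 c_neq0 leqNgt lt => H.
by have := H isT.
Qed.

Lemma dvdz_residue k x : (0 < k)%N -> (p %| (x k)%:Z)%Z = (x 1 == 0%N).
Proof.
by move=> k0; rewrite dvdzE !absz_nat /dvdn -[X in (_ %% X)%N]expn1 (residue_mod x k0).
Qed.

(** * Division by p, fractions and primitive pairs *)

(** The quotient has [x k.+1 %/ p] as its [k]-th residue: dividing by [p] costs one digit of
    precision. *)
Lemma residue1_eq0 x : x 1 = 0%N -> exists y, x = p%:R * y.
Proof.
move=> x1; have px k : (p %| x k.+1)%N.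
  by rewrite /dvdn -[X in (_ %% X)%N]expn1 (residue_mod x) // x1.
have yP k : (x k.+1 %/ p = x k.+2 %/ p %[mod p ^ k])%N.
  by rewrite !modn_divl -!expnSr -residueP residue_small.
exists (PadicInt p_pr (modpX_coherent yP)); apply: congp_eq => -[|k].
  by rewrite /congp expn0 dvd1z.
have kE : PadicInt p_pr (modpX_coherent yP) k.+1 = (x k.+2 %/ p)%N.
  by rewrite /= modn_small // ltn_divLR ?prime_gt0 // -expnSr residue_lt.
have := congpM (congp_int k.+1 p) (congp_residue k.+1 (PadicInt p_pr (modpX_coherent yP))).
rewrite kE -PoszM mulnC divnK // => pyx.
apply: dvdz_conv (rpredB (modp_cong k.+1 (x k.+2)) pyx) _.
by rewrite -residueP; ring.
Qed.

End PadicCongruence.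

Lemma fraction_div (A : idomainType) (x : {fraction A}) :
  exists a b : A, b != 0 /\ x = (tofrac a) / (tofrac b).
Proof.
elim/quotW: x => x; exists \n_x, \d_x; split; first exact: denom_ratioP.
apply: (canRL (mulfK _)); first by rewrite tofrac_eq0 denom_ratioP.
rewrite -[_ * _]/(FracField.mul _ _) !piE /FracField.mulf.
rewrite !numden_Ratio ?oner_neq0 // mulr1.
by apply/eqmodP; rewrite /= FracField.equivfE !numden_Ratio ?oner_neq0 ?denom_ratioP // mulr1 mulrC.
Qed.

Lemma fraction_common_denominator (A : idomainType) (x y : {fraction A}) :
  exists (c : {fraction A}) (a b : A), [/\ c != 0, x = c * tofrac a & y = c * tofrac b].
Proof.
have [a [b [b0 ->]]] := fraction_div x; have [a' [b' [b0' ->]]] := fraction_div y.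
have fb : tofrac b != 0 by rewrite tofrac_eq0.
have fb' : tofrac b' != 0 by rewrite tofrac_eq0.
exists (tofrac b * tofrac b')^-1, (a * b'), (a' * b); rewrite !tofracM invr_neq0 ?mulf_neq0 //.
split=> //; rewrite [RHS]mulrC; first by rewrite -mulf_div divff // mulr1.
by rewrite [tofrac b * tofrac b']mulrC -mulf_div divff // mulr1.
Qed.

Section PadicPrimitive.
Variables (p : nat) (p_pr : prime p).
Local Notation Zp := (padic_int p_pr).
Local Notation Qp := (padic p_pr).

(** Stands in for the valuation: some residue of [x] or [y] is nonzero at an index [k], and each
    common division by [p] lowers this index, so the extraction of factors [p] stops. *)
Lemma padic_int_primitive (x y : Zp) : (x != 0) || (y != 0) ->
  exists c x' y' : Zp, [/\ c != 0, x = c * x', y = c * y' &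
    (x' 1 != 0%N) || (y' 1 != 0%N)].
Proof.
have p_neq0 : (p%:R : Zp) != 0.
  by rewrite -[p%:R]/((Posz p)%:~R) intr_padic_int_eq0; have := prime_gt0 p_pr; lia.
have nz (z : Zp) : z != 0 -> exists k, z k != 0%N.
  move=> z0; apply: contrapT => nex; move/eqP: z0; apply.
  apply: padic_eqP => k /=; rewrite mod0n; apply: contrapT => /eqP zk.
  by apply: nex; exists k.
move=> xy; have {xy} [k] : exists k, (x k != 0%N) || (y k != 0%N).
  by case/orP: xy => /nz [k zk]; exists k; rewrite zk ?orbT.
elim: k x y => [|k IHk] x y.
  by rewrite -[x 0]residue_small -[y 0]residue_small !modn1.
have [x1|x1 _] := eqVneq (x 1) 0%N; last by exists 1, x, y; rewrite !mul1r oner_neq0 x1.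
have [y1|y1 _] := eqVneq (y 1) 0%N; last by exists 1, x, y; rewrite !mul1r oner_neq0 y1 orbT.
have [x' xE] := residue1_eq0 x1; have [y' yE] := residue1_eq0 y1.
have shift (z : Zp) : z k = 0%N -> (p%:R * z) k.+1 = 0%N.
  move=> zk; have zk1 : ((p ^ k)%N %| (z k.+1)%:Z)%Z.
    by rewrite dvdzE !absz_nat /dvdn -residueP zk.
  have := congpM (congp_int p_pr k.+1 p) (congp_residue k.+1 z).
  rewrite /congp -eqz_mod_dvd -PoszM !modz_nat residue_small => /eqP [kE].
  by rewrite [LHS]kE; apply/eqP; rewrite -/(dvdn _ _) expnS dvdn_pmul2l ?prime_gt0.
move=> xy.
have /IHk [c [x2 [y2 [c0 x2E y2E prim]]]] : (x' k != 0%N) || (y' k != 0%N).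
  by apply: contraTT xy; rewrite !negb_or !negbK xE yE => /andP [/eqP/shift -> /eqP/shift ->].
exists (p%:R * c), x2, y2; split=> //; first by rewrite mulf_neq0.
- by rewrite xE x2E mulrA.
- by rewrite yE y2E mulrA.
Qed.

Lemma padic_primitive (x y : Qp) : (x != 0) || (y != 0) ->
  exists (c : Qp) (x' y' : Zp), [/\ c != 0, x = c * tofrac x', y = c * tofrac y' &
    (x' 1 != 0%N) || (y' 1 != 0%N)].
Proof.
have [c [a [b [c0 -> ->]]]] := fraction_common_denominator x y.
rewrite !mulf_eq0 (negPf c0) !tofrac_eq0 /= => /padic_int_primitive.
move=> [k [x' [y' [k0 -> -> prim]]]]; exists (c * tofrac k), x', y'.
by rewrite !tofracM !mulrA; split=> //; rewrite mulf_neq0 // tofrac_eq0.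
Qed.

Lemma intr_padic_eq0 (c : int) : ((c%:~R : Qp) == 0) = (c == 0).
Proof.
by rewrite -(rmorph_int (@tofrac Zp)) tofrac_eq0 intr_padic_int_eq0.
Qed.

End PadicPrimitive.

Definition is_square (K : fieldType) (c : int) := exists u : K, u ^+ 2 = c%:~R.

Section Hensel.
Variables (p : nat) (p_pr : prime p).
Local Notation Zp := (padic_int p_pr).
Local Notation Qp := (padic p_pr).

Lemma dependent_sequence (T : Type) (P : nat -> T -> Prop) (rel : nat -> T -> T -> Prop) x0 :
  P 0%N x0 -> (forall k x, P k x -> exists y, P k.+1 y /\ rel k x y) ->
  exists f : nat -> T, forall k, P k (f k) /\ rel k (f k) (f k.+1).
Proof.
move=> P0 step.
have /choice [g gP] : forall kx : nat * T, exists y : T,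
    P kx.1 kx.2 -> P kx.1.+1 y /\ rel kx.1 kx.2 y.
  move=> [k x] /=; have [/step [y yP]|nP] := pselect (P k x); first by exists y.
  by exists x.
pose f := fix f k := if k is k'.+1 then g (k', f k') else x0.
have fP k : P k (f k) by elim: k => [//|k /(gP (k, f k)) []].
by exists f => k; split=> //; have [] := gP (k, f k) (fP k).
Qed.

Lemma padic_sqrt (c : int) (f : nat -> int) :
  (forall k, ((p ^ k)%N %| f k.+1 - f k)%Z) ->
  (forall k, ((p ^ k)%N %| f k ^+ 2 - c)%Z) -> is_square Qp c.
Proof.
move=> fS fc.
have pk_neq0 k : Posz (p ^ k) != 0 by rewrite eqz_nat -lt0n expn_gt0 prime_gt0.
pose r k := `|(f k %% (p ^ k)%N)%Z|%N.
have rE k : Posz (r k) = (f k %% (p ^ k)%N)%Z by rewrite gez0_abs ?modz_ge0.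
have rP k : r k = (r k.+1 %% p ^ k)%N.
  apply/eqP; rewrite -eqz_nat -modz_nat !rE; apply/eqP.
  have := divz_eq (f k.+1) (p ^ k.+1)%N.
  set e := (_ %/ _)%Z; set g := (_ %% (p ^ k.+1)%N)%Z => fE.
  have dvdpS : ((p ^ k)%N %| Posz (p ^ k.+1))%Z by rewrite expnSr PoszM dvdz_mulr.
  apply/eqP; rewrite eqz_mod_dvd; apply: dvdz_conv (rpredB (dvdz_mull e dvdpS) (fS k)) _.
  by rewrite fE; ring.
exists (tofrac (PadicInt p_pr rP)); rewrite -tofracXn -(rmorph_int (@tofrac Zp)).
congr tofrac; apply: congp_eq => k.
have fr : ((p ^ k)%N %| (r k)%:Z - f k)%Z by rewrite -eqz_mod_dvd rE modz_mod.
have H1 := congpX 2 (congp_residue k (PadicInt p_pr rP)).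
have H2 := congp_int p_pr k c.
rewrite /congp in H1 H2 *.
apply: dvdz_conv (rpredB (rpredD H1 (rpredD (dvdz_mull ((r k)%:Z + f k) fr) (fc k))) H2) _.
by rewrite /=; ring.
Qed.

(** Newton step: if [x ^+ 2 - c = e * p ^ k.+1], then [x + p ^ k.+1 * s] is a better root as soon as
    [p] divides [e + 2 * x * s], which is soluble since [2 * x] is prime to [p]. *)
Lemma is_square_odd (c : int) : odd p -> ~~ (p %| c)%Z -> qres p c -> is_square Qp c.
Proof.
move=> p_odd pc [x0 x0c].
have [|k x /dvdzP [e xe]|f fP] := @dependent_sequence int
    (fun k x => ((p ^ k.+1)%N %| x ^+ 2 - c)%Z) (fun k x y => ((p ^ k)%N %| y - x)%Z) x0.
- by rewrite expn1.
- have px : ~~ (p %| 2 * x)%Z.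
    rewrite dvdz_mulP //; apply/norP; split.
      by apply/negP => /(dvdn_leq (isT : 0 < 2)%N); have := prime_gt1 p_pr; lia.
    apply: contra pc => px; rewrite -(subrK (x ^+ 2) c) -opprB rpredD ?rpredN //.
      by rewrite xe expnS PoszM dvdz_mull ?dvdz_mulr.
    by rewrite expr2 dvdz_mulr.
  have [s /dvdzP [w sE]] := linear_congruence e p_pr px.
  exists (x + Posz (p ^ k.+1) * s); split.
    apply/dvdzP; exists (w + Posz (p ^ k) * s ^+ 2).
    have -> : (x + Posz (p ^ k.+1) * s) ^+ 2 - c =
      (x ^+ 2 - c) + Posz (p ^ k.+1) * (2 * x * s + Posz (p ^ k.+1) * s ^+ 2) by ring.
    rewrite xe.
    have -> : e * Posz (p ^ k.+1) +
        Posz (p ^ k.+1) * (2 * x * s + Posz (p ^ k.+1) * s ^+ 2) =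
      Posz (p ^ k.+1) * ((e + 2 * x * s) + Posz (p ^ k.+1) * s ^+ 2) by ring.
    by rewrite sE !expnS !PoszM; ring.
  by rewrite addrC addKr expnSr PoszM -mulrA dvdz_mulr.
apply: (@padic_sqrt c f) => k; first by have [] := fP k.
by have [+ _] := fP k; apply: dvdz_trans; rewrite expnSr PoszM dvdz_mulr.
Qed.

End Hensel.

(** At 2 the derivative [2 * x] costs a factor 2, so the invariant is kept modulo [2 ^ (k + 3)].
    Correcting by [2 ^ (k + 2) * e] leaves the error [2 ^ (k + 3) * e * (1 + x)] modulo
    [2 ^ (k + 4)], and [x] is odd. *)
Lemma is_square_two (p_pr : prime 2) (c : int) : (8 %| c - 1)%Z -> is_square (padic p_pr) c.
Proof.
move=> c1.
have [|k x /dvdzP [e xe]|f fP] := @dependent_sequence int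
    (fun k x => ((2 ^ (k + 3))%N %| x ^+ 2 - c)%Z) (fun k x y => ((2 ^ k)%N %| y - x)%Z) 1.
- by rewrite add0n expr1n -opprB rpredN.
- exists (x + Posz (2 ^ (k + 2)) * e); split; last first.
    by rewrite addrC addKr expnD PoszM -mulrA dvdz_mulr.
  have [w wE] : exists w, 1 + x = 2 * w.
    suff: (2 %| 1 + x)%Z by case/dvdzP => w ->; exists w; rewrite mulrC.
    have : x ^+ 2 - c = 2 * (e * (4 * Posz (2 ^ k))) by rewrite xe expnD PoszM; ring.
    have [y [->|xE]] : exists y : int, x = 2 * y \/ x = 2 * y + 1.
        by exists (x %/ 2)%Z; lia.
      have -> : (2 * y) ^+ 2 = 4 * (y * y) by ring.
      case/dvdzP: c1 => v /eqP; rewrite subr_eq => /eqP ->.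
      by move: (y * y) (e * _) => y2 e'; lia.
    by move=> _; lia.
  apply/dvdzP; exists (e * w + Posz (2 ^ k) * e ^+ 2).
  have -> : (x + Posz (2 ^ (k + 2)) * e) ^+ 2 - c =
      (x ^+ 2 - c) + Posz (2 ^ (k + 2)) * (2 * x * e + Posz (2 ^ (k + 2)) * e ^+ 2) by ring.
  rewrite xe !expnD !PoszM expnS !PoszM.
  have -> : x = 2 * w - 1 by rewrite -wE; ring.
  by ring.
apply: (@padic_sqrt 2 _ c f) => k; first by have [] := fP k.
by have [+ _] := fP k; apply: dvdz_trans; rewrite expnD PoszM dvdz_mulr.
Qed.

(** * Descent images and homogeneous spaces *)

Section DescentImage.
Variables (E : curve) (K : fieldType).
Implicit Types d c : int.

Lemma sqclass_eq (a b u : K) : a != 0 -> b != 0 -> u ^+ 2 = a * b ->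
  sqclass a = sqclass b.
Proof.
have sub (x y : K) : x != 0 -> y != 0 -> u ^+ 2 = x * y -> sqclass x `<=` sqclass y.
  move=> x0 y0 uE _ [v v0 <-]; exists (u / y * v).
    rewrite /= !mulf_neq0 ?invr_neq0 //.
    apply/eqP => u0; move: uE; rewrite u0 expr0n => /esym/eqP.
    by rewrite mulf_eq0 (negPf x0) (negPf y0).
  rewrite exprMn expr_div_n uE mulrA; congr (_ * _).
  by rewrite mulrA [y * _]mulrC expr2 invfM mulrA mulfK // mulfK.
move=> a0 b0 uE; apply/seteqP; split; first exact: sub.
by apply: sub => //; rewrite mulrC.
Qed.

Lemma descent_image1 d : d%:~R != 0 :> K -> is_square K d ->
  descent_image E K (sqclass d%:~R).
Proof.
move=> d0 [u uE]; exists Origin => //=.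
by apply: (sqclass_eq (u := u)); rewrite ?oner_neq0 ?mul1r.
Qed.

Lemma descent_image0 d : d%:~R != 0 :> K -> (coefB E)%:~R != 0 :> K ->
  is_square K (coefB E * d) -> descent_image E K (sqclass d%:~R).
Proof.
move=> d0 B0 [u uE]; exists (Affine 0 0); first by rewrite /points /= !expr0n /= !mulr0 !addr0.
rewrite /= eqxx; apply: (sqclass_eq (u := u)) => //.
by rewrite uE rmorphM.
Qed.

Lemma descent_image_affine d (x y u : K) : d%:~R != 0 :> K -> x != 0 ->
  y ^+ 2 = x ^+ 3 + (coefA E)%:~R * x ^+ 2 + (coefB E)%:~R * x ->
  u ^+ 2 = x * d%:~R -> descent_image E K (sqclass d%:~R).
Proof.
move=> d0 x0 yE uE; exists (Affine x y) => //=.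
by rewrite (negPf x0); apply: (sqclass_eq (u := u)).
Qed.

(** Certificate for an explicit point: integral abscissa [x] of the same class as [d], and ordinate
    [y] times a square root of [e] in [K]. *)
Lemma descent_image_int d (x y e : int) : d%:~R != 0 :> K -> x%:~R != 0 :> K ->
  x ^+ 3 + coefA E * x ^+ 2 + coefB E * x = y ^+ 2 * e ->
  is_square K e -> is_square K (x * d) -> descent_image E K (sqclass d%:~R).
Proof.
move=> d0 x0 yE [s sE] [u uE]; apply: (@descent_image_affine _ x%:~R (y%:~R * s) u) => //.
  by rewrite exprMn sE -!rmorphXn -!rmorphM -!rmorphD yE.
by rewrite uE rmorphM.
Qed.

(* [d z^2 = d^2 a^4 + A d a^2 b^2 + B b^4] is the homogeneous space attached to
   [d]; [Origin] and [(0, 0)] correspond to [(a, b) = (1, 0)] and [(0, 1)]. *)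
Lemma descent_image_torsor d : d%:~R != 0 :> K -> (coefB E)%:~R != 0 :> K ->
  descent_image E K (sqclass d%:~R) ->
  exists a b z : K, ((a != 0) || (b != 0)) /\
    d%:~R * z ^+ 2 = d%:~R ^+ 2 * a ^+ 4 + (coefA E)%:~R * d%:~R * a ^+ 2 * b ^+ 2
                     + (coefB E)%:~R * b ^+ 4.
Proof.
set D : K := d%:~R; set A : K := (coefA E)%:~R; set B : K := (coefB E)%:~R.
move=> d0 B0 [P PE].
have selfD : sqclass D D by exists 1; rewrite /= ?oner_neq0 // expr1n mulr1.
case: P PE => [_|x y] /=; rewrite -/A -/B.
  move=> clE; move: selfD; rewrite -clE => -[u u0]; rewrite mul1r => uE.
  exists 1, 0, u; rewrite oner_neq0; split=> //.
  by rewrite uE; ring.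
case: eqVneq => [x0|x0] yE clE; move: selfD; rewrite -clE => -[u /= u0 uE].
  exists 0, 1, u^-1; rewrite oner_neq0 orbT; split=> //.
  by rewrite -uE expr0n /= exprVn mulfK ?expf_neq0 //; ring.
exists u^-1, 1, (y * u / D); rewrite invr_neq0 //; split=> //.
have -> : D * (y * u / D) ^+ 2 = y ^+ 2 * u ^+ 2 / D.
  by field; exact: d0.
rewrite yE -uE; field.
by rewrite x0 u0.
Qed.

End DescentImage.

(** The equation is homogeneous for the weights 1, 1, 2 of [a], [b], [z], so [c] cancels; [mu] is
    the inverse of the denominator [f] of [z / c ^+ 2], whose numerator is [e]. *)
Lemma torsor_scale (A : idomainType) (c mu z : {fraction A}) (D a2 a4 x y e f : A) :
  c != 0 -> mu != 0 -> z / c ^+ 2 = mu * tofrac e -> 1 = mu * tofrac f ->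
  tofrac D * z ^+ 2 = tofrac D ^+ 2 * (c * tofrac x) ^+ 4
    + tofrac a2 * tofrac D * (c * tofrac x) ^+ 2 * (c * tofrac y) ^+ 2
    + tofrac a4 * (c * tofrac y) ^+ 4 ->
  D * e ^+ 2 = f ^+ 2 * (D ^+ 2 * x ^+ 4 + a2 * D * x ^+ 2 * y ^+ 2 + a4 * y ^+ 4).
Proof.
move=> c0 mu0 /(canRL (divfK (expf_neq0 2 c0))) -> oneE.
set R := D ^+ 2 * _ + _ + _ => eqz.
apply/eqP; rewrite -tofrac_eq !(tofracM, tofracXn); apply/eqP.
apply/(mulfI (expf_neq0 4 c0))/(mulfI (expf_neq0 2 mu0)).
transitivity (tofrac D * (mu * tofrac e * c ^+ 2) ^+ 2).
  by move: (tofrac D) (tofrac e) => d e'; ring.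
transitivity ((mu * tofrac f) ^+ 2 * (c ^+ 4 * tofrac R)).
  rewrite eqz -oneE !(tofracD, tofracM, tofracXn) expr1n mul1r.
  by move: (tofrac D) (tofrac x) (tofrac y) (tofrac a2) (tofrac a4) => *; ring.
by move: (tofrac f) (tofrac R) => *; ring.
Qed.

Lemma square_scale (A : idomainType) (u mu : {fraction A}) (c e f : A) : mu != 0 ->
  u ^+ 2 = tofrac c -> u = mu * tofrac e -> 1 = mu * tofrac f -> e ^+ 2 = c * f ^+ 2.
Proof.
move=> mu0 uE uE' oneE.
apply/eqP; rewrite -tofrac_eq !(tofracM, tofracXn).
apply/eqP/(mulfI (expf_neq0 2 mu0)).
by rewrite -exprMn -uE' uE mulrCA -exprMn -oneE expr1n mulr1.
Qed.

Section LocalTorsor.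
Variables (p : nat) (p_pr : prime p).
Local Notation Zp := (padic_int p_pr).
Local Notation Qp := (padic p_pr).

(** The denominator [f] is a unit: otherwise the numerator [e] is one, and [d * e ^+ 2], being a
    multiple of [f ^+ 2], is divisible by [p ^+ 2], against the hypothesis on [d]. Scaling by [f]
    with weights 1, 1, 2 then removes the denominator. *)
Lemma padic_torsor_int (E : curve) (d : int) (k : nat) :
  ~~ (p%:Z ^+ 2 %| d)%Z -> coefB E != 0 ->
  descent_image E Qp (sqclass d%:~R) ->
  exists a b z : int, ~~ ((p %| a)%Z && (p %| b)%Z) /\
    ((p ^ k)%N %| d * z ^+ 2 - (d ^+ 2 * a ^+ 4 + coefA E * d * a ^+ 2 * b ^+ 2
                     + coefB E * b ^+ 4))%Z.
Proof.
move=> p2d B0 dE.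
have d0 : d != 0 by apply: contraNneq p2d => ->; rewrite dvdz0.
have [|| a [b [z [ab0 eq1]]]] := descent_image_torsor _ _ dE; rewrite ?intr_padic_eq0 //.
have [c [x [y [c0 aE bE xy]]]] := padic_primitive ab0.
have [|mu [e [f [mu0 zE oneE ef]]]] := @padic_primitive p p_pr (z / c ^+ 2) 1.
  by rewrite oner_neq0 orbT.
have eq2 : d%:~R * e ^+ 2 = f ^+ 2 * (d%:~R ^+ 2 * x ^+ 4 +
    (coefA E)%:~R * d%:~R * x ^+ 2 * y ^+ 2 + (coefB E)%:~R * y ^+ 4).
  rewrite aE bE -!(rmorph_int (@tofrac Zp)) in eq1.
  exact: torsor_scale c0 mu0 zE oneE eq1.
(* Two more digits than asked, so that [p ^+ 2] divides the modulus even for [k = 0]. *)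
pose K := (k + 2)%N; have K0 : (0 < K)%N by rewrite /K addn2.
have H1 := congpM (congp_int p_pr K d) (congpX 2 (congp_residue K e)).
have H2 := congpM (congpX 2 (congp_residue K f)) (congpD (congpD
  (congpM (congpX 2 (congp_int p_pr K d)) (congpX 4 (congp_residue K x)))
  (congpM (congpM (congpM (congp_int p_pr K (coefA E)) (congp_int p_pr K d))
    (congpX 2 (congp_residue K x))) (congpX 2 (congp_residue K y))))
  (congpM (congp_int p_pr K (coefB E)) (congpX 4 (congp_residue K y)))).
rewrite -eq2 in H2; have := congp_dvd H1 H2.
move: xy ef; rewrite -!(dvdz_residue _ K0) -!negb_and.
move: (Posz (x K)) (Posz (y K)) (Posz (e K)) (Posz (f K)).
move=> {x y e f eq2 H1 H2 oneE zE aE bE} x y e f xy ef H.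
have pf : ~~ (p %| f)%Z.
  apply/negP => pf; move: ef; rewrite pf andbT => pe.
  have p2 : (p%:Z ^+ 2 %| d * e ^+ 2)%Z.
    have p2K : (p%:Z ^+ 2 %| Posz (p ^ K))%Z.
      by rewrite /K expnD PoszM dvdz_mull // -PoszM.
    have p2f : (p%:Z ^+ 2 %| f ^+ 2)%Z by apply: dvdz_exp2r.
    apply: dvdz_conv (rpredD (dvdz_trans p2K H) (dvdz_mulr
      (d ^+ 2 * x ^+ 4 + coefA E * d * x ^+ 2 * y ^+ 2 + coefB E * y ^+ 4) p2f)) _.
    by ring.
  move: p2d; rewrite -(Gauss_dvdzl _ (_ : coprimez _ (e ^+ 2))) ?p2 //.
  by rewrite coprimezXl // coprimezXr // coprimez_prime.
exists (f * x), (f * y), (e * f); split.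
  by rewrite !dvdz_mulP // (negPf pf).
have pkK : ((p ^ k)%N %| Posz (p ^ K))%Z by rewrite /K expnD PoszM dvdz_mulr.
apply: dvdz_conv (dvdz_mull (f ^+ 2) (dvdz_trans pkK H)) _.
by ring.
Qed.

Lemma is_square_qres (c : int) : ~~ (p %| c)%Z -> is_square Qp c -> qres p c.
Proof.
move=> pc [u uE].
have [|mu [e [f [mu0 uE' oneE ef]]]] := @padic_primitive p p_pr u 1.
  by rewrite oner_neq0 orbT.
rewrite -(rmorph_int (@tofrac Zp)) in uE; have eq2 := square_scale mu0 uE uE' oneE.
have H := congpM (congp_int p_pr 1 c) (congpX 2 (congp_residue 1 f)).
rewrite -eq2 in H; have {}H := congp_dvd (congpX 2 (congp_residue 1 e)) H.
move: ef; rewrite -!(dvdz_residue _ (isT : (0 < 1)%N)) -negb_and => ef.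
rewrite expn1 in H.
have pf : ~~ (p %| (f 1%N)%:Z)%Z.
  apply: contra ef => pf; rewrite pf andbT -dvdz_sqr //.
  rewrite -(subrK (c * (f 1%N)%:Z ^+ 2) (_ ^+ 2)) rpredD // dvdz_mull //.
  by rewrite dvdz_sqr.
by apply: qres_mulsqr pf _ => //; exists (e 1%N)%:Z.
Qed.

(** Odd valuation: in [e ^+ 2 = c * f ^+ 2] with [e], [f] primitive, [p] divides [e], so [f] is a
    unit and [p ^+ 2] would divide [c]. *)
Lemma is_square_val1 (c : int) : (p %| c)%Z -> ~~ (p%:Z ^+ 2 %| c)%Z -> ~ is_square Qp c.
Proof.
move=> pc p2c [u uE].
have [|mu [e [f [mu0 uE' oneE ef]]]] := @padic_primitive p p_pr u 1.
  by rewrite oner_neq0 orbT.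
rewrite -(rmorph_int (@tofrac Zp)) in uE; have eq2 := square_scale mu0 uE uE' oneE.
have H := congpM (congp_int p_pr 2 c) (congpX 2 (congp_residue 2 f)).
rewrite -eq2 in H; have {}H := congp_dvd (congpX 2 (congp_residue 2 e)) H.
move: ef; rewrite -!(dvdz_residue _ (isT : (0 < 2)%N)) -negb_and => ef.
have p2E : Posz (p ^ 2) = p%:Z ^+ 2 by rewrite -rmorphXn.
have pe : (p %| (e 2%N)%:Z)%Z.
  rewrite -dvdz_sqr // -(subrK (c * (f 2%N)%:Z ^+ 2) (_ ^+ 2)) rpredD // ?dvdz_mulr //.
  by apply: dvdz_trans H; rewrite expnS PoszM dvdz_mulr.
move: ef; rewrite pe /= => pf.
have : (p%:Z ^+ 2 %| c * (f 2%N)%:Z ^+ 2)%Z.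
  rewrite -[X in (_ %| X)%Z](subKr ((e 2%N)%:Z ^+ 2)) rpredB // -?p2E //.
  by rewrite p2E; apply: dvdz_exp2r.
rewrite Gauss_dvdzl ?(negPf p2c) //.
by rewrite coprimezXl // coprimezXr // coprimez_prime.
Qed.

End LocalTorsor.

(** * Local images at odd primes *)

Section IsSquare.
Variable K : fieldType.
Implicit Types a b c : int.

Lemma is_squareM a b : is_square K a -> is_square K b -> is_square K (a * b).
Proof. by move=> [u uE] [v vE]; exists (u * v); rewrite exprMn uE vE rmorphM. Qed.

Lemma is_square_sqr c : is_square K (c ^+ 2).
Proof. by exists c%:~R; rewrite rmorphXn. Qed.

Lemma is_square_mulsqr a c : c%:~R != 0 :> K -> is_square K (a * c ^+ 2) -> is_square K a.
Proof.
move=> c0 [u uE]; exists (u / c%:~R); rewrite expr_div_n uE rmorphM rmorphXn /=.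
by rewrite mulfK // expf_neq0.
Qed.

Lemma is_square1 : is_square K 1.
Proof. by exists 1; rewrite expr1n. Qed.

End IsSquare.

Section Good.
Variables (p : nat) (p_pr : prime p).
Local Notation Qp := (padic p_pr).
Implicit Types c d e : int.

(** For nonzero integers: the class of [d] lies in the subgroup generated by [c] in the group of
    square classes. *)
Definition square_mod c d := is_square Qp d \/ is_square Qp (d * c).

Lemma is_square_padic_mulsqr a c : c != 0 -> is_square Qp (a * c ^+ 2) -> is_square Qp a.
Proof. by move=> c0; apply: is_square_mulsqr; rewrite intr_padic_eq0. Qed.

Lemma square_modM c d1 d2 : c != 0 -> square_mod c d1 -> square_mod c d2 ->
  square_mod c (d1 * d2).
Proof.
move=> c0 [s1|s1] [s2|s2]; [left|right|right|left].
- exact: is_squareM.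
- by rewrite -mulrA; apply: is_squareM.
- by rewrite mulrAC; apply: is_squareM.
- apply: (is_square_padic_mulsqr c0).
  have -> : d1 * d2 * c ^+ 2 = (d1 * c) * (d2 * c) by ring.
  exact: is_squareM.
Qed.

Lemma square_mod_mulsqr c d e : e != 0 -> square_mod c (d * e ^+ 2) -> square_mod c d.
Proof.
move=> e0 [s|s]; [left|right]; apply: is_square_padic_mulsqr e0 _ => //.
by rewrite mulrAC.
Qed.

Lemma square_mod_base c c' d : is_square Qp c' -> square_mod c d -> square_mod (c * c') d.
Proof.
by move=> sc' [s|s]; [left|right; rewrite mulrA; apply: is_squareM].
Qed.

Lemma p_neq0 : p%:Z != 0.
Proof. by have := prime_gt0 p_pr; lia. Qed.

(** Since [c] has valuation one, either [d] or [d * c] has even valuation, and its unit part [e]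
    decides membership in the subgroup generated by [c]. *)
Lemma square_mod_unit c d : odd p -> (p %| c)%Z -> ~~ (p%:Z ^+ 2 %| c)%Z ->
  ~~ (p%:Z ^+ 2 %| d)%Z -> ~ square_mod c d ->
  exists e, [/\ ~~ (p %| e)%Z, ~ qres p e & d = e \/ d * c = e * p%:Z ^+ 2].
Proof.
move=> p_odd /dvdzP [c' ->]; rewrite [in X in X -> _]expr2 dvdz_mul2r ?p_neq0 //.
move=> pc' p2d nsq.
have [/dvdzP [d' dE]|pd] := boolP (p %| d)%Z; last first.
  exists d; split=> //; last by left.
  by move=> qd; apply: nsq; left; exact: is_square_odd.
rewrite dE expr2 dvdz_mul2r ?p_neq0 // in p2d.
have pdc : ~~ (p %| d' * c')%Z by rewrite dvdz_mulP // negb_or p2d.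
exists (d' * c'); split=> //; last by right; rewrite dE; ring.
move=> qdc; apply: nsq; right; rewrite dE.
have -> : d' * p * (c' * p) = (d' * c') * p%:Z ^+ 2 by ring.
by apply: is_squareM; [exact: is_square_odd|exact: is_square_sqr].
Qed.

(** The subgroup generated by [c] has index two, the quotient being the units modulo squares. Hence
    each local condition costs a single factor 2 in the pigeonhole count. *)
Lemma square_mod_index2 c d1 d2 : odd p -> (p %| c)%Z -> ~~ (p%:Z ^+ 2 %| c)%Z ->
  ~~ (p%:Z ^+ 2 %| d1)%Z -> ~~ (p%:Z ^+ 2 %| d2)%Z ->
  ~ square_mod c d1 -> ~ square_mod c d2 -> square_mod c (d1 * d2).
Proof.
move=> p_odd pc p2c p2d1 p2d2.
move=> /(square_mod_unit p_odd pc p2c p2d1) [e1 [pe1 ne1 E1]].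
move=> /(square_mod_unit p_odd pc p2c p2d2) [e2 [pe2 ne2 E2]].
have c0 : c != 0 by apply: contraNneq p2c => ->; rewrite dvdz0.
have sq12 : is_square Qp (e1 * e2).
  by apply: is_square_odd (nqres_mul _ _ _ ne1 ne2) => //; rewrite dvdz_mulP // negb_or pe1.
have sqM f : is_square Qp (e1 * e2 * f ^+ 2) by apply: is_squareM => //; exact: is_square_sqr.
case: E1 E2 => E1 [] E2; [left|right|right|left].
- by rewrite E1 E2.
- by rewrite -mulrA E2 E1 mulrA.
- by rewrite mulrAC E1 E2 mulrAC.
- apply: (is_square_padic_mulsqr c0).
  have -> : d1 * d2 * c ^+ 2 = (d1 * c) * (d2 * c) by ring.
  rewrite E1 E2; have -> : e1 * p%:Z ^+ 2 * (e2 * p%:Z ^+ 2) = e1 * e2 * (p%:Z ^+ 2) ^+ 2 by ring.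
  exact: sqM.
Qed.

End Good.

Lemma qres3 (c : int) : ~~ (3 %| c)%Z -> qres 3 c <-> (3 %| c - 1)%Z.
Proof.
move=> c3; split=> [[x xc]|c1]; last by exists 1; rewrite expr1n -opprB rpredN.
have [y [xE|[xE|xE]]] : exists y : int, x = 3 * y \/ x = 3 * y + 1 \/ x = 3 * y + 2.
    by exists (x %/ 3)%Z; lia.
- by move: xc c3; rewrite (_ : x ^+ 2 = 9 * (y * y)) ?xE; [lia|ring].
- by move: xc c3; rewrite (_ : x ^+ 2 = 9 * (y * y) + 6 * y + 1) ?xE; [lia|ring].
- by move: xc c3; rewrite (_ : x ^+ 2 = 9 * (y * y) + 12 * y + 4) ?xE; [lia|ring].
Qed.

Section TorsorUnit.
Variables (p : nat) (p_pr : prime p).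
Variables (n' a b z d : int).
Hypothesis ab : ~~ ((p %| a)%Z && (p %| b)%Z).
Let P := p%:Z.

Lemma dvd_mulp (x : int) : (p %| x * P)%Z. Proof. exact: dvdz_mull. Qed.

Lemma dvd_eq_mulp (x y : int) : x = y * P -> (p %| x)%Z.
Proof. by move=> ->; exact: dvd_mulp. Qed.

Lemma mulpI (x y : int) : x * P = y * P -> x = y.
Proof. by apply: mulIf; exact: (p_neq0 p_pr). Qed.

(** Case of units [d] and [a]: modulo [p] only the term in [a ^+ 4] survives. *)
Lemma torsor_unit_qres (w : int) : ~~ (p %| d)%Z -> ~~ (p %| a)%Z ->
  d * z ^+ 2 = d ^+ 2 * a ^+ 4 + w * P -> qres p d.
Proof.
move=> pd pa H; apply: (qres_mulsqr (b := d * a ^+ 2)) => //.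
  by rewrite dvdz_mulP // negb_or pd dvdz_sqr.
exists (d * z); apply: (dvd_eq_mulp (y := d * w)).
have -> : (d * z) ^+ 2 - d * (d * a ^+ 2) ^+ 2 = d * (d * z ^+ 2 - d ^+ 2 * a ^+ 4) by ring.
by rewrite H; ring.
Qed.

(** Case where [p] divides [a]: then [b] is a unit, [z] is divisible by [p], and after division by
    [p ^+ 2] only the term in [b ^+ 4] survives; [c] is -3 on [E] and a square on [E']. *)
Lemma torsor_unit_qres_div (w c : int) : ~~ (p %| d)%Z -> ~~ (p %| n')%Z -> ~~ (p %| c)%Z ->
  (p %| a)%Z -> d * z ^+ 2 = c * n' ^+ 2 * b ^+ 4 * P ^+ 2 + w * P ^+ 3 -> qres p (d * c).
Proof.
move=> pd pn pc pa; move: ab; rewrite pa /= => pb H.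
have : (p %| d * z ^+ 2)%Z.
  by apply: (dvd_eq_mulp (y := c * n' ^+ 2 * b ^+ 4 * P + w * P ^+ 2)); rewrite H; ring.
rewrite dvdz_mulP // (negPf pd) dvdz_sqr //= => /dvdzP [z' zE].
have H' : d * z' ^+ 2 = c * n' ^+ 2 * b ^+ 4 + w * P.
  apply/mulpI/mulpI; transitivity (d * z ^+ 2); first by rewrite zE; ring.
  by rewrite H; ring.
apply: (qres_mulsqr (b := n' * b ^+ 2)) => //.
  by rewrite dvdz_mulP // negb_or pn dvdz_sqr.
exists (d * z'); apply: (dvd_eq_mulp (y := d * w)).
have -> : (d * z') ^+ 2 - d * c * (n' * b ^+ 2) ^+ 2 =
    d * (d * z' ^+ 2 - c * n' ^+ 2 * b ^+ 4) by ring.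
by rewrite H'; ring.
Qed.

(** Case where [p] divides both [d] and [n]: [p] must divide [z], so the remaining form [X] vanishes
    modulo [p]. *)
Lemma torsor_ramified (d' w X : int) : ~~ (p %| d')%Z ->
  d' * P * z ^+ 2 = X * P ^+ 2 + w * P ^+ 3 ->
  exists z', d' * z' ^+ 2 * P = X + w * P.
Proof.
move=> pd H.
have H1 : d' * z ^+ 2 = (X + w * P) * P.
  by apply: mulpI; rewrite mulrAC H; ring.
have : (p %| d' * z ^+ 2)%Z by apply: dvd_eq_mulp H1.
rewrite dvdz_mulP // (negPf pd) dvdz_sqr //= => /dvdzP [z' zE].
by exists z'; apply: mulpI; rewrite -H1 zE; ring.
Qed.

End TorsorUnit.

Lemma sqfree_neq0 (p : nat) (d : int) : ~~ (p%:Z ^+ 2 %| d)%Z -> d != 0.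
Proof. by apply: contraNneq => ->; rewrite dvdz0. Qed.

Lemma sqfree_intr_neq0 (p : nat) (p_pr : prime p) (d : int) : ~~ (p%:Z ^+ 2 %| d)%Z ->
  d%:~R != 0 :> padic p_pr.
Proof. by move=> p2d; rewrite intr_padic_eq0 (sqfree_neq0 p2d). Qed.

Section PrimeDivision.
Variables (p : nat) (p_pr : prime p).
Local Notation P := p%:Z.

Lemma prime_dvd_decomp (x : int) : (p %| x)%Z -> ~~ (P ^+ 2 %| x)%Z ->
  exists2 x', x = x' * P & ~~ (p %| x')%Z.
Proof.
move=> /dvdzP [x' ->]; rewrite expr2 dvdz_mul2r ?(p_neq0 p_pr) // => px.
by exists x'.
Qed.

Lemma dvdp_2 : odd p -> (2%R : int) \notin dvdz p.
Proof.
move=> p_odd; apply/negP => /(dvdn_leq (isT : 0 < 2)%N).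
by have := prime_gt1 p_pr; lia.
Qed.

Lemma dvdp_4 : odd p -> (4%R : int) \notin dvdz p.
Proof.
by move=> p_odd; have -> : (4%R : int) = 2%R * 2%R by []; rewrite dvdz_mulP // orbb dvdp_2.
Qed.

Lemma dvdp_3 : (p %% 3 != 0)%N -> (3%R : int) \notin dvdz p.
Proof.
move=> p3; change (~~ (p %| 3)%N); rewrite dvdn_prime2 //.
by apply/eqP => pE; rewrite pE in p3.
Qed.

End PrimeDivision.

(** * Points of order two, and the primes dividing n *)

Section LocalImages.
Variable n : nat.
Hypothesis n_gt0 : (0 < n)%N.
Let N := n%:Z.
Let E := curve_pi3 n.
Let E' := isogenous E.

Lemma coefB_pi3_neq0 : coefB E != 0.
Proof. by rewrite /E /= mulf_neq0 // expf_neq0 //; lia. Qed.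

Lemma coefB_isogenous : coefB E' = 16 * N ^+ 2.
Proof. by rewrite /E' /E /= /N; ring. Qed.

Lemma coefB_isogenous_neq0 : coefB E' != 0.
Proof. by rewrite coefB_isogenous mulf_neq0 // expf_neq0 //; rewrite /N; lia. Qed.

(** This lemma and the next two use the points [(n, 0)], [(-3n, 0)] and [(0, 0)] of order two; the
    last has class [- 3 * n ^+ 2], that is, -3. *)
Lemma descent_image_n (K : fieldType) (d : int) : d%:~R != 0 :> K -> N%:~R != 0 :> K ->
  is_square K (d * N) -> descent_image E K (sqclass d%:~R).
Proof.
move=> d0 n0 [u uE]; apply: (@descent_image_affine _ _ _ N%:~R 0 u) => //.
  by rewrite /= -/N !(rmorphM, rmorphN, rmorphXn) /= expr0n /=; ring.
by rewrite uE rmorphM mulrC.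
Qed.

Lemma descent_image_N3n (K : fieldType) (d : int) : d%:~R != 0 :> K -> (- 3 * N)%:~R != 0 :> K ->
  is_square K (d * (- 3 * N)) -> descent_image E K (sqclass d%:~R).
Proof.
move=> d0 n0 [u uE]; apply: (@descent_image_affine _ _ _ (- 3 * N)%:~R 0 u) => //.
  by rewrite /= -/N !(rmorphM, rmorphN, rmorphXn) /= expr0n /=; ring.
by rewrite uE rmorphM mulrC.
Qed.

Lemma descent_image_N3 (K : fieldType) (d : int) : d%:~R != 0 :> K ->
  (- 3 * N ^+ 2)%:~R != 0 :> K ->
  is_square K (d * - 3) -> descent_image E K (sqclass d%:~R).
Proof.
move=> d0 n0 sq; apply: descent_image0 => //=; rewrite -/N.
have -> : - 3 * N ^+ 2 * d = d * - 3 * N ^+ 2 by ring.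
by apply: is_squareM => //; exact: is_square_sqr.
Qed.

(* With [w] a primitive cube root of unity, [x = -4nw] is the abscissa of a point
   of order 2 on [E'], and it has the class of [-n] because [w = w^4]. *)
Lemma descent_image_omega (K : fieldType) (d : int) : 2%:~R != 0 :> K ->
  d%:~R != 0 :> K -> N%:~R != 0 :> K -> is_square K (- 3) ->
  is_square K (d * - N) -> descent_image E' K (sqclass d%:~R).
Proof.
move=> two0 d0 n0 [r rE] [u uE].
pose w : K := (- 1 + r) / 2%:~R.
have w2 : w ^+ 2 + w + 1 = 0.
  apply: (mulfI (expf_neq0 2 two0)).
  have -> : 2%:~R ^+ 2 * (w ^+ 2 + w + 1) = r ^+ 2 + 3 by rewrite /w; field; exact: two0.
  by rewrite rE rmorphN mulr0 addrC subrr.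
have w3 : w ^+ 3 = 1.
  apply/eqP; rewrite -subr_eq0.
  have -> : w ^+ 3 - 1 = (w - 1) * (w ^+ 2 + w + 1) by ring.
  by rewrite w2 mulr0.
have w0 : w != 0.
  by apply/eqP => w0; move/eqP: w3; rewrite w0 expr0n eq_sym oner_eq0.
apply: (@descent_image_affine _ _ _ (- 2%:~R ^+ 2 * N%:~R * w) 0 (2%:~R * u * w ^+ 2)) => //.
- by rewrite mulf_neq0 // mulf_neq0 // oppr_eq0 expf_neq0.
- rewrite coefB_isogenous /E' /E /= -/N !(rmorphM, rmorphN, rmorphXn) /= expr0n /=.
  set m : K := N%:~R.
  transitivity (- 64 * m ^+ 3 * w * (w ^+ 2 + w + 1)); last by ring.
  by rewrite w2 mulr0.
- transitivity (2%:~R ^+ 2 * u ^+ 2 * (w ^+ 3 * w)); first by ring.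
  by rewrite uE w3 !(rmorphM, rmorphN) /=; ring.
Qed.

Section Finite.
Variables (p : nat) (p_pr : prime p) (d : int).
Hypothesis p2d : ~~ (p%:Z ^+ 2 %| d)%Z.
Local Notation Qp := (padic p_pr).
Let P := p%:Z.

(** The quartic factors because all 2-torsion of [E] is rational:
    [x^2 + 2nx - 3n^2 = (x - n)(x + 3n)]. *)
Lemma torsor_pi3 (k : nat) : descent_image E Qp (sqclass d%:~R) ->
  exists a b z w : int, ~~ ((p %| a)%Z && (p %| b)%Z) /\
    d * z ^+ 2 = (d * a ^+ 2 - N * b ^+ 2) * (d * a ^+ 2 + 3 * N * b ^+ 2) + w * P ^+ k.
Proof.
move=> /(padic_torsor_int k p2d coefB_pi3_neq0) [a [b [z [ab /dvdzP [w wE]]]]].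
exists a, b, z, w; split=> //; move/eqP: wE; rewrite subr_eq => /eqP -> /=.
rewrite -/N -[(p ^ k)%N%:Z]/(Posz (p ^ k)) (rmorphXn Posz) /= -/P.
by ring.
Qed.

Lemma torsor_isogenous (k : nat) : descent_image E' Qp (sqclass d%:~R) ->
  exists a b z w : int, ~~ ((p %| a)%Z && (p %| b)%Z) /\
    d * z ^+ 2 = d ^+ 2 * a ^+ 4 - 4 * N * d * a ^+ 2 * b ^+ 2 + 16 * N ^+ 2 * b ^+ 4
                 + w * P ^+ k.
Proof.
move=> /(padic_torsor_int k p2d coefB_isogenous_neq0) [a [b [z [ab /dvdzP [w wE]]]]].
exists a, b, z, w; split=> //; move/eqP: wE; rewrite subr_eq => /eqP -> /=.
rewrite -/N (rmorphXn Posz) /= -/P.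
by ring.
Qed.

(** For a unit [d] the homogeneous space shows that [d] or [-3 d] is a residue; when [p] divides
    [d], one of the two factors vanishes modulo [p] and [d' n'] or [-3 d' n'] is a residue. Since -3
    is itself a residue, both outcomes agree. *)
Lemma local_pi3_split : odd p -> (p %% 3 != 0)%N -> (p %| N)%Z -> ~~ (P ^+ 2 %| N)%Z ->
  qres p (- 3) -> descent_image E Qp (sqclass d%:~R) <-> square_mod p_pr N d.
Proof.
move=> p_odd p3 pn p2n qN3; have d0 := sqfree_intr_neq0 p_pr p2d.
have N0 : N%:~R != 0 :> Qp by rewrite intr_padic_eq0 /N; lia.
split=> [dE|[sq|sq]]; [|exact: descent_image1|exact: descent_image_n].
have [a [b [z [w [ab H]]]]] := torsor_pi3 3 dE.
have [n' nE pn'] := prime_dvd_decomp p_pr pn p2n.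
have p3' := dvdp_3 p_pr p3.
have pN3 : ~~ (p %| (- 3)%R)%Z by rewrite rpredN.
have [pd|pd] := boolP (p %| d)%Z; last first.
  left; apply: is_square_odd => //.
  have [pa|pa] := boolP (p %| a)%Z; last first.
    apply: (torsor_unit_qres p_pr (a := a) (z := z)
      (w := 2 * n' * d * a ^+ 2 * b ^+ 2 - 3 * n' ^+ 2 * P * b ^+ 4 + w * P ^+ 2)) => //.
    by rewrite H nE; ring.
  apply: (qres_mulr (b := - 3)) => //.
  case/dvdzP: (pa) => a' aE.
  apply: (torsor_unit_qres_div p_pr ab (n' := n') (z := z)
    (w := d ^+ 2 * a' ^+ 4 * P + 2 * n' * d * a' ^+ 2 * b ^+ 2 + w)) => //.
  by rewrite H nE aE; ring.
have [d' dE' pd'] := prime_dvd_decomp p_pr pd p2d.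
rewrite nE dE' in H *; right.
have -> : d' * P * (n' * P) = d' * n' * P ^+ 2 by ring.
apply: is_squareM; last exact: is_square_sqr.
have pdn : ~~ (p %| d' * n')%Z by rewrite dvdz_mulP // negb_or pd'.
apply: is_square_odd => //.
have [z' H'] := torsor_ramified p_pr (d' := d') (z := z) (w := w)
  (X := (d' * a ^+ 2 - n' * b ^+ 2) * (d' * a ^+ 2 + 3 * n' * b ^+ 2)) pd' ltac:(rewrite H; ring).
have : (p %| (d' * a ^+ 2 - n' * b ^+ 2) * (d' * a ^+ 2 + 3 * n' * b ^+ 2))%Z.
  by apply: (dvd_eq_mulp (y := d' * z' ^+ 2 - w)); rewrite [RHS]mulrBl H'; ring.
rewrite dvdz_mulP // => /orP [] pX.
  have pa : ~~ (p %| a)%Z.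
    apply: contra ab => pa; rewrite pa /= -dvdz_sqr //.
    have : (p %| n' * b ^+ 2)%Z.
      rewrite -(subKr (d' * a ^+ 2) (n' * b ^+ 2)) rpredB // dvdz_mull //.
      by rewrite dvdz_sqr.
    by rewrite dvdz_mulP // (negPf pn').
  apply: (qres_mulsqr (b := a)) => //; exists (n' * b).
  by apply: dvdz_conv (dvdz_mull (- n') pX) _; ring.
have pa : ~~ (p %| a)%Z.
  apply: contra ab => pa; rewrite pa /= -dvdz_sqr //.
  have : (p %| 3 * n' * b ^+ 2)%Z.
    rewrite -(addKr (d' * a ^+ 2) (3 * n' * b ^+ 2)) rpredD // rpredN dvdz_mull //.
    by rewrite dvdz_sqr.
  by rewrite !dvdz_mulP // (negPf pn') (negPf p3').
apply: (qres_mulr (b := - 3)) => //; apply: (qres_mulsqr (b := a)) => //; exists (3 * n' * b).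
by apply: dvdz_conv (dvdz_mull (3 * n') pX) _; ring.
Qed.

(** As -3 is a non-residue, the classes 1, -3, [n] and [-3n] of the 2-torsion are all four square
    classes. *)
Lemma local_pi3_inert : odd p -> (p %% 3 != 0)%N -> (p %| N)%Z -> ~~ (P ^+ 2 %| N)%Z ->
  ~ qres p (- 3) -> descent_image E Qp (sqclass d%:~R).
Proof.
move=> p_odd p3 pn p2n nqN3; have d0 := sqfree_intr_neq0 p_pr p2d.
have N0 : N != 0 by rewrite /N; lia.
have pN3 : ~~ (p %| (- 3)%R)%Z by rewrite rpredN dvdp_3.
have unit_sq e : ~~ (p %| e)%Z -> is_square Qp e \/ is_square Qp (e * - 3).
  move=> pe; have [qe|nqe] := pselect (qres p e); first by left; exact: is_square_odd.
  right; apply: is_square_odd (nqres_mul _ _ _ nqe nqN3) => //.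
  by rewrite dvdz_mulP // negb_or pe.
have [pd|pd] := boolP (p %| d)%Z; last first.
  have [sq|sq] := unit_sq _ pd; first exact: descent_image1.
  by apply: descent_image_N3 => //; rewrite intr_padic_eq0 mulf_neq0 // expf_neq0.
have [n' nE pn'] := prime_dvd_decomp p_pr pn p2n.
have [d' dE pd'] := prime_dvd_decomp p_pr pd p2d.
have [||sq] := unit_sq (d' * n'); first by rewrite dvdz_mulP // negb_or pd'.
  move=> sq; apply: descent_image_n => //; first by rewrite intr_padic_eq0.
  have -> : d * N = d' * n' * P ^+ 2 by rewrite dE nE; ring.
  by apply: is_squareM => //; exact: is_square_sqr.
apply: descent_image_N3n => //; first by rewrite intr_padic_eq0 mulf_neq0.
have -> : d * (- 3 * N) = d' * n' * - 3 * P ^+ 2 by rewrite dE nE; ring.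
by apply: is_squareM => //; exact: is_square_sqr.
Qed.

Lemma local_isogenous_unit : odd p -> (p %| N)%Z -> ~~ (P ^+ 2 %| N)%Z ->
  ~~ (p %| d)%Z -> descent_image E' Qp (sqclass d%:~R) <-> is_square Qp d.
Proof.
move=> p_odd pn p2n pd; have d0 := sqfree_intr_neq0 p_pr p2d.
split=> [dE|sq]; last exact: descent_image1.
have [a [b [z [w [ab H]]]]] := torsor_isogenous 3 dE.
have [n' nE pn'] := prime_dvd_decomp p_pr pn p2n.
apply: is_square_odd => //.
have [pa|pa] := boolP (p %| a)%Z; last first.
  apply: (torsor_unit_qres p_pr (a := a) (z := z)
    (w := - 4 * n' * d * a ^+ 2 * b ^+ 2 + 16 * n' ^+ 2 * P * b ^+ 4 + w * P ^+ 2)) => //.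
  by rewrite H nE; ring.
apply: (qres_mulsqr (b := 4)) => //; first exact: dvdp_4.
case/dvdzP: (pa) => a' aE.
apply: (torsor_unit_qres_div p_pr ab (n' := n') (z := z)
  (w := d ^+ 2 * a' ^+ 4 * P - 4 * n' * d * a' ^+ 2 * b ^+ 2 + w)) => //.
  by rewrite dvdz_sqr // dvdp_4.
by rewrite H nE aE; ring.
Qed.

(** The form on the right has unit coefficients at [a ^+ 4] and [b ^+ 4] and vanishes modulo [p], so
    if [p] divided one of [a], [b] it would divide the other. *)
Lemma isogenous_ramified (n' d' : int) : odd p -> N = n' * P -> d = d' * P ->
  ~~ (p %| n')%Z -> ~~ (p %| d')%Z -> (p %| N)%Z ->
  descent_image E' Qp (sqclass d%:~R) ->
  exists a b z w : int, [/\ ~~ (p %| a)%Z, ~~ (p %| b)%Z &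
   d' * z ^+ 2 * P = d' ^+ 2 * a ^+ 4 - 4 * n' * d' * a ^+ 2 * b ^+ 2 + 16 * n' ^+ 2 * b ^+ 4
                 + w * P ^+ 2].
Proof.
move=> p_odd nE dE pn' pd' pn iE.
(* Two of the four powers of [p] are lost in dividing out; the two that remain are needed at 3. *)
have [a [b [z [w [ab H]]]]] := torsor_isogenous 4 iE.
rewrite nE dE in H.
have [z' H'] := torsor_ramified p_pr (d' := d') (z := z) (w := w * P)
  (X := d' ^+ 2 * a ^+ 4 - 4 * n' * d' * a ^+ 2 * b ^+ 2 + 16 * n' ^+ 2 * b ^+ 4)
  pd' ltac:(rewrite H; ring).
have pX : (p %| d' ^+ 2 * a ^+ 4 - 4 * n' * d' * a ^+ 2 * b ^+ 2 + 16 * n' ^+ 2 * b ^+ 4)%Z.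
  by apply: (dvd_eq_mulp (y := d' * z' ^+ 2 - w * P)); rewrite [RHS]mulrBl H'; ring.
exists a, b, z', w; split; last by rewrite H'; ring.
  apply: contra ab => pa; rewrite pa /=.
  have : (p %| (4 * n' * b ^+ 2) ^+ 2)%Z.
    case/dvdzP: (pa) => a' aE.
    apply: dvdz_conv (rpredB pX (dvd_mulp p
      (d' ^+ 2 * a' ^+ 4 * P ^+ 3 - 4 * n' * d' * a' ^+ 2 * P * b ^+ 2))) _.
    by rewrite aE; ring.
  by rewrite dvdz_sqr // !dvdz_mulP // (negPf pn') (negPf (dvdp_4 p_pr p_odd)) /= orbb.
apply: contra ab => pb; rewrite pb andbT.
have : (p %| (d' * a ^+ 2) ^+ 2)%Z.
  case/dvdzP: (pb) => b' bE.
  apply: dvdz_conv (rpredB pX (dvd_mulp p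
    (- 4 * n' * d' * a ^+ 2 * b' ^+ 2 * P + 16 * n' ^+ 2 * b' ^+ 4 * P ^+ 3))) _.
  by rewrite bE; ring.
by rewrite dvdz_sqr // !dvdz_mulP // (negPf pd') /= orbb.
Qed.

(** For [p] dividing [d], complete the square modulo [p]: [(d' a^2 - 4 n' b^2)^2 = - n' d' (2 a
    b)^2]. The converse uses a point of order two of [E'] that exists because -3 is a square. *)
Lemma local_isogenous_split : odd p -> (p %% 3 != 0)%N -> (p %| N)%Z -> ~~ (P ^+ 2 %| N)%Z ->
  qres p (- 3) -> descent_image E' Qp (sqclass d%:~R) <-> square_mod p_pr (- N) d.
Proof.
move=> p_odd p3 pn p2n qN3; have d0 := sqfree_intr_neq0 p_pr p2d.
have [pd|pd] := boolP (p %| d)%Z; last first.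
  rewrite local_isogenous_unit //; split=> [|[//|]]; first by left.
  move=> sq; exfalso; apply: is_square_val1 sq.
    by rewrite dvdz_mull // rpredN.
  by rewrite Gauss_dvdzr ?rpredN // coprimezXl // coprimez_prime.
have [n' nE pn'] := prime_dvd_decomp p_pr pn p2n.
have [d' dE pd'] := prime_dvd_decomp p_pr pd p2d.
split=> [iE|].
  have [a [b [z [w [pa pb H]]]]] := isogenous_ramified p_odd nE dE pn' pd' pn iE.
  right; have -> : d * - N = d' * - n' * P ^+ 2 by rewrite dE nE; ring.
  apply: is_squareM; last exact: is_square_sqr.
  apply: is_square_odd => //; first by rewrite dvdz_mulP // rpredN negb_or pd'.
  apply: (qres_mulsqr (b := 2 * a * b)) => //.
    rewrite !dvdz_mulP // (negPf pa) (negPf pb) !orbF.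
    exact: dvdp_2.
  exists (d' * a ^+ 2 - 4 * n' * b ^+ 2).
  apply: (dvd_eq_mulp (y := d' * z ^+ 2 - w * P)).
  by rewrite [RHS]mulrBl H; ring.
case=> [sq|sq]; first exact: descent_image1.
apply: descent_image_omega => //; try by rewrite intr_padic_eq0 // /N; lia.
by apply: is_square_odd => //; rewrite rpredN dvdp_3.
Qed.

End Finite.
End LocalImages.

Lemma odd_sqr (x : int) : ~~ (2 %| x)%Z -> exists k, x ^+ 2 = 8 * k + 1.
Proof.
move=> x2; have [y [xE|xE]] : exists y : int, x = 4 * y + 1 \/ x = 4 * y - 1.
    by exists ((x + 1) %/ 4)%Z; lia.
- by exists (2 * y ^+ 2 + y); rewrite xE; ring.
- by exists (2 * y ^+ 2 - y); rewrite xE; ring.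
Qed.

Lemma is_square3 (p_pr : prime 3) (e : int) : (3 %| e - 1)%Z -> is_square (padic p_pr) e.
Proof. by move=> e1; apply: is_square_odd => //; [lia|apply/qres3; lia]. Qed.

Lemma is_square3_mul9 (p_pr : prime 3) (e f : int) : f = e * 3 ^+ 2 -> (3 %| e - 1)%Z ->
  is_square (padic p_pr) f.
Proof. by move=> -> e1; apply: is_squareM; [exact: is_square3|exact: is_square_sqr]. Qed.

Section LocalImages2.
Variable n : nat.
Hypothesis n_gt0 : (0 < n)%N.
Local Notation N := n%:Z.
Local Notation E := (curve_pi3 n).
Local Notation E' := (isogenous (curve_pi3 n)).

(** If [p] divided [d], completing the square the other way would give
    [(d' a^2 - 2 n' b^2)^2 = -3 (2 n' b^2)^2] modulo [p], but -3 is a non-residue. *)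
Lemma local_isogenous_inert (p : nat) (p_pr : prime p) (d : int) :
  ~~ (p%:Z ^+ 2 %| d)%Z -> odd p -> (p %% 3 != 0)%N -> (p %| N)%Z -> ~~ (p%:Z ^+ 2 %| N)%Z ->
  ~ qres p (- 3) -> descent_image E' (padic p_pr) (sqclass d%:~R) <-> is_square (padic p_pr) d.
Proof.
move=> p2d p_odd p3 pn p2n nqN3.
have [pd|pd] := boolP (p %| d)%Z; last exact: local_isogenous_unit.
split=> [iE|/is_square_val1]; last by move=> /(_ pd p2d).
have [n' nE pn'] := prime_dvd_decomp p_pr pn p2n.
have [d' dE pd'] := prime_dvd_decomp p_pr pd p2d.
have [a [b [z [w [pa pb H]]]]] := isogenous_ramified n_gt0 p2d p_odd nE dE pn' pd' pn iE.
case: nqN3; apply: (qres_mulsqr (b := 2 * n' * b ^+ 2)) => //.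
  by rewrite !dvdz_mulP // (negPf pn') (negPf pb) (negPf (dvdp_2 p_pr p_odd)).
exists (d' * a ^+ 2 - 2 * n' * b ^+ 2).
apply: (dvd_eq_mulp (y := d' * z ^+ 2 - w * p)).
by rewrite [RHS]mulrBl H; ring.
Qed.

(** * The prime 3 *)

Section Three.
Variables (p_pr : prime 3) (m d : int).
Hypothesis nE : N = m * 3.
Hypothesis d9 : ~~ (3%:Z ^+ 2 %| d)%Z.
Local Notation Q3 := (padic p_pr).

Lemma three_decomp : (3 %| d)%Z -> exists2 d', d = d' * 3 & ~~ (3 %| d')%Z.
Proof. by move=> d3; exact: (prime_dvd_decomp p_pr). Qed.

(** For [m = 1] mod 3 the classes of [n], -3 and [-3n] are 3, -3 and -1, so the 2-torsion fills the
    four square classes. *)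
Lemma local_pi3_three1 : (3 %| m - 1)%Z -> descent_image E Q3 (sqclass d%:~R).
Proof.
move=> m1; have d0 := sqfree_intr_neq0 p_pr d9.
have N0 : N != 0 by lia.
have [d3|d3] := boolP (3 %| d)%Z; last first.
  have [d1|d1] := boolP (3 %| d - 1)%Z; first exact/descent_image1/is_square3.
  apply: descent_image_N3n => //; first by rewrite intr_padic_eq0 mulf_neq0.
  apply: (@is_square3_mul9 _ (- d * m)); first by rewrite nE; ring.
  case/dvdzP: m1 => k /eqP; rewrite subr_eq => /eqP ->.
  have -> : - d * (k * 3 + 1) = - d - 3 * (d * k) by ring.
  by move: (d * k) => dk; lia.
have [d' dE d3'] := three_decomp d3.
have [d1|d1] := boolP (3 %| d' - 1)%Z.
  apply: descent_image_n => //; first by rewrite intr_padic_eq0.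
  apply: (@is_square3_mul9 _ (d' * m)); first by rewrite nE dE; ring.
  case/dvdzP: m1 => k /eqP; rewrite subr_eq => /eqP ->.
  have -> : d' * (k * 3 + 1) = d' + 3 * (d' * k) by ring.
  by move: (d' * k) => dk; lia.
apply: descent_image_N3 => //; first by rewrite intr_padic_eq0 mulf_neq0 // expf_neq0.
by apply: (@is_square3_mul9 _ (- d')); [rewrite dE; ring|lia].
Qed.

Lemma qresNm (k : int) : (3 %| m - 2)%Z -> ~~ (3 %| k)%Z -> qres 3 (- m * k) -> qres 3 k.
Proof.
move=> m2 k3; rewrite mulrC; apply: qres_mulr => //; first lia.
by apply/qres3; lia.
Qed.

(** Now [- m] is a 3-adic square, so [n] has the class of -3 and [-3n] is trivial: the 2-torsion
    gives only the subgroup generated by -3, and the homogeneous space has to exclude the other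
    classes. *)
Lemma local_pi3_three2 : (3 %| m - 2)%Z ->
  descent_image E Q3 (sqclass d%:~R) <-> square_mod p_pr (- 3) d.
Proof.
move=> m2; have d0 := sqfree_intr_neq0 p_pr d9.
have N0 : N != 0 by lia.
have pm : ~~ (3 %| m)%Z by lia.
split=> [iE|[sq|sq]]; [|exact: descent_image1|]; last first.
  by apply: descent_image_N3 => //; rewrite intr_padic_eq0 mulf_neq0 // expf_neq0.
have [a [b [z [w [ab H]]]]] := torsor_pi3 n_gt0 d9 4 iE.
rewrite nE in H.
have [d3|d3] := boolP (3 %| d)%Z; last first.
  left; apply: is_square_odd => //.
  have [pa|pa] := boolP (3 %| a)%Z; last first.
    apply: (torsor_unit_qres p_pr (a := a) (z := z)
      (w := 2 * m * d * a ^+ 2 * b ^+ 2 - 9 * m ^+ 2 * b ^+ 4 + w * 27)) => //.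
    by rewrite H; ring.
  (* The quartic is then 27 times a form, so [z] is divisible by 9 and that form vanishes modulo
     3. *)
  move: ab; rewrite pa /= => pb; case/dvdzP: (pa) => a' aE.
  have : (3 %| d * z ^+ 2)%Z.
    rewrite H aE; apply/dvdzP.
    exists (9 * ((3 * d * a' ^+ 2 - m * b ^+ 2) * (d * a' ^+ 2 + m * b ^+ 2) + 3 * w)); ring.
  rewrite dvdz_mulP // (negPf d3) dvdz_sqr //= => /dvdzP [z1 zE].
  have H1 : d * z1 ^+ 2 = 3 * ((3 * d * a' ^+ 2 - m * b ^+ 2) * (d * a' ^+ 2 + m * b ^+ 2) + 3 * w).
    apply: (mulfI (x := 9)) => //; transitivity (d * z ^+ 2); first by rewrite zE; ring.
    by rewrite H aE; ring.
  have : (3 %| d * z1 ^+ 2)%Z by rewrite H1 dvdz_mulr.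
  rewrite dvdz_mulP // (negPf d3) dvdz_sqr //= => /dvdzP [z2 zE'].
  have : (3 %| (3 * d * a' ^+ 2 - m * b ^+ 2) * (d * a' ^+ 2 + m * b ^+ 2))%Z.
    apply/dvdzP; exists (d * z2 ^+ 2 - w); apply: (mulfI (x := 3)) => //.
    apply/eqP; rewrite -subr_eq0; apply/eqP.
    transitivity (d * z1 ^+ 2 - 9 * d * z2 ^+ 2); first by rewrite H1; ring.
    by rewrite zE'; ring.
  rewrite dvdz_mulP // => /orP [pX|pX].
    have : (3 %| m * b ^+ 2)%Z.
      by apply: dvdz_conv (rpredB (dvdz_mulr (d * a' ^+ 2) (dvdzz 3)) pX) _; ring.
    by rewrite dvdz_mulP // (negPf pm) dvdz_sqr // (negPf pb).
  have pa' : ~~ (3 %| a')%Z.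
    apply: contra pb => pa'; have : (3 %| m * b ^+ 2)%Z.
      rewrite -(addKr (d * a' ^+ 2) (m * b ^+ 2)) rpredD // rpredN dvdz_mull //.
      by rewrite dvdz_sqr.
    by rewrite dvdz_mulP // (negPf pm) dvdz_sqr.
  apply: qresNm => //; apply: (qres_mulsqr (b := a')) => //; exists (m * b).
  by apply: dvdz_conv (dvdz_mull m pX) _; ring.
have [d' dE d3'] := three_decomp d3.
right; rewrite dE in H *; have -> : d' * 3 * - 3 = - d' * 3%:Z ^+ 2 by ring.
apply: is_squareM; last exact: is_square_sqr.
have d3N : ~~ (3 %| - d')%Z by rewrite rpredN.
apply: is_square_odd => //.
have [z' H'] := torsor_ramified p_pr (d' := d') (z := z) (w := w * 3)
  (X := (d' * a ^+ 2 - m * b ^+ 2) * (d' * a ^+ 2 + 3 * m * b ^+ 2)) d3' ltac:(rewrite H; ring).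
have : (3 %| (d' * a ^+ 2 - m * b ^+ 2) * (d' * a ^+ 2 + 3 * m * b ^+ 2))%Z.
  by apply/dvdzP; exists (d' * z' ^+ 2 - w * 3); rewrite [RHS]mulrBl H'; ring.
rewrite dvdz_mulP // => /orP [] pX.
  have pa : ~~ (3 %| a)%Z.
    apply: contra ab => pa; rewrite pa /= -dvdz_sqr //.
    have : (3 %| m * b ^+ 2)%Z.
      rewrite -(subKr (d' * a ^+ 2) (m * b ^+ 2)) rpredB // dvdz_mull //.
      by rewrite dvdz_sqr.
    by rewrite dvdz_mulP // (negPf pm).
  apply: qresNm => //; apply: (qres_mulsqr (b := a)) => //; exists (m * b).
  by apply: dvdz_conv (dvdz_mull (- m) pX) _; ring.
(* Here 3 divides [a], and modulo 3 the equation becomes [d' z'^2 = - (m b^2)^2]. *)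
have pa : (3 %| a)%Z.
  have : (3 %| d' * a ^+ 2)%Z.
    by apply: dvdz_conv (rpredB pX (dvdz_mulr (m * b ^+ 2) (dvdzz 3))) _; ring.
  by rewrite dvdz_mulP // (negPf d3') dvdz_sqr.
move: ab; rewrite pa /= => pb; case/dvdzP: (pa) => a' aE.
apply: (qres_mulsqr (b := m * b ^+ 2)) => //.
  by rewrite dvdz_mulP // negb_or pm dvdz_sqr.
exists (d' * z').
have H1 : d' * z' ^+ 2 =
  (9 * d' * a' ^+ 2 - m * b ^+ 2) * (3 * d' * a' ^+ 2 + m * b ^+ 2) + 3 * w.
  apply: (mulIf (x := 3)) => //; rewrite [LHS]H' aE; ring.
apply/dvdzP; exists (d' * (9 * d' ^+ 2 * a' ^+ 4 + 2 * d' * a' ^+ 2 * m * b ^+ 2 + w)).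
have -> : (d' * z') ^+ 2 = d' * (d' * z' ^+ 2) by ring.
by rewrite H1; ring.
Qed.

(** When 3 divides [d], the form of the ramified case is modulo 3 the square of [d' a^2 + 4 m b^2].
    Reading the equation modulo 9 then gives [z^2 = - m (a b)^2] modulo 3, hence [m = 2] mod 3, and
    the vanishing of the squared term fixes the class of [d']. *)
Lemma local_isogenous_three : ~~ (3 %| m)%Z ->
  descent_image E' Q3 (sqclass d%:~R) <->
  is_square Q3 d \/ (3 %| m - 2)%Z /\ is_square Q3 (d * 3).
Proof.
move=> pm; have d0 := sqfree_intr_neq0 p_pr d9.
have n3 : (3 %| N)%Z by rewrite nE dvdz_mull.
have n9 : ~~ (3%:Z ^+ 2 %| N)%Z by rewrite nE expr2 dvdz_mul2r.
have [d3|d3] := boolP (3 %| d)%Z; last first.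
  rewrite local_isogenous_unit //; split=> [|[//|[_ sq]]]; first by left.
  exfalso; apply: is_square_val1 sq; first exact: dvdz_mull.
  by rewrite Gauss_dvdzr // coprimezXl // coprimez_prime.
have [d' dE d3'] := three_decomp d3.
split=> [iE|[sq|[m2 sq]]]; [right|exact: descent_image1|].
  have [a [b [z [w [pa pb H]]]]] := isogenous_ramified n_gt0 d9 isT nE dE pm d3' n3 iE.
  have /dvdzP [v vE] : (3 %| d' * a ^+ 2 + 4 * m * b ^+ 2)%Z.
    rewrite -dvdz_sqr //; apply/dvdzP.
    exists (d' * z ^+ 2 - w * 3 + 4 * m * d' * a ^+ 2 * b ^+ 2).
    by rewrite [RHS]mulrDl [X in _ = X + _]mulrBl H; ring.
  have H1 : d' * (z ^+ 2 - - m * (a * b) ^+ 2) =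
      3 * (v ^+ 2 + w - m * d' * (a * b) ^+ 2).
    apply: (mulIf (x := 3)) => //.
    transitivity (d' * z ^+ 2 * 3 + 3 * d' * m * (a * b) ^+ 2); first by ring.
    rewrite H; transitivity
      ((d' * a ^+ 2 + 4 * m * b ^+ 2) ^+ 2 - 9 * m * d' * (a * b) ^+ 2 + w * 9); first by ring.
    by rewrite vE; ring.
  have qm : qres 3 (- m).
    apply: (qres_mulsqr (b := a * b)) => //; first by rewrite dvdz_mulP // negb_or pa.
    exists z; have : (3 %| d' * (z ^+ 2 - - m * (a * b) ^+ 2))%Z by rewrite H1 dvdz_mulr.
    by rewrite dvdz_mulP // (negPf d3').
  have m2 : (3 %| m - 2)%Z.
    have pNm : ~~ (3 %| - m)%Z by rewrite rpredN.
    by have := (qres3 pNm).1 qm; move: pm; clear; lia.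
  split=> //; rewrite dE; have -> : d' * 3 * 3 = d' * 3%:Z ^+ 2 by ring.
  apply: is_squareM; last exact: is_square_sqr.
  apply: is_square_odd => //; apply: qresNm => //; apply: (qres_mulsqr (b := a)) => //.
  exists (2 * m * b); apply/dvdzP; exists (m * v).
  rewrite -[m * v * _]mulrA -vE; ring.
have [m' mE] : exists k, m = 3 * k + 2 by exists (m %/ 3)%Z; lia.
(* At [x = 12], of class 3, and [n = 9 m' + 6], the cubic of [E'] equals [72^2 (1 + 3 m' + 3 m'^2)],
   with last factor 1 mod 3. *)
apply: (@descent_image_int _ _ _ 12 72 (1 + 3 * m' + 3 * m' ^+ 2)) => //.
- by rewrite intr_padic_eq0.
- by rewrite /= nE mE; ring.
- apply: is_square3; have -> : 1 + 3 * m' + 3 * m' ^+ 2 - 1 = 3 * (m' + m' ^+ 2) by ring.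
  exact: dvdz_mulr.
- have -> : 12 * d = d * 3 * 2 ^+ 2 by ring.
  by apply: is_squareM => //; exact: is_square_sqr.
Qed.

End Three.

End LocalImages2.

(** * Local images at 2 and at infinity *)

Lemma mod8_cases (n : nat) : (n %% 8)%N \in [:: 1; 3; 7]%N ->
  exists k : int, [\/ n%:Z = 8 * k + 1, n%:Z = 8 * k + 3 | n%:Z = 8 * k + 7].
Proof.
move=> n8; exists (n %/ 8)%N%:Z; have := divn_eq n 8.
by move: n8; rewrite !inE => /or3P [] /eqP ->; [constructor 1|constructor 2|constructor 3]; lia.
Qed.

Lemma mod8_odd (n : nat) : (n %% 8)%N \in [:: 1; 3; 7]%N -> ~~ (2 %| n%:Z)%Z.
Proof. by move=> /mod8_cases [k []]; lia. Qed.

Section TwoInfinity.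
Variable n : nat.
Hypothesis n_gt0 : (0 < n)%N.
Local Notation N := n%:Z.
Local Notation E := (curve_pi3 n).
Local Notation E' := (isogenous (curve_pi3 n)).

(** * The prime 2 *)

Section Two.
Variables (p_pr : prime 2) (d : int).
Hypothesis d4 : ~~ (2%:Z ^+ 2 %| d)%Z.
Hypothesis n8 : (n %% 8)%N \in [:: 1; 3; 7]%N.
Local Notation Q2 := (padic p_pr).

(** For even [d], comparing powers of 2 makes [b], [z] and [a] even in turn. For odd [d] the
    2-torsion gives all four classes modulo 8 when [n] is 3 or 7 mod 8, but only 1 and 5 when
    [n = 1] mod 8; there the points with [x = 3n] and [x = -n] supply 3 and 7, the values [36 n^3]
    and [4 n^3] of the cubic being 2-adic squares. *)
Lemma local_pi3_two : descent_image E Q2 (sqclass d%:~R) <-> ~~ (2 %| d)%Z.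
Proof.
have d0 := sqfree_intr_neq0 p_pr d4; have n2 := (mod8_odd n8).
have N0 : N != 0 by lia.
split=> [iE|d2].
  apply/negP => d2; have [d' dE d2'] := prime_dvd_decomp p_pr d2 d4.
  have [a [b [z [w [ab H]]]]] := torsor_pi3 n_gt0 d4 3 iE.
  rewrite dE in H.
  have pb : (2 %| b)%Z.
    have : (2 %| (N * b ^+ 2) ^+ 2)%Z.
      apply/dvdzP; exists (d' * z ^+ 2 - 2 * d' ^+ 2 * a ^+ 4 - 2 * N * d' * a ^+ 2 * b ^+ 2
        - 4 * w + 2 * (N * b ^+ 2) ^+ 2).
      apply/eqP; rewrite -subr_eq0; apply/eqP.
      transitivity ((d' * 2 * a ^+ 2 - N * b ^+ 2) * (d' * 2 * a ^+ 2 + 3 * N * b ^+ 2)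
        + w * 2%:Z ^+ 3 - d' * 2 * z ^+ 2); first by ring.
      by rewrite -H subrr.
    by rewrite dvdz_sqr // dvdz_mulP // (negPf n2) dvdz_sqr.
  move: ab; rewrite pb andbT => pa; case/dvdzP: pb => b' bE.
  have H1 : d' * z ^+ 2 =
      2 * ((d' * a ^+ 2 - 2 * N * b' ^+ 2) * (d' * a ^+ 2 + 6 * N * b' ^+ 2) + 2 * w).
    apply: (mulfI (x := 2)) => //; transitivity (d' * 2 * z ^+ 2); first by ring.
    by rewrite H bE; ring.
  have : (2 %| d' * z ^+ 2)%Z by rewrite H1 dvdz_mulr.
  rewrite dvdz_mulP // (negPf d2') dvdz_sqr //= => /dvdzP [z' zE].
  have : (2 %| (d' * a ^+ 2) ^+ 2)%Z.
    apply/dvdzP; exists (d' * z' ^+ 2 - 2 * N * b' ^+ 2 * d' * a ^+ 2 + 6 * N ^+ 2 * b' ^+ 4 - w).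
    apply: (mulfI (x := 2)) => //; apply/eqP; rewrite -subr_eq0; apply/eqP.
    transitivity (2 * ((d' * a ^+ 2 - 2 * N * b' ^+ 2) * (d' * a ^+ 2 + 6 * N * b' ^+ 2) + 2 * w)
      - d' * (z' * 2) ^+ 2); first by ring.
    by rewrite -zE -H1 subrr.
  by rewrite dvdz_sqr // dvdz_mulP // (negPf d2') dvdz_sqr // (negPf pa).
have [k nE] := (mod8_cases n8).
have sq8 (e : int) : (8 %| e - 1)%Z -> is_square Q2 e by exact: is_square_two.
have Nr0 : N%:~R != 0 :> Q2 by rewrite intr_padic_eq0.
have N3r0 : (- 3 * N)%:~R != 0 :> Q2 by rewrite intr_padic_eq0 mulf_neq0.
have N32r0 : (- 3 * N ^+ 2)%:~R != 0 :> Q2 by rewrite intr_padic_eq0 mulf_neq0 // expf_neq0.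
have [l dE] : exists l : int, d = 8 * l + 1 \/ d = 8 * l + 3 \/ d = 8 * l + 5 \/ d = 8 * l + 7.
  by exists (d %/ 8)%Z; move: d2; clear; lia.
have mod8 (x y : int) : x = 8 * y + 1 -> is_square Q2 x.
  by move=> ->; apply: sq8; rewrite addrK dvdz_mulr.
case: dE => [dE|[dE|[dE|dE]]]; first by apply: descent_image1 => //; apply: mod8 dE.
- case: nE => nE.
  + apply: (@descent_image_int _ _ _ (3 * N) 6 (N ^+ 3)) => //.
    * by rewrite intr_padic_eq0 mulf_neq0.
    * by rewrite /=; ring.
    * by apply: (mod8 _ (64 * k ^+ 3 + 24 * k ^+ 2 + 3 * k)); rewrite nE; ring.
    * by apply: (mod8 _ (24 * k * l + 9 * k + 3 * l + 1)); rewrite nE dE; ring.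
  + apply: descent_image_n => //.
    by apply: (mod8 _ (8 * k * l + 3 * k + 3 * l + 1)); rewrite nE dE; ring.
  + apply: descent_image_N3n => //.
    by apply: (mod8 _ (- 24 * k * l - 9 * k - 21 * l - 8)); rewrite nE dE; ring.
- apply: descent_image_N3 => //.
  by apply: (mod8 _ (- 3 * l - 2)); rewrite dE; ring.
- case: nE => nE.
  + apply: (@descent_image_int _ _ _ (- N) 2 (N ^+ 3)) => //.
    * by rewrite intr_padic_eq0 oppr_eq0.
    * by rewrite /=; ring.
    * by apply: (mod8 _ (64 * k ^+ 3 + 24 * k ^+ 2 + 3 * k)); rewrite nE; ring.
    * by apply: (mod8 _ (- 8 * k * l - 7 * k - l - 1)); rewrite nE dE; ring.
  + apply: descent_image_N3n => //.
    by apply: (mod8 _ (- 24 * k * l - 21 * k - 9 * l - 8)); rewrite nE dE; ring.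
  + apply: descent_image_n => //.
    by apply: (mod8 _ (8 * k * l + 7 * k + 7 * l + 6)); rewrite nE dE; ring.
Qed.

(** For odd [d], if [a] is odd or divisible by 4, the right-hand side freed of powers of 4 is 1 mod
    4, which gives [d = 1] mod 4. If [a] is exactly divisible by 2, one gets [d (n + 1) = 2] mod 8,
    possible only for [n = 1] mod 8 and [d = 1] mod 4; with [n = 5] mod 8 it would admit [d = 3] mod
    4. *)
Lemma local_isogenous_two : descent_image E' Q2 (sqclass d%:~R) <-> (4 %| d - 1)%Z.
Proof.
have d0 := sqfree_intr_neq0 p_pr d4; have n2 := (mod8_odd n8).
split=> [iE|d1]; last first.
  have [d8|d8] := boolP (8 %| d - 1)%Z; first exact/descent_image1/is_square_two.
  have [l dE] : exists l : int, d = 8 * l + 5 by exists (d %/ 8)%Z; lia.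
  have [k nE] := odd_sqr n2.
  (* The abscissa 80 has class 5, and there the cubic of [E'] is [16^2] times
     [5 (400 - 20 n + n^2)], which is 1 mod 8 for odd [n]. *)
  apply: (@descent_image_int _ _ _ 80 16 (5 * (400 - 20 * N + N ^+ 2))) => //.
  - by rewrite intr_padic_eq0.
  - by rewrite /=; ring.
  - apply: is_square_two; have [v vE] : exists v : int, N = 2 * v + 1 by exists (N %/ 2)%Z; lia.
    rewrite nE vE; apply/dvdzP; exists (5 * k + 238 - 25 * v); ring.
  - have -> : 80 * d = (5 * d) * 4 ^+ 2 by ring.
    apply: is_squareM; last exact: is_square_sqr.
    by apply: is_square_two; rewrite dE; apply/dvdzP; exists (5 * l + 3); ring.
(* Precision 7: for odd [d] and even [a] a factor 16 is divided out, leaving an equation modulo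
   8. *)
have [a [b [z [w [ab H]]]]] := torsor_isogenous n_gt0 d4 7 iE.
have [d2|d2] := boolP (2 %| d)%Z.
  exfalso; have [d' dE d2'] := prime_dvd_decomp p_pr d2 d4.
  rewrite dE in H.
  have step (x y : int) : d' * x ^+ 2 = 2 * y -> exists2 x', x = x' * 2 & 2 * (d' * x' ^+ 2) = y.
    move=> xy; have : (2 %| d' * x ^+ 2)%Z by rewrite xy dvdz_mulr.
    rewrite dvdz_mulP // (negPf d2') dvdz_sqr //= => /dvdzP [x' xE]; exists x' => //.
    by apply: (mulfI (x := 2)) => //; rewrite -xy xE; ring.
  have H1 : d' * z ^+ 2 = 2 * (d' ^+ 2 * a ^+ 4 - 2 * N * d' * a ^+ 2 * b ^+ 2
      + 4 * N ^+ 2 * b ^+ 4 + 32 * w).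
    apply: (mulfI (x := 2)) => //; transitivity (d' * 2 * z ^+ 2); first by ring.
    by rewrite H; ring.
  have [z1 zE H2] := step _ _ H1.
  have pa : (2 %| a)%Z.
    have : (2 %| (d' * a ^+ 2) ^+ 2)%Z.
      apply/dvdzP; exists (d' * z1 ^+ 2 + N * d' * a ^+ 2 * b ^+ 2 - 2 * N ^+ 2 * b ^+ 4 - 16 * w).
      apply/eqP; rewrite -subr_eq0; apply/eqP.
      transitivity (d' ^+ 2 * a ^+ 4 - 2 * N * d' * a ^+ 2 * b ^+ 2
        + 4 * N ^+ 2 * b ^+ 4 + 32 * w - 2 * (d' * z1 ^+ 2)); first by ring.
      by rewrite -H2 subrr.
    by rewrite dvdz_sqr // dvdz_mulP // (negPf d2') dvdz_sqr.
  move: ab; rewrite pa /= => pb; case/dvdzP: pa => a' aE.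
  have H3 : d' * z1 ^+ 2 = 2 * (4 * d' ^+ 2 * a' ^+ 4 - 2 * N * d' * a' ^+ 2 * b ^+ 2
      + N ^+ 2 * b ^+ 4 + 8 * w).
    by apply: (mulfI (x := 2)) => //; rewrite H2 aE; ring.
  have [z2 zE2 H4] := step _ _ H3.
  have : (2 %| (N * b ^+ 2) ^+ 2)%Z.
    apply/dvdzP; exists (d' * z2 ^+ 2 + N * d' * a' ^+ 2 * b ^+ 2 - 2 * d' ^+ 2 * a' ^+ 4 - 4 * w).
    apply/eqP; rewrite -subr_eq0; apply/eqP.
    transitivity (4 * d' ^+ 2 * a' ^+ 4 - 2 * N * d' * a' ^+ 2 * b ^+ 2
      + N ^+ 2 * b ^+ 4 + 8 * w - 2 * (d' * z2 ^+ 2)); first by ring.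
    by rewrite -H4 subrr.
  by rewrite dvdz_sqr // dvdz_mulP // (negPf n2) dvdz_sqr // (negPf pb).
have [dd ddE] := odd_sqr d2; have [nn nnE] := odd_sqr n2.
(* An odd square is 1 modulo 4, so an odd right-hand side determines [d] modulo 4. *)
have conclude (x y : int) : d * x ^+ 2 = 4 * y + 1 -> (4 %| d - 1)%Z.
  move=> xy; have x2 : ~~ (2 %| x)%Z.
    apply/negP => /dvdzP [x' xE]; move: xy; rewrite xE.
    have -> : d * (x' * 2) ^+ 2 = 4 * (d * x' ^+ 2) by ring.
    by clear; move: (d * x' ^+ 2) => v; lia.
  have [xx xxE] := odd_sqr x2; move: xy; rewrite xxE.
  have -> : d * (8 * xx + 1) = 8 * (d * xx) + d by ring.
  by clear; move: (d * xx) => v; lia.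
have [pa|pa] := boolP (2 %| a)%Z; last first.
  have [aa aaE] := odd_sqr pa.
  apply: (conclude z (2 * (dd * (8 * aa + 1) ^+ 2 + 8 * aa ^+ 2 + 2 * aa) - N * d * a ^+ 2 * b ^+ 2
    + 4 * N ^+ 2 * b ^+ 4 + 32 * w)).
  have aE4 : a ^+ 4 = (8 * aa + 1) ^+ 2 by rewrite -aaE; ring.
  by rewrite H aE4 ddE; ring.
move: ab; rewrite pa /= => pb; case/dvdzP: pa => a1 aE.
have step (x y : int) : d * x ^+ 2 = 4 * y -> exists2 x', x = x' * 2 & d * x' ^+ 2 = y.
  move=> xy; have : (2 %| d * x ^+ 2)%Z by rewrite xy; apply/dvdzP; exists (2 * y); ring.
  rewrite dvdz_mulP // (negPf d2) dvdz_sqr //= => /dvdzP [x' xE]; exists x' => //.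
  by apply: (mulfI (x := 4)) => //; rewrite -xy xE; ring.
have [z1 _ H1] := step z
  (4 * (d ^+ 2 * a1 ^+ 4 - N * d * a1 ^+ 2 * b ^+ 2 + N ^+ 2 * b ^+ 4 + 8 * w))
  ltac:(rewrite H aE; ring).
have [z2 _ H2] := step _ _ H1.
have [bb bbE] := odd_sqr pb.
have bE : b ^+ 4 = (8 * bb + 1) ^+ 2 by rewrite -bbE; ring.
rewrite bE bbE nnE in H2.
have [pa|pa] := boolP (2 %| a1)%Z.
  case/dvdzP: pa => a2 aE2.
  apply: (conclude z2 (4 * d ^+ 2 * a2 ^+ 4 - N * d * a2 ^+ 2 * (8 * bb + 1)
    + 2 * nn * (8 * bb + 1) ^+ 2 + 16 * bb ^+ 2 + 4 * bb + 2 * w)).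
  by rewrite H2 aE2; ring.
have [aa aaE] := odd_sqr pa.
have aE4 : a1 ^+ 4 = (8 * aa + 1) ^+ 2 by rewrite -aaE; ring.
rewrite aE4 aaE ddE in H2.
have [y H3] : exists y, d * z2 ^+ 2 = 8 * y + 2 - N * d.
  exists (dd * (8 * aa + 1) ^+ 2 + 8 * aa ^+ 2 + 2 * aa - N * d * (8 * aa * bb + aa + bb)
    + nn * (8 * bb + 1) ^+ 2 + 8 * bb ^+ 2 + 2 * bb + w).
  by rewrite H2; ring.
have [v vE] : exists v : int, d = 2 * v + 1 by exists (d %/ 2)%Z; move: d2; clear; lia.
have [k nE] := (mod8_cases n8).
have zz : ~~ (2 %| z2)%Z.
  apply/negP => /dvdzP [x' xE]; move: H3; rewrite xE vE.
  have -> : (2 * v + 1) * (x' * 2) ^+ 2 = 4 * ((2 * v + 1) * x' ^+ 2) by ring.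
  move: (_ * x' ^+ 2) => t.
  have Nd r : (8 * k + r) * (2 * v + 1) = 2 * (8 * (k * v) + 4 * k + r * v) + r by ring.
  by case: nE => ->; rewrite Nd; clear; move: (k * v) => kv; lia.
have [zq zqE] := odd_sqr zz; rewrite zqE in H3.
have H4 : d + N * d - 2 = 8 * (y - d * zq).
  transitivity (d * (8 * zq + 1) + N * d - 2 - 8 * (d * zq)); first by ring.
  by rewrite H3; ring.
move: H4; move: (y - d * zq) => {H3} t; move: vE.
case: nE => ->.
- have -> : d + (8 * k + 1) * d - 2 = 8 * (k * d) + 2 * d - 2 by ring.
  by clear; move: (k * d) => kd; lia.
- have -> : d + (8 * k + 3) * d - 2 = 8 * (k * d) + 4 * d - 2 by ring.
  by clear; move: (k * d) => kd; lia.
- have -> : d + (8 * k + 7) * d - 2 = 8 * (k * d) + 8 * d - 2 by ring.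
  by clear; move: (k * d) => kd; lia.
Qed.

End Two.

(** * The real place *)

Section Infinity.
Variables (R : realType) (d : int).
Hypothesis d0 : d != 0.

Lemma is_square_pos (c : int) : 0 <= c -> is_square R c.
Proof. by move=> c0; exists (Num.sqrt c%:~R); rewrite sqr_sqrtr // ler0z. Qed.

Lemma local_pi3_infinity : descent_image E R (sqclass d%:~R).
Proof.
have dR : d%:~R != 0 :> R by rewrite intr_eq0.
have [dpos|dneg] := leP 0 d; first exact/descent_image1/is_square_pos.
apply: descent_image_N3 => //.
  by rewrite intr_eq0 mulf_neq0 // expf_neq0 //; lia.
by apply: is_square_pos; lia.
Qed.

(** The quartic of [E'] is [(d a^2 - 2 n b^2)^2 + 12 (n b^2)^2], positive definite. *)
Lemma local_isogenous_infinity : descent_image E' R (sqclass d%:~R) <-> 0 < d.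
Proof.
have dR : d%:~R != 0 :> R by rewrite intr_eq0.
split=> [iE|dpos]; last by apply/descent_image1/is_square_pos => //; exact: ltW.
have B0 : (coefB E')%:~R != 0 :> R by rewrite intr_eq0 coefB_isogenous_neq0.
have [a [b [z [ab H]]]] := descent_image_torsor dR B0 iE.
rewrite coefB_isogenous !(rmorphM, rmorphN, rmorphXn) /= in H.
rewrite -(ltr0z R) lt_neqAle eq_sym dR /= leNgt; apply/negP => dneg.
move: dneg H dR; set D : R := d%:~R; set m : R := N%:~R => dneg H dR.
have m0 : 0 < m by rewrite ltr0z; lia.
have : 0 < D * z ^+ 2.
  rewrite H; have -> : D ^+ 2 * a ^+ 4 + - 2 * (2 * m) * D * a ^+ 2 * b ^+ 2
      + 16 * m ^+ 2 * b ^+ 4 = (D * a ^+ 2 - 2 * m * b ^+ 2) ^+ 2 + 12 * (m * b ^+ 2) ^+ 2 by ring.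
  have [b0|b0] := eqVneq b 0.
    rewrite b0 expr0n /= !mulr0 subr0 expr0n mulr0 addr0 /=.
    move: ab; rewrite b0 eqxx orbF => a0.
    by rewrite exprn_even_gt0 //= mulf_neq0 // expf_neq0.
  rewrite ltr_wpDl ?sqr_ge0 // mulr_gt0 // exprn_even_gt0 //= mulf_neq0 ?expf_neq0 //.
  by rewrite gt_eqF.
by rewrite ltNge; have := sqr_ge0 z; rewrite (nmulr_rle0 _ dneg) => ->.
Qed.

End Infinity.
End TwoInfinity.

(** * Local description of the Selmer groups *)

(** For [M = n] odd this is [bad_sqfree] with the prime 2 excluded, which is how the condition of S'
    at 2 is recorded. *)
Definition sqfree_in (M d : int) := forall r : nat, prime r ->
  ~~ (r%:Z ^+ 2 %| d)%Z /\ ((r %| d)%Z -> (r %| M)%Z).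

Section SelmerConditions.
Variables (R : realType) (n m : nat).
Hypothesis n_gt0 : (0 < n)%N.
Hypothesis nE : n = (3 * m)%N.
Hypothesis m3 : ~~ (3 %| m)%N.
Hypothesis n8 : (n %% 8)%N \in [:: 1; 3; 7]%N.
Hypothesis n_sqfree : forall r : nat, prime r -> ~~ (r%:Z ^+ 2 %| n%:Z)%Z.
Local Notation N := n%:Z.
Local Notation E := (curve_pi3 n).

Lemma badness_pi3 : badness E = 144 * N ^+ 6.
Proof. by rewrite /badness /=; ring. Qed.

Lemma n_odd : ~~ (2 %| N)%Z.
Proof. exact: mod8_odd n8. Qed.

Lemma prime_dvd_badness (r : nat) : prime r ->
  (r %| badness E)%Z = (r == 2%N) || (r %| N)%Z.
Proof.
move=> r_pr; rewrite badness_pi3.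
have -> : 144 * N ^+ 6 = (2 * N ^+ 3 * 3 * 2) * (2 * (3 * (2 * N ^+ 3))) by ring.
have r2 : (2%R : int) \in dvdz r = (r == 2%N) by rewrite dvdzE /= dvdn_prime2.
have r3 : (3%R : int) \in dvdz r = (r == 3%N) by rewrite dvdzE /= dvdn_prime2.
have rn : N ^+ 3 \in dvdz r = (r %| N)%Z.
  by rewrite !dvdzE abszX Euclid_dvdX // andbT.
rewrite !(rn, r2, r3, dvdz_mulP) //.
have n3 : r == 3%N -> (r %| N)%Z by move=> /eqP ->; rewrite dvdzE !absz_nat nE dvdn_mulr.
by move: n3; case: (r == 2%N); case: (r %| N)%Z; case: (r == 3%N) => //= /(_ isT).
Qed.

Lemma bad_sqfree_pi3 (d : int) : bad_sqfree E d -> ~~ (2 %| d)%Z -> sqfree_in N d.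
Proof.
move=> dE d2 r r_pr; have [r2d rd] := dE r r_pr; split=> //.
move=> /[dup] rd' /rd; rewrite prime_dvd_badness // => /predU1P [r2|//].
by rewrite r2 in rd'; rewrite rd' in d2.
Qed.

Lemma sqfree_in_bad (d : int) : sqfree_in N d -> bad_sqfree E d.
Proof.
move=> dE r r_pr; have [r2d rd] := dE r r_pr; split=> //.
by move=> /rd; rewrite prime_dvd_badness // => ->; rewrite orbT.
Qed.

Lemma sqfree_in_odd (d : int) : sqfree_in N d -> ~~ (2 %| d)%Z.
Proof. by move=> dE; apply/negP => /(dE 2%N isT).2; exact/negP/n_odd. Qed.

Lemma sqfree_in_neq0 (M d : int) : sqfree_in M d -> d != 0.
Proof. by move=> dE; have [/sqfree_neq0] := dE 2%N isT. Qed.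

Lemma three_cofactor : N = m%:Z * 3.
Proof. by rewrite nE; lia. Qed.

Lemma prime_dvd_n (r : nat) : prime r -> (r %| N)%Z -> odd r.
Proof.
move=> r_pr rn; case: (even_prime r_pr) => // r2.
by move: rn; rewrite r2 => rn; have := n_odd; rewrite rn.
Qed.

Lemma m3z : ~~ (3 %| m%:Z)%Z.
Proof. exact: m3. Qed.

(** The real place, the odd primes 2 mod 3 and, if [m = 1] mod 3, the prime 3 impose nothing, their
    images being everything; the place 2 turns [bad_sqfree] into [sqfree_in]. *)
Lemma Selmer'P (d : int) : Selmer' R E d <->
  [/\ sqfree_in N d,
      forall p (p_pr : prime p), (p %| N)%Z -> (p %% 3 = 1)%N -> square_mod p_pr N d
    & (m %% 3 = 2)%N -> forall p_pr : prime 3, square_mod p_pr (- 3) d].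
Proof.
split=> [[dE loc]|[dE locp loc3]].
  have d4 : ~~ (2%:Z ^+ 2 %| d)%Z := (dE 2%N isT).1.
  have d2 : ~~ (2 %| d)%Z.
    apply/(local_pi3_two n_gt0 (isT : prime 2) d4 n8).
    by apply: (loc (@Finite 2 isT)) => /=; rewrite prime_dvd_badness.
  split; first exact: bad_sqfree_pi3.
    move=> p p_pr pn p1.
    apply/(local_pi3_split n_gt0 p_pr (dE p p_pr).1 (prime_dvd_n p_pr pn)) => //.
    - by rewrite p1.
    - exact: n_sqfree.
    - exact: qres_N3.
    - by apply: (loc (Finite p_pr)); rewrite /= prime_dvd_badness // pn orbT.
  move=> m2 p_pr; apply/(local_pi3_three2 n_gt0 p_pr three_cofactor (dE 3%N p_pr).1); first lia.
  apply: (loc (Finite p_pr)); rewrite /= prime_dvd_badness //.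
  by rewrite three_cofactor dvdz_mull.
split; first exact: sqfree_in_bad.
case=> [_|p p_pr] /=; first exact: (local_pi3_infinity n_gt0 _ (sqfree_in_neq0 dE)).
have p2d := (dE p p_pr).1.
rewrite prime_dvd_badness // => /predU1P [p2|pn].
  subst p; apply/local_pi3_two => //; exact: sqfree_in_odd.
have p_odd := prime_dvd_n p_pr pn.
have : [\/ p %% 3 = 0, p %% 3 = 1 | p %% 3 = 2]%N.
  by have := ltn_pmod p (isT : 0 < 3)%N; case: (p %% 3)%N => [|[|[|//]]] _;
    [constructor 1|constructor 2|constructor 3].
case=> pm.
- have p3 : p = 3%N by apply/esym/eqP; rewrite -dvdn_prime2 // /dvdn pm.
  subst p; have [m2|m2] := eqVneq (m %% 3)%N 2%N.
    apply/(local_pi3_three2 n_gt0 p_pr three_cofactor p2d); [lia|exact: loc3].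
  by apply: (local_pi3_three1 n_gt0 p_pr three_cofactor p2d); have := m3; move: m2; clear; lia.
- apply/local_pi3_split => //; [by rewrite pm|exact: n_sqfree|exact: qres_N3|exact: locp].
- by apply: local_pi3_inert => //; [by rewrite pm|exact: n_sqfree|exact: nqres_N3].
Qed.

Lemma SelmerP (d : int) : Selmer R E d <->
  [/\ 0 < d /\ (4 %| d - 1)%Z, sqfree_in N d,
      forall p (p_pr : prime p), (p %| N)%Z -> (p %% 3 = 1)%N -> square_mod p_pr (- N) d,
      forall p (p_pr : prime p), (p %| N)%Z -> (p %% 3 = 2)%N -> is_square (padic p_pr) d
    & forall p_pr : prime 3, is_square (padic p_pr) d \/
        (m %% 3 = 2)%N /\ is_square (padic p_pr) (d * 3)].
Proof.
have m2E : (3 %| m%:Z - 2)%Z = ((m %% 3)%N == 2%N) by have := m3; clear; lia.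
split=> [[dE loc]|[[d_gt0 d1] dE locp locq loc3]].
  have d4 : ~~ (2%:Z ^+ 2 %| d)%Z := (dE 2%N isT).1.
  have d1 : (4 %| d - 1)%Z.
    apply/(local_isogenous_two n_gt0 (isT : prime 2) d4 n8).
    by apply: (loc (@Finite 2 isT)) => /=; rewrite prime_dvd_badness.
  split.
  - split=> //; apply/(local_isogenous_infinity n_gt0 R (sqfree_neq0 d4)).
    exact: (loc Infinite).
  - by apply: bad_sqfree_pi3 => //; move: d1; clear; lia.
  - move=> p p_pr pn p1.
    apply/(local_isogenous_split n_gt0 p_pr (dE p p_pr).1 (prime_dvd_n p_pr pn)) => //.
    + by rewrite p1.
    + exact: n_sqfree.
    + exact: qres_N3.
    + by apply: (loc (Finite p_pr)); rewrite /= prime_dvd_badness // pn orbT.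
  - move=> p p_pr pn p1; have p_odd := prime_dvd_n p_pr pn.
    apply/(local_isogenous_inert n_gt0 p_pr (dE p p_pr).1 p_odd) => //.
    + by rewrite p1.
    + exact: n_sqfree.
    + exact: nqres_N3.
    + by apply: (loc (Finite p_pr)); rewrite /= prime_dvd_badness // pn orbT.
  - move=> p_pr.
    have := (local_isogenous_three n_gt0 p_pr three_cofactor (dE 3%N p_pr).1 m3z).1.
    rewrite m2E => -[|sq|[/eqP m2 sq]]; [|by left|by right].
    apply: (loc (Finite p_pr)); rewrite /= prime_dvd_badness //.
    by rewrite three_cofactor dvdz_mull.
split; first exact: sqfree_in_bad.
case=> [_|p p_pr] /=; first by apply/(local_isogenous_infinity n_gt0 R (sqfree_in_neq0 dE)).
have p2d := (dE p p_pr).1.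
rewrite prime_dvd_badness // => /predU1P [p2|pn].
  by subst p; apply/local_isogenous_two.
have p_odd := prime_dvd_n p_pr pn.
have : [\/ p %% 3 = 0, p %% 3 = 1 | p %% 3 = 2]%N.
  by have := ltn_pmod p (isT : 0 < 3)%N; case: (p %% 3)%N => [|[|[|//]]] _;
    [constructor 1|constructor 2|constructor 3].
case=> pm.
- have p3 : p = 3%N by apply/esym/eqP; rewrite -dvdn_prime2 // /dvdn pm.
  subst p; apply/(local_isogenous_three n_gt0 p_pr three_cofactor p2d m3z).
  by rewrite m2E; have [|[-> sq]] := loc3 p_pr; [left|right].
- apply/local_isogenous_split => //; [by rewrite pm|exact: n_sqfree|exact: qres_N3|exact: locp].
- by apply/local_isogenous_inert => //; [by rewrite pm|exact: n_sqfree|exact: nqres_N3|exact: locq].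
Qed.

End SelmerConditions.

(** * Residue graphs *)

Section VertexProd.
Implicit Types V W : {fset int}.

Lemma vertex_prodU V W : [disjoint V & W]%fset ->
  vertex_prod (V `|` W)%fset = vertex_prod V * vertex_prod W.
Proof.
move=> VW; rewrite /vertex_prod -big_cat /=; apply: perm_big; apply: uniq_perm.
- exact: fset_uniq.
- rewrite cat_uniq !fset_uniq andbT /= -all_predC; apply/allP => x xW /=.
  by apply/negP => xV; move/fdisjointP: VW => /(_ x xV); rewrite xW.
- by move=> x; rewrite mem_cat in_fsetU.
Qed.

Lemma vertex_prod_seq (s : seq int) : uniq s ->
  vertex_prod [fset v in s]%fset = \prod_(v <- s) v.
Proof.
move=> s_uniq; apply: perm_big; apply: uniq_perm; [exact: fset_uniq|by []|].
by move=> x; rewrite !inE.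
Qed.

Lemma vertex_prod0 : vertex_prod fset0 = 1.
Proof. by rewrite /vertex_prod big_seq_fset0. Qed.

Lemma arcs_intoE (G : digraph) v W : arcs_into G v W = count (arc G v) W.
Proof.
rewrite /arcs_into -size_filter; apply: perm_size; apply: uniq_perm.
- exact: fset_uniq.
- by rewrite filter_uniq // fset_uniq.
- by move=> x; rewrite mem_filter !inE andbC.
Qed.

End VertexProd.

Definition sqfree (M : int) := forall r : nat, prime r -> ~~ (r%:Z ^+ 2 %| M)%Z.

Lemma sqfree_ne0 M : sqfree M -> M != 0.
Proof. by move=> /(_ 2%N isT) /sqfree_neq0. Qed.

Lemma prod_primes (k : nat) : sqfree k%:Z -> (\prod_(r <- primes k) r)%N = k.
Proof.
move=> k_sq; have k_gt0 : (0 < k)%N by have := sqfree_ne0 k_sq; rewrite lt0n.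
rewrite [RHS](prod_prime_decomp k_gt0) /primes big_map.
apply: eq_big_seq => -[r e] /mem_prime_decomp [r_pr e_gt0 rk] /=.
case: e e_gt0 rk => [//|[|e]] _ rk; first by rewrite expn1.
case/negP: (k_sq r r_pr); rewrite dvdzE abszX !absz_nat.
by apply: dvdn_trans rk; apply: dvdn_exp2l.
Qed.

Section ResidueGraph.
Variable M : int.
Hypothesis M_sq : sqfree M.
Local Notation G := (residue_graph M).

Lemma vertexP v : reflect (M < 0 /\ v = -1 \/ exists r : nat, [/\ prime r, (r %| M)%Z & v = r%:Z])
  (v \in vertices G).
Proof.
rewrite /= !inE /=; apply: (iffP orP).
  case=> [|/mapP [r]].
    by case: ifP => // M0; rewrite inE => /eqP ->; left.
  by rewrite mem_primes => /and3P [r_pr _ rM] ->; right; exists r.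
case=> [[-> ->]|[r [r_pr rM ->]]]; first by left; rewrite inE.
by right; apply: map_f; rewrite mem_primes r_pr absz_gt0 sqfree_ne0.
Qed.

Lemma vertex_prod_graph : vertex_prod (vertices G) = M.
Proof.
have M_absq : sqfree `|M|%N%:Z.
  by move=> r /M_sq; rewrite !dvdzE absz_nat.
have primes_map : uniq [seq r%:Z | r <- primes `|M|%N].
  by rewrite map_inj_uniq ?primes_uniq // => x y [].
have prodE : \prod_(r <- [seq r%:Z | r <- primes `|M|%N]) r = `|M|%N%:Z.
  by rewrite big_map -[in RHS](prod_primes M_absq) (big_morph Posz PoszM (erefl _)).
rewrite vertex_prod_seq.
  rewrite big_cat /= prodE; case: ltP => M0; last by rewrite big_nil mul1r gez0_abs.
  by rewrite big_seq1 mulN1r ltz0_abs // opprK.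
rewrite cat_uniq primes_map andbT.
by case: ifP => _ /=; rewrite -all_predC; apply/allP => x /mapP [r _ ->].
Qed.

Lemma prime_vertex_dvd V1 (r : nat) : prime r -> (V1 `<=` vertices G)%fset ->
  (r %| vertex_prod V1)%Z = (r%:Z \in V1).
Proof.
move=> r_pr V1V; apply/idP/idP => [|rV]; last first.
  rewrite /vertex_prod (big_rem r%:Z) //=.
  exact: dvdz_mulr.
rewrite /vertex_prod -[r%:Z \in V1]/(r%:Z \in enum_fset V1).
have : {subset enum_fset V1 <= vertices G} by move=> x /(fsubsetP V1V).
elim: (enum_fset V1) => [|x s IHs] sub.
  by rewrite big_nil prime_dvdz1.
rewrite big_cons dvdz_mulP // inE => /orP [rx|rs].
  have /vertexP [[_ xE]|[r' [r'_pr _ xE]]] := sub x (mem_head _ _); subst x.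
    by move: rx; rewrite rpredN prime_dvdz1.
  by move: rx; rewrite dvdzE !absz_nat dvdn_prime2 // => /eqP ->; rewrite eqxx.
by rewrite IHs ?orbT // => y ys; apply: sub; rewrite inE ys orbT.
Qed.

(** By multiplicativity each arc from [p] into [W] contributes a sign -1 to the Legendre symbol of
    the product. The hypothesis on [W] keeps [p] itself, to which it has no arc, out of the
    product. *)
Lemma odd_arcs (p : nat) (W : {fset int}) : prime p -> (p %% 3 = 1)%N ->
  (forall w, w \in W -> ~~ (p %| w)%Z) ->
  odd (arcs_into G p W) = ~~ `[< qres p (vertex_prod W) >].
Proof.
move=> p_pr p1 pW; rewrite arcs_intoE /vertex_prod.
have {pW} : forall w, w \in enum_fset W -> ~~ (p %| w)%Z by [].
elim: (enum_fset W) => [|w s IHs] pW.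
  by rewrite big_nil /= asboolT //; exact: qres1.
have pw : ~~ (p %| w)%Z by apply: pW; rewrite inE eqxx.
have ps x : x \in s -> ~~ (p %| x)%Z by move=> xs; apply: pW; rewrite inE xs orbT.
have pprod : ~~ (p %| \prod_(v <- s) v)%Z.
  elim: s ps {IHs pW} => [|x s IHs] ps.
    by rewrite big_nil prime_dvdz1.
  rewrite big_cons dvdz_mulP // negb_or ps ?inE ?eqxx //= IHs // => y ys.
  by apply: ps; rewrite inE ys orbT.
have arcE : arc G p w = ~~ `[< qres p w >].
  rewrite /= legendre_eqN1 //; case: eqVneq => [wE|_] /=.
    by rewrite -wE dvdzz in pw.
  by rewrite ltz_nat prime_gt0 //= modz_nat p1 eqxx.
rewrite big_cons -[count _ _]/(arc G p w + count (arc G p) s)%N oddD arcE IHs // oddb.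
case: asboolP => qw; case: asboolP => qs /=.
- by rewrite asboolT //; exact: qres_mul.
- rewrite asboolF // => q; apply: qs; apply: qres_mulr pw qw _ => //.
  by rewrite mulrC.
- by rewrite asboolF // => q; apply: qw; apply: qres_mulr pprod qs q.
- by rewrite asboolT //; exact: nqres_mul.
Qed.

Lemma even_arcs v W : v \in vertices G -> ~~ ((0 < v) && (v == 1 %[mod 3])%Z) ->
  arcs_into G v W = 0%N.
Proof.
move=> vV nv; rewrite arcs_intoE; apply/eqP; rewrite -leqn0 leqNgt -has_count -all_predC.
apply/allP => w _ /=; apply/negP => /and4P [_ v0 v1 _].
by move: nv; rewrite v0 v1.
Qed.

Section Partition.
Variables V1 V2 : {fset int}.
Hypothesis dis : [disjoint V1 & V2]%fset.
Hypothesis cov : (V1 `|` V2)%fset = vertices G.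

Lemma partition_prod : vertex_prod V1 * vertex_prod V2 = M.
Proof. by rewrite -vertex_prodU // cov vertex_prod_graph. Qed.

(** Vertices other than primes 1 mod 3 emit no arcs, and at these primes the parity of the arcs is a
    residue condition on the product of the other part. *)
Lemma not_odd_partition_qres : ~ odd_partition G V1 V2 <->
  forall p : nat, prime p -> (p %% 3 = 1)%N ->
    (p%:Z \in V1 -> qres p (vertex_prod V2)) /\ (p%:Z \in V2 -> qres p (vertex_prod V1)).
Proof.
have sub1 : (V1 `<=` vertices G)%fset by rewrite -cov fsubsetUl.
have sub2 : (V2 `<=` vertices G)%fset by rewrite -cov fsubsetUr.
have dvd (W : {fset int}) (p : nat) : prime p -> (W `<=` vertices G)%fset -> p%:Z \notin W ->
    forall w, w \in W -> ~~ (p %| w)%Z.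
  move=> p_pr WV pW w wW; apply: contra pW; rewrite -(prime_vertex_dvd p_pr WV) => pw.
  rewrite /vertex_prod (big_rem w) //=; exact: dvdz_mulr.
have in1 (p : int) : p \in V1 -> p \notin V2 by apply/fdisjointP.
have in2 (p : int) : p \in V2 -> p \notin V1.
  by move=> p2; apply/negP => /in1; rewrite p2.
split=> [nodd p p_pr p1|H [] [v vV]].
  split=> pV; apply: contrapT => nq; apply: nodd; [left|right]; exists p%:Z => //.
    by rewrite odd_arcs ?asboolF //; apply: dvd => //; exact: in1.
  by rewrite odd_arcs ?asboolF //; apply: dvd => //; exact: in2.
- have vG : v \in vertices G := fsubsetP sub1 _ vV.
  have [/andP [v0 v1]|nv] := boolP ((0 < v) && (v == 1 %[mod 3])%Z); last by rewrite even_arcs.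
  have [[_ vE]|[r [r_pr _ vE]]] := vertexP _ vG; first by rewrite vE in v0.
  subst v; have r1 : (r %% 3 = 1)%N by move: v1; clear; lia.
  rewrite odd_arcs //; first by rewrite asboolT //; exact: (H r r_pr r1).1.
  by apply: dvd => //; exact: in1.
- have vG : v \in vertices G := fsubsetP sub2 _ vV.
  have [/andP [v0 v1]|nv] := boolP ((0 < v) && (v == 1 %[mod 3])%Z); last by rewrite even_arcs.
  have [[_ vE]|[r [r_pr _ vE]]] := vertexP _ vG; first by rewrite vE in v0.
  subst v; have r1 : (r %% 3 = 1)%N by move: v1; clear; lia.
  rewrite odd_arcs //; first by rewrite asboolT //; exact: (H r r_pr r1).2.
  by apply: dvd => //; exact: in2.
Qed.

(* If [d1 d2 = M] are the products of the two parts, then [d1 M = d2 d1^2], so [d1]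
   has the class of the unit [d2] in [Q_p^* / <M, squares>] when [p] divides [d1]. *)
Lemma not_odd_partition : (forall r : nat, prime r -> (r %| M)%Z -> odd r) ->
  ~ odd_partition G V1 V2 <->
  forall p (p_pr : prime p), (p %| M)%Z -> (p %% 3 = 1)%N -> square_mod p_pr M (vertex_prod V1).
Proof.
move=> M_odd; rewrite not_odd_partition_qres.
have sub1 : (V1 `<=` vertices G)%fset by rewrite -cov fsubsetUl.
have sub2 : (V2 `<=` vertices G)%fset by rewrite -cov fsubsetUr.
have d1_ne0 : vertex_prod V1 != 0.
  by apply: contraNneq (sqfree_ne0 M_sq) => d10; rewrite -partition_prod d10 mul0r.
have inV (p : nat) : prime p -> (p %| M)%Z -> (p%:Z \in V1) || (p%:Z \in V2).
  by move=> p_pr pM; rewrite -in_fsetU cov; apply/vertexP; right; exists p.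
split=> H p p_pr.
  move=> pM p1; have [H1 H2] := H p p_pr p1.
  have [p1V|p1V] := boolP (p%:Z \in V1).
    right; rewrite -partition_prod.
    have -> : vertex_prod V1 * (vertex_prod V1 * vertex_prod V2) =
       vertex_prod V2 * vertex_prod V1 ^+ 2 by ring.
    apply: is_squareM; last exact: is_square_sqr.
    apply: is_square_odd (H1 p1V); first exact: M_odd.
    rewrite (prime_vertex_dvd p_pr sub2); exact: (fdisjointP dis).
  have := inV p p_pr pM; rewrite (negPf p1V) /= => p2V.
  left; apply: is_square_odd (H2 p2V); first exact: M_odd.
  by rewrite (prime_vertex_dvd p_pr sub1).
move=> p1; have [pM|pM] := boolP (p %| M)%Z; last first.
  by split=> pV; case/negP: pM; rewrite -partition_prod dvdz_mulP //
    !(prime_vertex_dvd p_pr sub1, prime_vertex_dvd p_pr sub2) pV ?orbT.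
have p2M := M_sq p_pr.
split=> pV; case: (H p p_pr pM p1) => sq.
- exfalso; apply: is_square_val1 sq; first by rewrite (prime_vertex_dvd p_pr sub1).
  by apply: contra p2M => p2d; rewrite -partition_prod dvdz_mulr.
- have pd2 : ~~ (p %| vertex_prod V2)%Z.
    by rewrite (prime_vertex_dvd p_pr sub2); exact: (fdisjointP dis).
  apply: (is_square_qres pd2); apply: (is_square_padic_mulsqr d1_ne0).
  have -> : vertex_prod V2 * vertex_prod V1 ^+ 2 =
    vertex_prod V1 * (vertex_prod V1 * vertex_prod V2) by ring.
  by rewrite partition_prod.
- apply: is_square_qres sq; rewrite (prime_vertex_dvd p_pr sub1).
  by apply/negP => pV1; have := fdisjointP dis _ pV1; rewrite pV.
- have pd1 : ~~ (p %| vertex_prod V1)%Z.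
    rewrite (prime_vertex_dvd p_pr sub1).
    by apply/negP => pV1; have := fdisjointP dis _ pV1; rewrite pV.
  exfalso; apply: is_square_val1 sq; first by rewrite dvdz_mull.
  by rewrite Gauss_dvdzr // coprimezXl // coprimez_prime.
Qed.

End Partition.
End ResidueGraph.

(** * Divisors, subsets and pigeonhole *)

Lemma prime_dvd_prod (s : seq nat) (r : nat) : (forall x, x \in s -> prime x) -> prime r ->
  (r %| \prod_(x <- s) x)%N = (r \in s).
Proof.
move=> s_pr r_pr; elim: s s_pr => [|x s IHs] s_pr.
  by rewrite big_nil dvdn1 in_nil; apply: gtn_eqF; exact: prime_gt1.
have x_pr : prime x by apply: s_pr; rewrite mem_head.
rewrite big_cons Euclid_dvdM // dvdn_prime2 // inE IHs // => y ys.
by apply: s_pr; rewrite inE ys orbT.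
Qed.

Lemma sqfree_prod (s : seq nat) : (forall x, x \in s -> prime x) -> uniq s ->
  sqfree (\prod_(x <- s) x)%N%:Z.
Proof.
elim: s => [|x s IHs] s_pr /= => [_|/andP [xs s_uniq]] r r_pr; rewrite dvdzE abszX !absz_nat.
  by rewrite big_nil dvdn1 -[1%N](exp1n 2) eqn_exp2r // gtn_eqF // prime_gt1.
have x_pr : prime x by apply: s_pr; rewrite mem_head.
have s_pr' y : y \in s -> prime y by move=> ys; apply: s_pr; rewrite inE ys orbT.
rewrite big_cons; have [rx|rx] := eqVneq r x.
  rewrite rx -mulnn dvdn_pmul2l ?prime_gt0 //; by rewrite prime_dvd_prod.
rewrite Gauss_dvdr; last by rewrite coprimeXl // prime_coprime // dvdn_prime2.
by have := IHs s_pr' s_uniq r r_pr; rewrite dvdzE abszX !absz_nat.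
Qed.

(** There are [2 ^ k] subsets and only [2 ^ l] patterns of satisfied conditions, so two distinct
    subsets share a pattern; their symmetric difference is nonempty and satisfies every
    condition. *)
Lemma pigeonhole_kernel (k l : nat) (good : 'I_l -> {set 'I_k} -> Prop) : (l < k)%N ->
  (forall j A B, (good j A <-> good j B) -> good j ((A :\: B) :|: (B :\: A))) ->
  exists2 A : {set 'I_k}, A != finset.set0 & forall j, good j A.
Proof.
move=> lk goodD.
pose f (A : {set 'I_k}) : {ffun 'I_l -> bool} := [ffun j => `[< good j A >]].
have : ~~ injectiveb f.
  apply/negP => /injectiveP /leq_card; rewrite card_ffun card_bool !card_ord.
  by rewrite -cardsT -powersetT card_powerset cardsT card_ord leq_exp2l // leqNgt lk.
case/injectivePn => A [B AB fAB]; exists ((A :\: B) :|: (B :\: A)).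
  apply: contraNneq AB => D0; apply/eqP/setP => x.
  by move/setP: D0 => /(_ x); rewrite !inE; case: (x \in A); case: (x \in B).
move=> j; apply: goodD.
have /ffunP/(_ j) := fAB; rewrite !ffunE => e.
by split=> /asboolP g; apply/asboolP; [rewrite -e|rewrite e].
Qed.

Section Subproduct.
Variables (k : nat) (X : 'I_k -> nat).
Implicit Types A B : {set 'I_k}.

Definition subprod A : int := (\prod_(i in A) X i)%N%:Z.

(** Symmetric difference of index sets is multiplication modulo squares. *)
Lemma subprod_symdiff A B :
  subprod ((A :\: B) :|: (B :\: A)) * subprod (A :&: B) ^+ 2 = subprod A * subprod B.
Proof.
rewrite /subprod (big_setID B (A := A)) (big_setID A (A := B)) /= (finset.setIC B A).
have -> : (\prod_(i in (A :\: B) :|: (B :\: A)) X i =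
    \prod_(i in A :\: B) X i * \prod_(i in B :\: A) X i)%N.
  rewrite -bigU /=; first by apply: eq_bigl => x; rewrite !inE.
  rewrite finset.disjoints_subset; apply/fintype.subsetP => x; rewrite !inE.
  by case: (x \in A); case: (x \in B).
by rewrite !PoszM; ring.
Qed.

Lemma subprod_seq A : subprod A = (\prod_(x <- [seq X i | i <- enum A]) x)%N%:Z.
Proof. by rewrite /subprod big_map big_enum. Qed.

End Subproduct.

Lemma square_mod_symdiff (p : nat) (p_pr : prime p) (c d1 d2 e f : int) :
  odd p -> (p %| c)%Z -> ~~ (p%:Z ^+ 2 %| c)%Z ->
  ~~ (p%:Z ^+ 2 %| d1)%Z -> ~~ (p%:Z ^+ 2 %| d2)%Z -> e != 0 -> f * e ^+ 2 = d1 * d2 ->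
  (square_mod p_pr c d1 <-> square_mod p_pr c d2) -> square_mod p_pr c f.
Proof.
move=> p_odd pc p2c p2d1 p2d2 e0 fE H; apply: (square_mod_mulsqr e0); rewrite fE.
have [s1|s1] := pselect (square_mod p_pr c d1).
  by apply: square_modM => //; [exact: sqfree_neq0 p2c|exact/H].
by apply: square_mod_index2 => // s2; apply: s1; exact/H.
Qed.

Lemma square_mod_base_sqr (p : nat) (p_pr : prime p) (c d e : int) : e != 0 ->
  square_mod p_pr (c * e ^+ 2) d -> square_mod p_pr c d.
Proof.
by move=> e0 [s|s]; [left|right; apply: (is_square_padic_mulsqr e0); rewrite -mulrA].
Qed.

Lemma vertex_prod_mod3 (V : {fset int}) : (forall v, v \in V -> (3 %| v - 1)%Z) ->
  (3 %| vertex_prod V - 1)%Z.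
Proof.
rewrite /vertex_prod => H.
have {H} : forall v, v \in enum_fset V -> (3 %| v - 1)%Z by [].
elim: (enum_fset V) => [|x s IHs] H; first by rewrite big_nil subrr.
rewrite big_cons; have x1 := H x (mem_head _ _).
have s1 : (3 %| \prod_(v <- s) v - 1)%Z by apply: IHs => v vs; apply: H; rewrite inE vs orbT.
by apply: dvdz_conv (rpredD (dvdz_mull x s1) x1) _; ring.
Qed.

Lemma fset_complement (V1 V : {fset int}) : (V1 `<=` V)%fset ->
  [disjoint V1 & (V `\` V1)]%fset /\ (V1 `|` (V `\` V1))%fset = V.
Proof.
move=> V1V; split; first by apply/fdisjointP => x xV; rewrite inE xV.
apply/fsetP => x; rewrite !inE; case: (boolP (x \in V1)) => //= /(fsubsetP V1V) -> //.
Qed.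

Section VertexSets.
Variable M : int.
Hypothesis M_sq : sqfree M.
Local Notation V := (vertices (residue_graph M)).

Lemma sqfree_in_sqfree (d : int) : sqfree_in M d -> sqfree d.
Proof. by move=> dM r /dM []. Qed.

Lemma vertices_sub (d : int) : sqfree_in M d -> 0 < d ->
  (vertices (residue_graph d) `<=` V)%fset.
Proof.
move=> dM d0; have d_sq := sqfree_in_sqfree dM.
apply/fsubsetP => v /(vertexP d_sq) [[]|[r [r_pr rd ->]]]; first by rewrite ltNge ltW.
by apply/(vertexP M_sq); right; exists r; split=> //; exact: (dM r r_pr).2.
Qed.

Lemma vertex_prod_dvd (V1 : {fset int}) : (V1 `<=` V)%fset -> (vertex_prod V1 %| M)%Z.
Proof.
move=> /fset_complement [dis cov].
by rewrite -(partition_prod M_sq dis cov) dvdz_mulr.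
Qed.

Lemma vertex_prod_sqfree_in (V1 : {fset int}) : (V1 `<=` V)%fset ->
  sqfree_in M (vertex_prod V1).
Proof.
move=> V1V r r_pr; have dM := vertex_prod_dvd V1V.
split=> [|rd]; last exact: dvdz_trans rd dM.
by apply: contra (M_sq r_pr) => r2; exact: dvdz_trans r2 dM.
Qed.

Lemma vertex_prod_gt0 (V1 : {fset int}) : (forall v, v \in V1 -> 0 < v) -> 0 < vertex_prod V1.
Proof. by move=> H; rewrite /vertex_prod big_seq; apply: prodr_gt0 => v /H. Qed.

Lemma vertex_prod_eq1 (V1 : {fset int}) : (V1 `<=` V)%fset -> (forall v, v \in V1 -> 0 < v) ->
  vertex_prod V1 = 1 -> V1 = fset0.
Proof.
move=> V1V V1_gt0 d1; apply/eqP; rewrite -[_ == _]negbK; apply/negP => /fset0Pn [v vV1].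
have [[_ vE]|[r [r_pr _ vE]]] := vertexP M_sq _ (fsubsetP V1V _ vV1).
  by have := V1_gt0 v vV1; rewrite vE.
by move: vV1; rewrite vE -(prime_vertex_dvd M_sq r_pr V1V) d1 prime_dvdz1.
Qed.

Lemma odd_partitionC (G : digraph) (V1 V2 : {fset int}) :
  odd_partition G V1 V2 -> odd_partition G V2 V1.
Proof. by case; [right|left]. Qed.

End VertexSets.

(** * The four equivalences *)

Section Main.
Variables (R : realType) (ps qs : seq nat) (n m : nat).
Hypothesis ps_pr : forall x, x \in ps -> [/\ prime x, odd x & (x %% 3 = 1)%N].
Hypothesis qs_pr : forall x, x \in qs -> [/\ prime x, odd x & (x %% 3 = 2)%N].
Hypothesis pq_uniq : uniq (ps ++ qs).
Hypothesis mE : m = (\prod_(x <- ps ++ qs) x)%N.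
Hypothesis nE : n = (3 * m)%N.
Hypothesis n24 : (n %% 24)%N \in [:: 3; 9; 15]%N.
Local Notation N := n%:Z.
Local Notation E := (curve_pi3 n).

Lemma pq_prime x : x \in ps ++ qs -> prime x.
Proof. by rewrite mem_cat => /orP [/ps_pr []|/qs_pr []]. Qed.

Lemma three_notin : 3%N \notin ps ++ qs.
Proof. by rewrite mem_cat; apply/negP => /orP [/ps_pr []|/qs_pr []]. Qed.

Lemma n_prod : n = (\prod_(x <- 3 :: ps ++ qs) x)%N.
Proof. by rewrite big_cons -mE. Qed.

Lemma npq_prime x : x \in 3%N :: ps ++ qs -> prime x.
Proof. by rewrite inE => /predU1P [->//|/pq_prime]. Qed.

Lemma sqfree_n : sqfree N.
Proof.
rewrite n_prod; apply: sqfree_prod; first exact: npq_prime.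
by rewrite /= three_notin.
Qed.

Lemma sqfree_m : sqfree m%:Z.
Proof. by rewrite mE; apply: sqfree_prod; first exact: pq_prime. Qed.

Lemma sqfree_Nn : sqfree (- N).
Proof. by move=> r r_pr; rewrite rpredN sqfree_n. Qed.

Lemma dvd_n r : prime r -> (r %| N)%Z = (r \in 3%N :: ps ++ qs).
Proof. by move=> r_pr; rewrite n_prod -(prime_dvd_prod npq_prime r_pr). Qed.

Lemma dvd_m r : prime r -> (r %| m%:Z)%Z = (r \in ps ++ qs).
Proof. by move=> r_pr; rewrite mE -(prime_dvd_prod pq_prime r_pr). Qed.

Lemma nat_n_gt0 : (0 < n)%N.
Proof. by have := sqfree_ne0 sqfree_n; rewrite lt0n. Qed.

Lemma nat_m_gt0 : (0 < m)%N.
Proof. by have := nat_n_gt0; rewrite nE; lia. Qed.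

Lemma m_coprime3 : ~~ (3 %| m)%N.
Proof. by have := dvd_m (isT : prime 3); rewrite (negPf three_notin) => /negbT. Qed.

Lemma n_mod8 : (n %% 8)%N \in [:: 1; 3; 7]%N.
Proof.
move: n24; rewrite !inE; clear; move=> /or3P [] /eqP nE; apply/or3P;
  [constructor 2|constructor 1|constructor 3]; lia.
Qed.

Lemma dvd_n_odd r : prime r -> (r %| N)%Z -> odd r.
Proof. exact: (prime_dvd_n n_mod8). Qed.

Lemma NE : N = m%:Z * 3.
Proof. by rewrite nE; lia. Qed.

Lemma split_ps r : prime r -> (r %| N)%Z -> (r %% 3 = 1)%N -> r \in ps.
Proof.
move=> r_pr; rewrite dvd_n // inE mem_cat => /or3P [/eqP ->//|//|/qs_pr [_ _ ->//]].
Qed.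

Lemma inert_qs r : prime r -> (r %| N)%Z -> (r %% 3 = 2)%N -> r \in qs.
Proof.
move=> r_pr; rewrite dvd_n // inE mem_cat => /or3P [/eqP ->//|/ps_pr [_ _ ->//]|//].
Qed.

Lemma ps_dvd r : r \in ps -> (r %| N)%Z.
Proof. by move=> rp; have [r_pr _ _] := ps_pr rp; rewrite dvd_n // inE mem_cat rp orbT. Qed.

Lemma split_N3 r (r_pr : prime r) : (r %% 3 = 1)%N -> odd r -> is_square (padic r_pr) (- 3).
Proof.
move=> r1 r_odd; apply: is_square_odd => //; last exact: qres_N3.
by rewrite rpredN dvdp_3 // r1.
Qed.

(** * The group S' *)

Local Notation good' d := (forall p (p_pr : prime p),
  (p %| N)%Z -> (p %% 3 = 1)%N -> square_mod p_pr N d).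
Local Notation good d := (forall p (p_pr : prime p),
  (p %| N)%Z -> (p %% 3 = 1)%N -> square_mod p_pr (- N) d).

Lemma good'M d1 d2 : good' d1 -> good' d2 -> good' (d1 * d2).
Proof.
move=> g1 g2 p p_pr pN p1; apply: square_modM; [exact: sqfree_ne0 sqfree_n|exact: g1|exact: g2].
Qed.

Lemma good'_mulsqr d e : e != 0 -> good' (d * e ^+ 2) -> good' d.
Proof. by move=> e0 g p p_pr pN p1; apply: (square_mod_mulsqr e0); exact: g. Qed.

Lemma good'1 : good' 1.
Proof. by move=> p p_pr _ _; left; exact: is_square1. Qed.

Lemma good'N3 : good' (- 3).
Proof. by move=> p p_pr pN p1; left; apply: split_N3 => //; exact: dvd_n_odd pN. Qed.

Lemma good'N : good' N.
Proof. by move=> p p_pr pN p1; right; rewrite -expr2; exact: is_square_sqr. Qed.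

Lemma good'Nm : good' (- m%:Z).
Proof.
have N0 := sqfree_ne0 sqfree_n.
apply: (@good'_mulsqr _ 3) => //; have -> : - m%:Z * 3 ^+ 2 = - 3 * N by rewrite NE; ring.
by apply: good'M; [exact: good'N3|exact: good'N].
Qed.

Lemma Nm_mod3 : (m %% 3 = 2)%N -> (3 %| - m%:Z - 1)%Z.
Proof. by clear; lia. Qed.

(** Images of the 2-torsion of [E]; [- m] is the square-free form of [-3n = -9m]. *)
Local Notation T := [set 1; N; - m%:Z; - 3].

Lemma sqfree_in_N M d : sqfree_in M d -> sqfree_in M (- d).
Proof. by move=> dM r r_pr; rewrite !rpredN; exact: dM. Qed.

Lemma sqfree_in1 M : sqfree_in M 1.
Proof.
move=> r r_pr; rewrite prime_dvdz1 //; split=> //.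
by rewrite dvdzE abszX dvdn1 -[1%N](exp1n 2) eqn_exp2r // gtn_eqF // prime_gt1.
Qed.

Lemma sqfree_inM M a b : sqfree_in M a -> sqfree_in M b ->
  (forall r : nat, prime r -> (r %| a)%Z -> ~~ (r %| b)%Z) -> sqfree_in M (a * b).
Proof.
move=> aM bM co r r_pr; have [r2a ra] := aM r r_pr; have [r2b rb] := bM r r_pr.
split; last by rewrite (dvdz_mulP _ _ r_pr) => /orP [].
have [r_a|r_a] := boolP (r %| a)%Z.
  by rewrite Gauss_dvdzl // coprimezXl // coprimez_prime // co.
by rewrite Gauss_dvdzr // coprimezXl // coprimez_prime.
Qed.

Lemma sqfree_in_m : sqfree_in N m%:Z.
Proof.
move=> r r_pr; split=> [|rm]; first exact: sqfree_m.
by rewrite NE dvdz_mulr.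
Qed.

Lemma sqfree_in_3 : sqfree_in N 3.
Proof.
move=> r r_pr; split.
  rewrite dvdzE abszX /=; apply/negP => /(dvdn_leq (isT : 0 < 3)%N).
  by have := prime_gt1 r_pr; case: r {r_pr} => [|[|r]] // _; rewrite -mulnn; lia.
by move=> r3; rewrite NE dvdz_mull.
Qed.

Lemma Selmer'_trivial : T `<=` Selmer' R E.
Proof.
move=> d dT; apply/(Selmer'P R nat_n_gt0 nE m_coprime3 n_mod8 sqfree_n).
case: dT => [[[->|->]|->]|->]; split.
- exact: sqfree_in1.
- exact: good'1.
- by move=> _ p_pr; left; exact: is_square1.
- by move=> r r_pr; split=> //; exact: sqfree_n.
- exact: good'N.
- move=> m2 p_pr; right; have -> : N * - 3 = - m%:Z * 3 ^+ 2 by rewrite NE; ring.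
  by apply: is_squareM; [apply: is_square3; exact: Nm_mod3|exact: is_square_sqr].
- exact/sqfree_in_N/sqfree_in_m.
- exact: good'Nm.
- by move=> m2 p_pr; left; apply: is_square3; exact: Nm_mod3.
- exact/sqfree_in_N/sqfree_in_3.
- exact: good'N3.
- by move=> _ p_pr; right; rewrite -expr2; exact: is_square_sqr.
Qed.

Lemma trivial_eq_sub : Selmer' R E `<=` T <-> Selmer' R E = T.
Proof.
split=> [sub|->//]; apply/seteqP; split=> //; exact: Selmer'_trivial.
Qed.

(* The [2^(t+s)] divisors of [m] meet only [t + eps] index-two conditions, so when
   [s > eps] two of them have a nontrivial quotient in the Selmer group. *)
Lemma Selmer'_bound (eps : bool) : ((m %% 3 = 2)%N -> eps) ->
  Selmer' R E `<=` T -> (size qs <= eps)%N.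
Proof.
move=> epsP sub; rewrite leqNgt; apply/negP => lt_eps.
pose k := size (ps ++ qs); pose l := (size ps + eps)%N.
pose X (i : 'I_k) := nth 0%N (ps ++ qs) i.
have X_in i : X i \in ps ++ qs by apply: mem_nth.
have lk : (l < k)%N by rewrite /k size_cat ltn_add2l.
(* Indices below [size ps] are the conditions at the primes of [ps]; the extra index, present when
   [eps] holds, reads the default 3 and stands for the condition at 3, with base -3. *)
pose pp (j : 'I_l) := nth 3%N ps j.
pose cc (j : 'I_l) := if (j < size ps)%N then N else - 3 : int.
have X_sq A : sqfree (subprod X A).
  rewrite subprod_seq; apply: sqfree_prod => [x /mapP [i _ ->]|]; first exact: pq_prime.
  rewrite map_inj_uniq ?enum_uniq // => i j /eqP.
  by rewrite nth_uniq // => /eqP/val_inj.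
have ppr j : prime (pp j).
  rewrite /pp; have [jp|jp] := ltnP j (size ps); last by rewrite nth_default.
  by have [] := ps_pr (mem_nth 3%N jp).
have [j A B|A A0 Agood] := @pigeonhole_kernel k l
  (fun j A => square_mod (ppr j) (cc j) (subprod X A)) lk.
  have ccP : [/\ odd (pp j), (pp j %| cc j)%Z & ~~ ((pp j)%:Z ^+ 2 %| cc j)%Z].
    rewrite /pp /cc; have [jp|jp] := ltnP j (size ps); last by rewrite nth_default.
    have pj := mem_nth 3%N jp; have [pj_pr pj_odd _] := ps_pr pj.
    by split=> //; [exact: ps_dvd|exact: sqfree_n].
  case: ccP => p_odd pc p2c AB.
  apply: (square_mod_symdiff p_odd pc p2c (X_sq A _ (ppr j)) (X_sq B _ (ppr j)) _
    (subprod_symdiff X A B) AB).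
  exact: sqfree_ne0 (X_sq _).
have mem_prod r : prime r -> (r %| subprod X A)%Z -> r \in ps ++ qs.
  move=> r_pr; rewrite subprod_seq dvdzE !absz_nat prime_dvd_prod //.
    by case/mapP => i _ ->.
  by move=> x /mapP [i _ ->]; exact: pq_prime.
have transport j p (p_pr : prime p) c : pp j = p -> cc j = c -> square_mod p_pr c (subprod X A).
  move=> pE <-; have := Agood j; move: (ppr j); rewrite pE => pr'.
  by rewrite (bool_irrelevance pr' p_pr).
have /sub : Selmer' R E (subprod X A).
  apply/(Selmer'P R nat_n_gt0 nE m_coprime3 n_mod8 sqfree_n); split.
  - move=> r r_pr; split=> [|rd]; first exact: X_sq.
    by rewrite dvd_n // inE mem_prod ?orbT.
  - move=> p p_pr pN p1; have pps := split_ps p_pr pN p1.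
    have jl : (index p ps < l)%N by rewrite /l ltn_addr // index_mem.
    by apply: (transport (Ordinal jl)); rewrite /pp /cc /= ?nth_index // index_mem pps.
  - move=> m2 p_pr; have jl : (size ps < l)%N by rewrite /l (epsP m2) addn1.
    by apply: (transport (Ordinal jl)); rewrite /pp /cc /= ?nth_default // ltnn.
(* The product is positive and prime to 3, so among the four trivial elements it could only be 1,
   but [A] is nonempty. *)
have d_ge0 : 0 <= subprod X A by [].
have [i iA] : exists i, i \in A by apply/set0Pn.
have Xi_pr : prime (X i) by exact: pq_prime.
have m_gt0 := nat_m_gt0.
case=> [[[d1|dN]|dm]|d3].
- have : (X i %| subprod X A)%Z by rewrite dvdzE !absz_nat (bigD1 i) //= dvdn_mulr.
  by rewrite d1 prime_dvdz1.
- have := mem_prod 3%N isT; rewrite dN NE dvdz_mull // => /(_ isT).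
  by rewrite (negPf three_notin).
- by move: d_ge0 m_gt0; rewrite dm; clear; lia.
- by move: d_ge0; rewrite d3.
Qed.

Lemma vertices_gt0 M (V1 : {fset int}) : sqfree M -> 0 < M ->
  (V1 `<=` vertices (residue_graph M))%fset -> forall v, v \in V1 -> 0 < v.
Proof.
move=> M_sq M_gt0 V1V v /(fsubsetP V1V) /(vertexP M_sq) [[]|[r [r_pr _ ->]]].
  by rewrite ltNge ltW.
by rewrite ltz_nat prime_gt0.
Qed.

Lemma N_gt0 : 0 < N. Proof. by rewrite ltz_nat nat_n_gt0. Qed.

Lemma ps_vertices (V1 : {fset int}) : {subset V1 <= [seq x%:Z | x <- ps]} ->
  (V1 `<=` vertices (residue_graph N))%fset.
Proof.
move=> V1ps; apply/fsubsetP => v /V1ps /mapP [r rps ->].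
apply/(vertexP sqfree_n); right; exists r; have [r_pr _ _] := ps_pr rps.
by split=> //; exact: ps_dvd.
Qed.

Lemma not_oddN (V1 V2 : {fset int}) : [disjoint V1 & V2]%fset ->
  (V1 `|` V2)%fset = vertices (residue_graph N) ->
  ~ odd_partition (residue_graph N) V1 V2 <-> good' (vertex_prod V1).
Proof. by move=> dis cov; apply: (not_odd_partition sqfree_n dis cov); exact: dvd_n_odd. Qed.

(** A partition that is not odd puts [vertex_prod V1] in S'; being positive it would have to be 1 or
    [n], so a part would be empty. The congruence modulo 3 takes care of the condition at 3. *)
Lemma Selmer'_odd_partition (V1 V2 : {fset int}) : Selmer' R E `<=` T ->
  ((m %% 3 = 2)%N -> (3 %| vertex_prod V1 - 1)%Z) ->
  nontrivial_partition (residue_graph N) V1 V2 -> odd_partition (residue_graph N) V1 V2.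
Proof.
move=> sub three [V10 V20 dis cov]; apply: contrapT => /(not_oddN dis cov) g.
have sub1 : (V1 `<=` vertices (residue_graph N))%fset by rewrite -cov fsubsetUl.
have sub2 : (V2 `<=` vertices (residue_graph N))%fset by rewrite -cov fsubsetUr.
have pos1 := vertices_gt0 sqfree_n N_gt0 sub1; have pos2 := vertices_gt0 sqfree_n N_gt0 sub2.
have dpos := vertex_prod_gt0 pos1.
have m_gt0 := nat_m_gt0; have prodE := partition_prod sqfree_n dis cov.
have /sub : Selmer' R E (vertex_prod V1).
  apply/(Selmer'P R nat_n_gt0 nE m_coprime3 n_mod8 sqfree_n); split=> //.
    exact: (vertex_prod_sqfree_in sqfree_n).
  by move=> m2 p_pr; left; apply: is_square3; exact: three.
case=> [[[d1|dN]|dm]|d3].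
- by move: V10; rewrite (vertex_prod_eq1 sqfree_n sub1 pos1 d1) eqxx.
- suff d2 : vertex_prod V2 = 1.
    by move: V20; rewrite (vertex_prod_eq1 sqfree_n sub2 pos2 d2) eqxx.
  by apply: (mulfI (sqfree_ne0 sqfree_n)); rewrite mulr1 -[in LHS]dN.
- by move: dpos m_gt0; rewrite dm; clear; lia.
- by move: dpos; rewrite d3.
Qed.

Lemma prod_mod3 (s : seq nat) : (forall x, x \in s -> (x %% 3 = 1)%N) ->
  (\prod_(x <- s) x %% 3 = 1)%N.
Proof.
elim: s => [|x s IHs] H; first by rewrite big_nil.
rewrite big_cons -modnMm (H x (mem_head _ _)) IHs // => y ys.
by apply: H; rewrite inE ys orbT.
Qed.

Lemma ps_mod3 (V1 : {fset int}) : {subset V1 <= [seq x%:Z | x <- ps]} ->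
  (3 %| vertex_prod V1 - 1)%Z.
Proof.
move=> V1ps; apply: vertex_prod_mod3 => v /V1ps /mapP [r /ps_pr [_ _ r1] ->].
by move: r1; clear; lia.
Qed.

(** A positive [d] meeting the conditions cuts out a partition that is not odd, so one of its parts
    must be empty. *)
Lemma odd_trivial M d : sqfree M -> 0 < M -> sqfree_in M d -> 0 < d ->
  odd_graph (residue_graph M) -> (forall r : nat, prime r -> (r %| M)%Z -> odd r) ->
  (forall p (p_pr : prime p), (p %| M)%Z -> (p %% 3 = 1)%N -> square_mod p_pr M d) ->
  d = 1 \/ d = M.
Proof.
move=> M_sq M_gt0 dM d_gt0 oddG M_odd g.
have [dis cov] := fset_complement (vertices_sub M_sq dM d_gt0).
have dE := vertex_prod_graph (sqfree_in_sqfree dM).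
set V1 := vertices (residue_graph d) in dis cov dE *.
have [V10|V10] := eqVneq V1 fset0; first by left; rewrite -dE V10 vertex_prod0.
have [V20|V20] := eqVneq (vertices (residue_graph M) `\` V1)%fset fset0.
  by right; rewrite -(vertex_prod_graph M_sq) -cov V20 fsetU0 dE.
have : ~ odd_partition (residue_graph M) V1 (vertices (residue_graph M) `\` V1)%fset.
  by apply/(not_odd_partition M_sq dis cov M_odd); rewrite dE.
by case; apply: oddG; split.
Qed.

Lemma part_I1 : (m %% 3 = 1)%N ->
  Selmer' R E = T <-> size qs = 0%N /\ odd_graph (residue_graph N).
Proof.
move=> m1; rewrite -trivial_eq_sub; split=> [sub|[qs0 oddG]].
  split.
    by apply/eqP; rewrite -leqn0; apply: (@Selmer'_bound false) => //; rewrite m1.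
  by move=> V1 V2; apply: Selmer'_odd_partition => //; rewrite m1.
have pos d : sqfree_in N d -> 0 < d -> good' d -> d = 1 \/ d = N.
  by move=> dN d0 g; apply: (odd_trivial sqfree_n N_gt0) => //; exact: dvd_n_odd.
move=> d /(Selmer'P R nat_n_gt0 nE m_coprime3 n_mod8 sqfree_n) [dN g _].
have [d_gt0|d_le0] := ltP 0 d; first by case: (pos d dN d_gt0 g) => ->; left; left; [left|right].
have d_lt0 : d < 0 by rewrite lt_neqAle d_le0 (sqfree_ne0 (sqfree_in_sqfree dN)).
(* A negative [d] is multiplied by -3, an element of S': the square-free representative is [-d/3] or
   [-3d], which is positive. *)
have [/dvdzP [d' dE]|d3] := boolP (3 %| d)%Z.
  have d'3 : ~~ (3 %| d')%Z.
    by have [+ _] := dN 3%N isT; rewrite dE expr2 dvdz_mul2r.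
  have [] := pos (- d').
  - apply: sqfree_in_N => r r_pr; have [r2 rd] := dN r r_pr; rewrite dE in r2 rd.
    split; first by apply: contra r2 => r2; exact: dvdz_mulr.
    by move=> rd'; apply: rd; exact: dvdz_mulr.
  - by move: d_lt0; rewrite dE; clear; lia.
  - apply: (@good'_mulsqr _ 3) => //; have -> : - d' * 3 ^+ 2 = d * - 3 by rewrite dE; ring.
    by apply: good'M => //; exact: good'N3.
  - by move=> d'1; right; rewrite dE -[d']opprK d'1.
  - move=> d'N; have : (3 %| - d')%Z by rewrite d'N NE dvdz_mull.
    by rewrite rpredN (negPf d'3).
have [] := pos (d * - 3).
- apply: sqfree_inM => //; first exact/sqfree_in_N/sqfree_in_3.
  move=> r r_pr; apply: contraL => r3; have /eqP -> : r == 3%N.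
    by move: r3; rewrite rpredN dvdzE /= dvdn_prime2.
  exact: d3.
- by move: d_lt0; clear; lia.
- by apply: good'M => //; exact: good'N3.
- by clear; lia.
- move=> dNE; left; right; apply: (mulIf (x := 3)) => //.
  by rewrite mulNr -NE -dNE; ring.
Qed.

(** As -1 is not a residue modulo 3 and 3 has odd valuation, neither -1 nor 3 lies in the subgroup
    generated by -3. *)
Lemma three_sign (p_pr : prime 3) (c : int) : c = 1 \/ c = -1 \/ c = 3 \/ c = - 3 ->
  square_mod p_pr (- 3) c -> c = 1 \/ c = - 3.
Proof.
have nsqN1 : ~ is_square (padic p_pr) (-1).
  have n1 : ~~ (3 %| (-1)%R)%Z by [].
  by move=> /(is_square_qres n1) /(qres3 n1).
have nsq3 : ~ is_square (padic p_pr) 3 by apply: is_square_val1.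
move=> [->|[->|[->|->]]] => [|[//|] sq|[//|] sq|]; [by left| | |by right].
- by case: nsq3; move: sq; rewrite mulN1r opprK.
- by case: nsqN1; apply: (@is_square_padic_mulsqr _ _ _ 3).
Qed.

Lemma vertex_prodD1 (W : {fset int}) : (3%R : int) \in W ->
  vertex_prod W = 3 * vertex_prod (W `\ (3%R : int))%fset.
Proof.
move=> W3; rewrite -{1}(fsetD1K W3) vertex_prodU /vertex_prod ?big_seq_fset1 //.
by apply/fdisjointP => x; rewrite !inE => /eqP ->; rewrite eqxx.
Qed.

Lemma sqfree_in_abs M d : sqfree_in M d -> sqfree_in M `|d|.
Proof. by move=> dM; have [d0|d0] := leP 0 d => //; exact: sqfree_in_N. Qed.

Lemma qs_neq0 : (m %% 3 = 2)%N -> size qs != 0%N.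
Proof.
move=> m2; apply/eqP => /size0nil qs0; have := m2.
by rewrite mE qs0 cats0 prod_mod3 // => x /ps_pr [].
Qed.

Lemma part_I2 : (m %% 3 = 2)%N ->
  Selmer' R E = T <-> size qs = 1%N /\
    forall V1 : {fset int}, {subset V1 <= [seq x%:Z | x <- ps]} ->
      nontrivial_partition (residue_graph N) V1 (vertices (residue_graph N) `\` V1)%fset ->
      odd_partition (residue_graph N) V1 (vertices (residue_graph N) `\` V1)%fset.
Proof.
move=> m2; rewrite -trivial_eq_sub; split=> [sub|[qs1 oddG]].
  split.
    apply/eqP; rewrite eqn_leq lt0n qs_neq0 // andbT.
    exact: (@Selmer'_bound true).
  by move=> V1 V1ps; apply: Selmer'_odd_partition => // _; exact: ps_mod3.
have [q qsE] : exists q, qs = [:: q] by case: (qs) qs1 => [|q []] // _; exists q.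
move=> d /(Selmer'P R nat_n_gt0 nE m_coprime3 n_mod8 sqfree_n) [dN g /(_ m2) g3].
have d0 := sqfree_ne0 (sqfree_in_sqfree dN).
have m0 : m%:Z != 0 by have := nat_m_gt0; clear; lia.
have aN := sqfree_in_abs dN; have a_gt0 : 0 < `|d| by rewrite normr_gt0.
have subV := vertices_sub sqfree_n aN a_gt0.
have aE := vertex_prod_graph (sqfree_in_sqfree aN).
set V0 := vertices (residue_graph `|d|) in subV aE.
set V := vertices (residue_graph N) in subV *.
(* Multiplying by [n] passes to the complementary vertex set, so the part avoiding [q] can be
   chosen; deleting 3 then leaves a set [V1] of primes of [ps]. *)
pose W := if q%:Z \in V0 then (V `\` V0)%fset else V0.
have qW : q%:Z \notin W by rewrite /W; case: ifP => [qV|->//]; rewrite inE qV.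
have WV : (W `<=` V)%fset by rewrite /W; case: ifP => // _; exact: fsubsetDl.
pose V1 := (W `\ (3%R : int))%fset.
have V1ps : {subset V1 <= [seq x%:Z | x <- ps]}.
  move=> v; rewrite !inE => /andP [v3 vW].
  have [[]|[r [r_pr rN vE]]] := vertexP sqfree_n _ (fsubsetP WV _ vW).
    by rewrite ltNge ltW // N_gt0.
  subst v; move: rN; rewrite dvd_n // inE mem_cat qsE inE => /or3P [/eqP r3|rp|/eqP rq].
  - by rewrite r3 in v3.
  - exact: map_f.
  - by rewrite rq (negPf qW) in vW.
have V1V := ps_vertices V1ps.
have three_V : (3%R : int) \in V.
  by apply/(vertexP sqfree_n); right; exists 3%N; split=> //; rewrite NE dvdz_mull.
have d1_sq (p_pr : prime 3) : square_mod p_pr (- 3) (vertex_prod V1).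
  by left; apply: is_square3; exact: ps_mod3.
have mm_sq (p_pr : prime 3) : square_mod p_pr (- 3) (- m%:Z).
  by left; apply: is_square3; exact: Nm_mod3.
have WE : vertex_prod W = vertex_prod V1 \/ vertex_prod W = 3 * vertex_prod V1.
  have [W3|W3] := boolP ((3%R : int) \in W); first by right; exact: vertex_prodD1.
  by left; rewrite /V1 mem_fsetD1.
have WaE : vertex_prod W = `|d| \/ `|d| * vertex_prod W = N.
  rewrite /W; case: ifP => _; last by left.
  have [dis cov] := fset_complement subV.
  by right; rewrite -[X in X * _]aE (partition_prod sqfree_n dis cov).
set d1 := vertex_prod V1 in d1_sq WE *.
have d1_ne0 : d1 != 0 := sqfree_ne0 (sqfree_in_sqfree (vertex_prod_sqfree_in sqfree_n V1V)).
have dE : d = `|d| \/ d = - `|d| by move: d0; clear; lia.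
(* [c] collects the sign and the factor 3 lost between [d] and [d1]; the second alternative is the
   complementary case. *)
have [c cE dc] : exists2 c : int, c = 1 \/ c = -1 \/ c = 3 \/ c = - 3 &
    d = c * d1 \/ d * d1 = - m%:Z * c.
  have NE' := NE; move: (vertex_prod W) `|d| WE WaE dE NE' => w a.
  case=> -> [aE'|aE'] dE NE'.
  - by case: dE => ->; [exists 1|exists (-1)]; auto; left; rewrite -aE'; ring.
  - case: dE => ->; [exists (- 3)|exists 3]; auto; right;
      rewrite ?mulNr aE' NE'; ring.
  - by case: dE => ->; [exists 3|exists (- 3)]; auto; left; rewrite -aE'; ring.
  - have aE3 : a * d1 = m%:Z.
      by apply: (mulIf (x := 3)) => //; rewrite -NE' -aE'; ring.
    by case: dE => ->; [exists (-1)|exists 1]; auto; right; rewrite ?mulNr aE3; ring.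
(* [d1] and [- m] are 1 mod 3, hence squares at 3, so [c] inherits from [d] the condition at 3. *)
have {cE} cE : c = 1 \/ c = - 3.
  apply: (@three_sign isT) => //; case: dc => dc.
    apply: (square_mod_mulsqr d1_ne0); have -> : c * d1 ^+ 2 = d * d1 by rewrite dc; ring.
    exact: square_modM.
  apply: (square_mod_mulsqr m0); have -> : c * m%:Z ^+ 2 = d * d1 * - m%:Z by rewrite dc; ring.
  by apply: square_modM => //; exact: square_modM.
have gc : good' c by case: cE => ->; [exact: good'1|exact: good'N3].
have g1 : good' d1.
  case: dc => dc.
    have c0 : c != 0 by case: cE => ->.
    apply: (good'_mulsqr c0); have -> : d1 * c ^+ 2 = d * c by rewrite dc; ring.
    exact: good'M.
  apply: (good'_mulsqr d0); have -> : d1 * d ^+ 2 = d * (- m%:Z * c) by rewrite -dc; ring.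
  by apply: good'M => //; apply: good'M => //; exact: good'Nm.
have d11 : d1 = 1.
  have [dis cov] := fset_complement V1V.
  have [V10|V10] := eqVneq V1 fset0; first by rewrite /d1 V10 vertex_prod0.
  exfalso; move/(not_oddN dis cov): g1; apply; apply: oddG => //; split=> //.
  by apply/fset0Pn; exists (3%R : int); rewrite in_fsetD three_V andbT in_fsetD1 eqxx.
rewrite d11 !mulr1 in dc; case: dc => ->; case: cE => ->.
- by left; left; left.
- by right.
- by left; right; rewrite mulr1.
- by left; left; right; rewrite NE; ring.
Qed.

(** * The group S *)

Lemma Selmer1 : Selmer R E 1.
Proof.
apply/(SelmerP R nat_n_gt0 nE m_coprime3 n_mod8 sqfree_n); split=> //.
- exact: sqfree_in1.
- by move=> p p_pr _ _; left; exact: is_square1.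
- by move=> p p_pr _ _; exact: is_square1.
- by move=> p_pr; left; exact: is_square1.
Qed.

Lemma Selmer_eq1 : Selmer R E `<=` [set 1] <-> Selmer R E = [set 1].
Proof.
by split=> [sub|->//]; apply/seteqP; split=> // _ ->; exact: Selmer1.
Qed.

Lemma split_dvd_m p : prime p -> (p %| N)%Z -> (p %% 3 = 1)%N -> (p %| m%:Z)%Z.
Proof. by move=> p_pr pN p1; rewrite dvd_m // mem_cat (split_ps p_pr pN p1). Qed.

Lemma dvd_m_n p : (p %| m%:Z)%Z -> (p %| N)%Z.
Proof. by move=> pm; rewrite NE dvdz_mulr. Qed.

(** At these primes -3 is a square, so [-n = -3m] and [m] have the same class; this is why the graph
    of [m] occurs. *)
Lemma good_m d : good d <->
  forall p (p_pr : prime p), (p %| m%:Z)%Z -> (p %% 3 = 1)%N -> square_mod p_pr m%:Z d.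
Proof.
split=> g p p_pr pN p1.
  have pN' := dvd_m_n pN; apply: (@square_mod_base_sqr _ _ _ _ 3) => //.
  have -> : m%:Z * 3 ^+ 2 = - N * - 3 by rewrite NE; ring.
  apply: square_mod_base; [apply: split_N3 => //; exact: dvd_n_odd pN'|exact: g].
have -> : - N = m%:Z * - 3 by rewrite NE; ring.
apply: square_mod_base; first by apply: split_N3 => //; exact: dvd_n_odd pN.
by apply: g => //; exact: split_dvd_m.
Qed.

Lemma mul_mod4 (a b : int) : (4 %| a * b - 3)%Z -> (4 %| a - 1)%Z \/ (4 %| b - 1)%Z.
Proof.
clear; have four (x : int) : exists y, [\/ x = 4 * y, x = 4 * y + 1, x = 4 * y + 2 | x = 4 * y + 3].
  have : x = 4 * (x %/ 4)%Z \/ x = 4 * (x %/ 4)%Z + 1 \/ x = 4 * (x %/ 4)%Z + 2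
    \/ x = 4 * (x %/ 4)%Z + 3 by lia.
  move=> H; exists (x %/ 4)%Z.
  by case: H => [|[|[|]]] ?; [constructor 1|constructor 2|constructor 3|constructor 4].
have [x xE] := four a; have [y yE] := four b.
have cong (r s : int) : a = 4 * x + r -> b = 4 * y + s ->
    a * b - 3 = 4 * (4 * (x * y) + x * s + r * y) + (r * s - 3) by move=> -> ->; ring.
case: xE => xE; last 1 first; try by left; rewrite xE addrK dvdz_mulr.
- case: yE => yE; try by right; rewrite yE addrK dvdz_mulr.
  + by rewrite (cong 3 0) ?addr0 //; move: (x * y) => xy; lia.
  + by rewrite (cong 3 2) //; move: (x * y) => xy; lia.
  + by rewrite (cong 3 3) //; move: (x * y) => xy; lia.
- case: yE => yE; try by right; rewrite yE addrK dvdz_mulr.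
  + by rewrite (cong 0 0) ?addr0 //; move: (x * y) => xy; lia.
  + by rewrite (cong 0 2) ?addr0 //; move: (x * y) => xy; lia.
  + by rewrite (cong 0 3) ?addr0 //; move: (x * y) => xy; lia.
- case: yE => yE; try by right; rewrite yE addrK dvdz_mulr.
  + by rewrite (cong 2 0) ?addr0 //; move: (x * y) => xy; lia.
  + by rewrite (cong 2 2) //; move: (x * y) => xy; lia.
  + by rewrite (cong 2 3) //; move: (x * y) => xy; lia.
Qed.

(** For [n] equal to 3 or 15 mod 24, [m] is 1 mod 4 and is itself a nontrivial element of S. For
    [n = 9] mod 24, [m = 3] mod 4, so of two complementary divisors exactly one is 1 mod 4, and
    every partition is tested by one of its parts. *)
Lemma part_II1 : size qs = 0%N -> (0 < size ps)%N ->
  Selmer R E = [set 1] <-> (n %% 24 = 9)%N /\ odd_graph (residue_graph m%:Z).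
Proof.
move=> /size0nil qs0 ps0; rewrite -Selmer_eq1.
have m_gt0 : 0 < m%:Z by rewrite ltz_nat nat_m_gt0.
have m_ne1 : m%:Z != 1.
  apply/eqP => m1; have [r rps] : exists r, r \in ps.
    by case: (ps) ps0 => // r l _; exists r; rewrite mem_head.
  have [r_pr _ r1] := ps_pr rps.
  by have := dvd_m r_pr; rewrite mem_cat rps m1 prime_dvdz1.
have m1 : (m %% 3 = 1)%N by rewrite mE qs0 cats0; apply: prod_mod3 => x /ps_pr [].
have Vps (V1 : {fset int}) : (V1 `<=` vertices (residue_graph m%:Z))%fset ->
    {subset V1 <= [seq x%:Z | x <- ps]}.
  move=> V1V v /(fsubsetP V1V) /(vertexP sqfree_m) [[]|[r [r_pr rm ->]]].
    by rewrite ltNge ltW.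
  by apply: map_f; move: rm; rewrite dvd_m // qs0 cats0.
have memS (V1 : {fset int}) : (V1 `<=` vertices (residue_graph m%:Z))%fset ->
    (4 %| vertex_prod V1 - 1)%Z -> good (vertex_prod V1) -> Selmer R E (vertex_prod V1).
  move=> V1V d4 g; apply/(SelmerP R nat_n_gt0 nE m_coprime3 n_mod8 sqfree_n); split=> //.
  - by split=> //; apply: vertex_prod_gt0; exact: (vertices_gt0 sqfree_m).
  - by apply: (vertex_prod_sqfree_in sqfree_n); apply: ps_vertices; exact: Vps.
  - by move=> p p_pr pN p2; have := inert_qs p_pr pN p2; rewrite qs0.
  - by move=> p_pr; left; apply: is_square3; apply: ps_mod3; exact: Vps.
have m_odd r : prime r -> (r %| m%:Z)%Z -> odd r.
  by move=> r_pr /dvd_m_n; exact: dvd_n_odd.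
have nm24 : (4 %| m%:Z - 1)%Z \/ (n %% 24 = 9)%N /\ (4 %| m%:Z - 3)%Z.
  move: n24; rewrite nE !inE; clear; move=> /or3P [] /eqP e; [left|right|left]; lia.
split=> [sub|[n9 oddG]].
  have [m4|[n9 m4]] := nm24.
    exfalso; move/eqP: m_ne1; apply.
    have /memS := fsubset_refl (vertices (residue_graph m%:Z)).
    rewrite (vertex_prod_graph sqfree_m) => /(_ m4) H; apply: sub; apply: H.
    by apply/good_m => p p_pr _ _; right; rewrite -expr2; exact: is_square_sqr.
  split=> // V1 V2 [V10 V20 dis cov]; apply: contrapT => nodd.
  have sub1 : (V1 `<=` vertices (residue_graph m%:Z))%fset by rewrite -cov fsubsetUl.
  have sub2 : (V2 `<=` vertices (residue_graph m%:Z))%fset by rewrite -cov fsubsetUr.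
  have pos1 := vertices_gt0 sqfree_m m_gt0 sub1; have pos2 := vertices_gt0 sqfree_m m_gt0 sub2.
  have g1 : good (vertex_prod V1).
    by apply/good_m; apply/(not_odd_partition sqfree_m dis cov m_odd).
  have g2 : good (vertex_prod V2).
    have dis' : [disjoint V2 & V1]%fset by rewrite fdisjoint_sym.
    have cov' : (V2 `|` V1)%fset = vertices (residue_graph m%:Z) by rewrite fsetUC.
    apply/good_m; apply/(not_odd_partition sqfree_m dis' cov' m_odd).
    by move=> /odd_partitionC.
  have := mul_mod4 (a := vertex_prod V1) (b := vertex_prod V2).
  rewrite (partition_prod sqfree_m dis cov) => /(_ m4) [d4|d4].
    by move: V10; rewrite (vertex_prod_eq1 sqfree_m sub1 pos1 (sub _ (memS _ sub1 d4 g1))) eqxx.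
  by move: V20; rewrite (vertex_prod_eq1 sqfree_m sub2 pos2 (sub _ (memS _ sub2 d4 g2))) eqxx.
move=> d /(SelmerP R nat_n_gt0 nE m_coprime3 n_mod8 sqfree_n) [[d_gt0 d4] dN g _ loc3].
have sq3 : is_square (padic (isT : prime 3)) d by case: (loc3 isT) => // -[]; rewrite m1.
have d3 : ~~ (3 %| d)%Z.
  by apply/negP => d3; exact: is_square_val1 d3 (dN 3%N isT).1 sq3.
have dm : sqfree_in m%:Z d.
  move=> r r_pr; have [r2 rd] := dN r r_pr; split=> // r_d.
  move: (rd r_d); rewrite dvd_n // dvd_m // inE => /predU1P [r3|//].
  by rewrite r3 in r_d; rewrite r_d in d3.
have [//|dE] : d = 1 \/ d = m%:Z.
  by apply: (odd_trivial sqfree_m) => //; exact/good_m.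
case: nm24 => [m4|[_ m4]]; last by exfalso; move: d4 m4; rewrite dE; clear; lia.
by exfalso; move: n9 m4; rewrite nE; clear; lia.
Qed.

(** The congruence modulo 4 and the symbol at [q] are the conditions at 2 and [q]; at 3, the product
    of [V1] is 1 mod 3 up to a factor 3, which suffices for [m = 2] mod 3. The vertices -1 and [q]
    always lie in the complement. *)
Lemma part_II2 : (m %% 3 = 2)%N -> forall q, qs = [:: q] ->
  Selmer R E = [set 1] <->
    forall V1 : {fset int}, {subset V1 <= 3 :: [seq x%:Z | x <- ps]} ->
      (vertex_prod V1 = 1 %[mod 4])%Z -> legendre (vertex_prod V1) q = 1 ->
      nontrivial_partition (residue_graph (- N)) V1
        (vertices (residue_graph (- N)) `\` V1)%fset ->
      odd_partition (residue_graph (- N)) V1 (vertices (residue_graph (- N)) `\` V1)%fset.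
Proof.
move=> m2 q qsE; rewrite -Selmer_eq1.
have q_in : q \in qs by rewrite qsE mem_head.
have [q_pr q_odd q2] := qs_pr q_in.
have N_odd r : prime r -> (r %| - N)%Z -> odd r.
  by move=> r_pr; rewrite rpredN; exact: dvd_n_odd.
have goodE d : good d <-> forall p (p_pr : prime p),
    (p %| - N)%Z -> (p %% 3 = 1)%N -> square_mod p_pr (- N) d.
  by split=> g p p_pr; [rewrite rpredN; exact: g|rewrite -rpredN; exact: g].
have mod4E d : (d = 1 %[mod 4])%Z <-> (4 %| d - 1)%Z.
  by rewrite -eqz_mod_dvd; split=> [->|/eqP].
split=> [sub V1 V1ps /mod4E d4 /(legendre_eq1 _ q_pr) [qd qrd] [V10 V20 dis cov]|oddG d].
  apply: contrapT => nodd.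
  have sub1 : (V1 `<=` vertices (residue_graph (- N)))%fset by rewrite -cov fsubsetUl.
  have pos1 v : v \in V1 -> 0 < v.
    move=> /V1ps; rewrite inE => /predU1P [->//|/mapP [r /ps_pr [r_pr _ _] ->]].
    by rewrite ltz_nat prime_gt0.
  have g1 : good (vertex_prod V1) by apply/goodE/(not_odd_partition sqfree_Nn dis cov N_odd).
  suff /sub d1 : Selmer R E (vertex_prod V1).
    by move: V10; rewrite (vertex_prod_eq1 sqfree_Nn sub1 pos1 d1) eqxx.
  apply/(SelmerP R nat_n_gt0 nE m_coprime3 n_mod8 sqfree_n); split=> //.
  - by split=> //; exact: vertex_prod_gt0.
  - move=> r r_pr; have := vertex_prod_sqfree_in sqfree_Nn sub1 r_pr.
    by rewrite [(r %| - N)%Z]rpredN.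
  - move=> p p_pr pN p2; have := inert_qs p_pr pN p2; rewrite qsE inE => /eqP pq.
    by subst p; exact: is_square_odd.
  - move=> p_pr; have [V13|V13] := boolP ((3%R : int) \in V1).
      right; split=> //; rewrite vertex_prodD1 //.
      set d1 := vertex_prod _.
      apply: (@is_square3_mul9 _ d1); first by ring.
      apply: ps_mod3 => v; rewrite !inE => /andP [v3 /V1ps].
      by rewrite inE (negPf v3).
    left; apply: is_square3; apply: ps_mod3 => v vV; have := V1ps v vV.
    by rewrite inE => /predU1P [v3|//]; rewrite v3 (negPf V13) in vV.
move=> /(SelmerP R nat_n_gt0 nE m_coprime3 n_mod8 sqfree_n) [[d_gt0 d4] dN g gq _].
have qN : (q %| N)%Z by rewrite dvd_n // inE mem_cat q_in !orbT.
have sqq := gq q q_pr qN q2.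
have qd : ~~ (q %| d)%Z.
  by apply/negP => qd; exact: is_square_val1 qd (dN q q_pr).1 sqq.
have dNn : sqfree_in (- N) d.
  by move=> r r_pr; rewrite [(r %| - N)%Z]rpredN; exact: dN.
have d_sq := sqfree_in_sqfree dN.
have subV := vertices_sub sqfree_Nn dNn d_gt0.
have [dis cov] := fset_complement subV.
have dE := vertex_prod_graph d_sq.
have [V10|V10] := eqVneq (vertices (residue_graph d)) fset0.
  by rewrite /= -dE V10 vertex_prod0.
exfalso; have : good (vertex_prod (vertices (residue_graph d))) by rewrite dE.
move=> /goodE/(not_odd_partition sqfree_Nn dis cov N_odd).
apply; apply: oddG.
- move=> v /(vertexP d_sq) [[]|[r [r_pr rd ->]]]; first by rewrite ltNge ltW.
  have := (dN r r_pr).2 rd; rewrite dvd_n // inE mem_cat qsE inE => /or3P [/eqP ->|rp|/eqP rq].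
  + by rewrite mem_head.
  + by rewrite inE map_f ?orbT.
  + by move: qd; rewrite -rq rd.
- by rewrite dE; exact/mod4E.
- by rewrite dE; apply/(legendre_eq1 _ q_pr); split=> //; exact: is_square_qres sqq.
- split=> //; apply/fset0Pn; exists (-1); rewrite in_fsetD; apply/andP; split.
    apply/negP => /(vertexP d_sq) [[]|[r [_ _]]]; first by rewrite ltNge ltW.
    by [].
  by apply/(vertexP sqfree_Nn); left; rewrite oppr_lt0 N_gt0.
Qed.

End Main.

Theorem theorem5p1 (R : realType) (t s : nat)
    (p : t.-tuple nat) (q : s.-tuple nat) (n P Q : nat)
    (p_prime : forall x, x \in p -> prime x /\ odd x /\ x = 1 %[mod 3])
    (q_prime : forall x, x \in q -> prime x /\ odd x /\ x = 2 %[mod 3])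
    (pq_distinct : uniq (p ++ q))
    (ts_ge1 : (1 <= t + s)%N)
    (defP : P = (\prod_(x <- p) x)%N)
    (defQ : Q = (\prod_(x <- q) x)%N)
    (defn : n = (3 * P * Q)%N)
    (n_mod24 : (n %% 24)%N \in [:: 3; 9; 15]%N) :
  let E := curve_pi3 n in
  let S := Selmer R E in
  let S' := Selmer' R E in
  let V := vertices (residue_graph n%:Z) in
  let W := vertices (residue_graph (- n%:Z)) in
  [/\ (P * Q = 1 %[mod 3])%N ->
        (S' = [set 1; n%:Z; - (n %/ 3)%:Z; - 3] <->
         s = 0%N /\ odd_graph (residue_graph n%:Z)),
      (P * Q = 2 %[mod 3])%N ->
        (S' = [set 1; n%:Z; - (n %/ 3)%:Z; - 3] <->
         s = 1%N /\
         forall V1 : {fset int},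
           {subset V1 <= [seq x%:Z | x <- p]} ->
           nontrivial_partition (residue_graph n%:Z) V1 (V `\` V1)%fset ->
           odd_partition (residue_graph n%:Z) V1 (V `\` V1)%fset),
      (P * Q = 1 %[mod 3])%N -> s = 0%N ->
        (S = [set 1] <->
         n = 9 %[mod 24] /\ odd_graph (residue_graph (n %/ 3)%:Z))
    & (P * Q = 2 %[mod 3])%N -> s = 1%N ->
        (S = [set 1] <->
         forall V1 : {fset int},
           {subset V1 <= 3 :: [seq x%:Z | x <- p]} ->
           (vertex_prod V1 = 1 %[mod 4])%Z ->
           legendre (vertex_prod V1) (nth 0%N q 0) = 1 ->
           nontrivial_partition (residue_graph (- n%:Z)) V1 (W `\` V1)%fset ->
           odd_partition (residue_graph (- n%:Z)) V1 (W `\` V1)%fset)].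
Proof.
have ps_pr x : x \in tval p -> [/\ prime x, odd x & (x %% 3 = 1)%N].
  by move=> /p_prime [x_pr [x_odd x1]].
have qs_pr x : x \in tval q -> [/\ prime x, odd x & (x %% 3 = 2)%N].
  by move=> /q_prime [x_pr [x_odd x2]].
have mE : (P * Q = \prod_(x <- tval p ++ tval q) x)%N by rewrite big_cat -defP -defQ.
have nE : n = (3 * (P * Q))%N by rewrite mulnA.
have n3 : (n %/ 3)%N = (P * Q)%N by rewrite nE mulKn.
move=> E S S' V W; rewrite n3; split=> PQ.
- by rewrite (part_I1 R ps_pr qs_pr pq_distinct mE nE n_mod24 PQ) size_tuple.
- by rewrite (part_I2 R ps_pr qs_pr pq_distinct mE nE n_mod24 PQ) size_tuple.
- move=> s0; apply: (part_II1 R ps_pr qs_pr pq_distinct mE nE n_mod24).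
    by rewrite size_tuple.
  by rewrite size_tuple; move: ts_ge1; rewrite s0 addn0.
- move=> s1; apply: (part_II2 R ps_pr qs_pr pq_distinct mE nE n_mod24 PQ).
  by have := etrans (size_tuple q) s1; case: (tval q) => [|x []].
Qed.
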